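(* Let $f$ be an entire function of order $1$ which is real on the real axis and has only real zeros, and let $(z_n)$ denote the zeros of $f$ listed in increasing order (repeated according to multiplicity). Let $a\in\mathbb{R}$. If $q<p$ are consecutive zeros of $f'+af$, then $$\inf_n (z_{n+1}-z_n)\le p-q\le \sup_n (z_{n+1}-z_n).$$ Moreover, if the zeros of $f$ are simple and equality holds in one of these two inequalities, then equality also holds in the other, and $f(z)=Ae^{Bz}\cos(Cz+D)$ for some real constants $A,B,C,D$.
   Context: An entire function $f$ has order $\rho$ if $\limsup_{r\to\infty}\frac{\log\log M(r)}{\log r}=\rho$, where $M(r)=\max_{|z|=r}|f(z)|$.
   Formalization: If the zeros of f are bounded above or below, the list is continued by ±∞ and +∞ counts as a gap, so the sup is +∞ and the upper bound is void there; with finite gaps only it fails, e.g. f=(z²−1)e^z, a=0: the gap of f is 2, but p−q=2√2. *)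

(* Defs.v *)
From Stdlib Require Import Reals ZArith List.
From Coquelicot Require Import Coquelicot.

Open Scope R_scope.

Definition entire (f : C -> C) : Prop :=
  forall w : C, @ex_derive C_AbsRing C_NormedModule f w.

Definition max_modulus (f : C -> C) (r : R) : R :=
  real (Lub_Rbar (fun m : R => exists w : C, Cmod w = r /\ m = Cmod (f w))).

(* [limsup_{r -> +oo} g r = l] for a finite [l]; same shape as the finite case
   of Coquelicot's [is_LimSup_seq]. *)
Definition is_LimSup_p_infty (g : R -> R) (l : R) : Prop :=
  forall eps : posreal,
    (forall r0 : R, exists r : R, r0 <= r /\ l - eps < g r) /\
    (exists r0 : R, forall r : R, r0 <= r -> g r < l + eps).

(* Stdlib's [ln] vanishes on nonpositive reals.  This affects only constant
   [f], since otherwise [max_modulus f r > 1] for large [r]; constants get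
   order 0. *)
Definition has_order (f : C -> C) (rho : R) : Prop :=
  is_LimSup_p_infty (fun r : R => ln (ln (max_modulus f r)) / ln r) rho.

(* [m = 0] means that [w0] is not a zero of [f]. *)
Definition has_multiplicity (f : C -> C) (w0 : C) (m : nat) : Prop :=
  exists g : C -> C,
    entire g /\ g w0 <> 0%C /\
    forall w : C, f w = (Cpow (w - w0) m * g w)%C.

(* The zeros of [f], assumed real, in increasing order and repeated according
   to multiplicity.  Indexing by [Z] covers all cases: when the zeros are
   bounded below (above), the sequence is continued by [m_infty] on the left
   ([p_infty] on the right). *)
Definition lists_zeros (f : C -> C) (z : Z -> Rbar) : Prop :=
  (forall n : Z, Rbar_le (z n) (z (n + 1)%Z)) /\
  (forall x : R, exists l : list Z,
     NoDup l /\
     (forall n : Z, In n l <-> z n = Finite x) /\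
     has_multiplicity f (RtoC x) (length l)).

(* The values [z_{n+1} - z_n].  Steps between two infinite terms are excluded;
   a step from a last zero to [p_infty], or from [m_infty] to a first zero,
   has length [p_infty]. *)
Definition zero_gap (z : Z -> Rbar) (d : Rbar) : Prop :=
  exists n : Z,
    (is_finite (z n) \/ is_finite (z (n + 1)%Z)) /\
    d = Rbar_minus (z (n + 1)%Z) (z n).

Definition consecutive_real_zeros (h : C -> C) (q p : R) : Prop :=
  q < p /\ h (RtoC q) = 0%C /\ h (RtoC p) = 0%C /\
  forall x : R, q < x < p -> h (RtoC x) <> 0%C.

Definition Cexp (w : C) : C :=
  (exp (Re w) * cos (Im w), exp (Re w) * sin (Im w)).

Definition Ccos (w : C) : C :=
  ((Cexp (Ci * w) + Cexp (- (Ci * w))) / 2)%C.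

(* Main.v *)
(** Let [q < p] be consecutive zeros of [f' + a f] which are not zeros of [f].
    Rolle's theorem for [exp (a x) f x] shows that exactly one zero of [f] lies between
    them.  As [f] has order less than 2, [f'/f p - f'/f q] is the limit of the sums of
    [1/(p - z_n) - 1/(q - z_n)] over [|z_n| <= r], so these sums tend to 0.  Shifting the
    second term by one index changes a sum only at its two ends and pairs [p - z_(n+1)]
    with [q - z_n], which have the same sign and differ by [p - q - (z_(n+1) - z_n)].  If
    all gaps are at least (or all at most) [p - q], then all the paired terms have one
    sign, hence they all vanish and all gaps are equal to [p - q].  In that case [f] has
    the zeros of a cosine, and the same limit formula for both functions shows that
    their logarithmic derivatives differ by a constant.

    The limit formula is Landau's: divide [f] by the linear factors of the zeros in a large
    disc and apply the Borel-Caratheodory inequality to a logarithm of the quotient. *)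

Require Import Defs.
From Stdlib Require Import Reals ZArith List.
From Coquelicot Require Import Coquelicot.
From Stdlib Require Import Lra Lia Classical ClassicalEpsilon.
Open Scope R_scope.

(** * Complex differentiability *)

(** Rolle's theorem only shows that [f] has at most one zero in [(q, p)], counted with multiplicity.
    That there is one comes from the limit formula: otherwise all terms of the sums would have the
    same strict sign. If [q] or [p] is itself a zero of [f], it is a multiple one and needs a
    separate argument: it produces a gap 0, and Rolle's theorem keeps the neighbouring zero at
    distance at least [p - q].

    The two inequalities are not mirror images. When the gaps are large, the two end terms of the
    shifted sum have the sign of the paired terms and must tend to 0 with them, which excludes a
    first or a last zero. When the gaps are small, the end terms have the opposite sign; but then no
    gap is infinite, so the zeros are unbounded on both sides and the end terms tend to 0.

    The complex analysis rests on one estimate, the bound of [Re (F c)] by the values of [Re F] on a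
    circle around [c]. It asks only for continuity of [F] at [c] itself, so that difference
    quotients at [c] are admissible; Cauchy's estimate and the Borel-Caratheodory inequality are
    instances of it. *)

Lemma Cmod_triangle_inv (x y : C) : Cmod x - Cmod y <= Cmod (x - y)%C.
Proof.
  replace x with ((x - y) + y)%C at 1 by ring.
  pose proof (Cmod_triangle (x - y) y). lra.
Qed.

Lemma Cmod_minus_sym (x y : C) : Cmod (x - y)%C = Cmod (y - x)%C.
Proof. rewrite <- Cmod_opp. f_equal. ring. Qed.

Lemma Cmod_minus_diag (x : C) : Cmod (x - x)%C = 0.
Proof. replace (x - x)%C with (RtoC 0) by ring. apply Cmod_0. Qed.

Lemma Im_le_Cmod (w : C) : Rabs (Im w) <= Cmod w.
Proof. eapply Rle_trans. 2: apply Rmax_Cmod. apply Rmax_r. Qed.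

Lemma Cmod_le_Re_Im (w : C) : Cmod w <= Rabs (Re w) + Rabs (Im w).
Proof.
  rewrite <- (Rabs_pos_eq (Cmod w)) by apply Cmod_ge_0.
  rewrite <- (Rabs_pos_eq (Rabs (Re w) + Rabs (Im w)))
    by (pose proof (Rabs_pos (Re w)); pose proof (Rabs_pos (Im w)); lra).
  apply Rsqr_le_abs_0. rewrite !Rsqr_pow2, Cmod2_alt.
  rewrite <- (pow2_abs (Re w)), <- (pow2_abs (Im w)).
  pose proof (Rabs_pos (Re w)); pose proof (Rabs_pos (Im w)). nra.
Qed.

Definition ccont (f : C -> C) (w : C) : Prop :=
  forall eps, 0 < eps -> exists del, 0 < del /\
    forall v, Cmod (v - w) < del -> Cmod (f v - f w) < eps.

(* Caratheodory's form of differentiability: the slope [psi] is continuous at [w]. *)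
Definition cderiv (f : C -> C) (w l : C) : Prop :=
  exists (psi : C -> C) (del : R), 0 < del /\
    (forall v, Cmod (v - w) < del -> f v = (f w + psi v * (v - w))%C) /\
    ccont psi w /\ psi w = l.

Lemma ccont_const (k w : C) : ccont (fun _ => k) w.
Proof. intros e He. exists 1. split. lra. intros. rewrite Cmod_minus_diag. lra. Qed.

Lemma ccont_id (w : C) : ccont (fun v => v) w.
Proof. intros e He. exists e. auto. Qed.

Lemma ccont_ext_loc (f g : C -> C) (w : C) (d : R) :
  0 < d -> (forall v, Cmod (v - w) < d -> f v = g v) -> ccont f w -> ccont g w.
Proof.
  intros Hd E H e He. destruct (H e He) as [d' [H1 H2]].
  exists (Rmin d d'). split. now apply Rmin_glb_lt.
  intros v Hv. rewrite <- !E. apply H2.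
  eapply Rlt_le_trans. apply Hv. apply Rmin_r.
  rewrite Cmod_minus_diag; auto.
  eapply Rlt_le_trans. apply Hv. apply Rmin_l.
Qed.

Lemma ccont_plus (f g : C -> C) (w : C) :
  ccont f w -> ccont g w -> ccont (fun v => (f v + g v)%C) w.
Proof.
  intros Hf Hg e He.
  destruct (Hf (e/2)) as [d1 [P1 Q1]]. lra.
  destruct (Hg (e/2)) as [d2 [P2 Q2]]. lra.
  exists (Rmin d1 d2). split. now apply Rmin_glb_lt.
  intros v Hv. replace (f v + g v - (f w + g w))%C with ((f v - f w) + (g v - g w))%C by ring.
  eapply Rle_lt_trans. apply Cmod_triangle.
  pose proof (Q1 v (Rlt_le_trans _ _ _ Hv (Rmin_l _ _))).
  pose proof (Q2 v (Rlt_le_trans _ _ _ Hv (Rmin_r _ _))). lra.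
Qed.

Lemma ccont_mult (f g : C -> C) (w : C) :
  ccont f w -> ccont g w -> ccont (fun v => (f v * g v)%C) w.
Proof.
  intros Hf Hg e He.
  set (A := Cmod (f w)). set (B := Cmod (g w)).
  assert (HA : 0 <= A) by apply Cmod_ge_0. assert (HB : 0 <= B) by apply Cmod_ge_0.
  set (k := Rmin 1 (e / (A + B + 1))).
  assert (Hk : 0 < k). { apply Rmin_glb_lt. lra. apply Rdiv_lt_0_compat; lra. }
  destruct (Hf k Hk) as [d1 [P1 Q1]].
  destruct (Hg k Hk) as [d2 [P2 Q2]].
  exists (Rmin d1 d2). split. now apply Rmin_glb_lt.
  intros v Hv.
  pose proof (Q1 v (Rlt_le_trans _ _ _ Hv (Rmin_l _ _))) as R1.
  pose proof (Q2 v (Rlt_le_trans _ _ _ Hv (Rmin_r _ _))) as R2.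
  replace (f v * g v - f w * g w)%C with
    ((f v - f w) * (g v - g w) + (f w * (g v - g w) + (f v - f w) * g w))%C by ring.
  eapply Rle_lt_trans. apply Cmod_triangle.
  eapply Rle_lt_trans. apply Rplus_le_compat_l. apply Cmod_triangle.
  rewrite !Cmod_mult. fold A B.
  assert (k <= 1) by apply Rmin_l.
  assert (k * (A + B + 1) <= e).
  { assert (k <= e / (A + B + 1)) by apply Rmin_r.
    apply Rmult_le_compat_r with (r := A + B + 1) in H0; [|lra].
    replace (e / (A + B + 1) * (A + B + 1)) with e in H0 by (field; lra). exact H0. }
  pose proof (Cmod_ge_0 (f v - f w)). pose proof (Cmod_ge_0 (g v - g w)).
  set (x := Cmod (f v - f w)) in *. set (y := Cmod (g v - g w)) in *.
  assert (x * y < k). { apply Rle_lt_trans with (x * 1). apply Rmult_le_compat_l; lra. lra. }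
  assert (A * y <= A * k) by (apply Rmult_le_compat_l; lra).
  assert (x * B <= k * B) by (apply Rmult_le_compat_r; lra).
  lra.
Qed.

Lemma ccont_opp (f : C -> C) (w : C) : ccont f w -> ccont (fun v => (- f v)%C) w.
Proof.
  intros H e He. destruct (H e He) as [d [P Q]]. exists d. split; auto.
  intros v Hv. replace (- f v - - f w)%C with (- (f v - f w))%C by ring.
  rewrite Cmod_opp. auto.
Qed.

Lemma ccont_minus (f g : C -> C) (w : C) :
  ccont f w -> ccont g w -> ccont (fun v => (f v - g v)%C) w.
Proof. intros Hf Hg. apply ccont_plus; auto. now apply ccont_opp. Qed.

Lemma ccont_nz_loc (f : C -> C) (w : C) :
  ccont f w -> f w <> RtoC 0 -> exists d, 0 < d /\ forall v, Cmod (v - w) < d ->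
    f v <> 0%C /\ Cmod (f w) / 2 < Cmod (f v).
Proof.
  intros H N. assert (0 < Cmod (f w)) by now apply Cmod_gt_0.
  destruct (H (Cmod (f w) / 2)) as [d [P Q]]. lra.
  exists d. split; auto. intros v Hv. specialize (Q v Hv).
  pose proof (Cmod_triangle_inv (f w) (f w - f v)).
  replace (f w - (f w - f v))%C with (f v) in H1 by ring.
  rewrite Cmod_minus_sym in Q. split; [|lra].
  apply Cmod_gt_0. lra.
Qed.

Lemma ccont_inv (f : C -> C) (w : C) :
  ccont f w -> f w <> RtoC 0 -> ccont (fun v => (/ f v)%C) w.
Proof.
  intros H N e He. assert (HA : 0 < Cmod (f w)) by now apply Cmod_gt_0.
  destruct (ccont_nz_loc f w H N) as [d1 [P1 Q1]].
  set (A := Cmod (f w)) in *.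
  destruct (H (e * (A * A / 2))) as [d2 [P2 Q2]].
  { apply Rmult_lt_0_compat; auto. nra. }
  exists (Rmin d1 d2). split. now apply Rmin_glb_lt.
  intros v Hv.
  destruct (Q1 v (Rlt_le_trans _ _ _ Hv (Rmin_l _ _))) as [N1 N2].
  pose proof (Q2 v (Rlt_le_trans _ _ _ Hv (Rmin_r _ _))) as R2.
  replace (/ f v - / f w)%C with ((f w - f v) / (f v * f w))%C by (field; auto).
  rewrite Cmod_div by (apply Cmult_neq_0; auto). rewrite Cmod_mult. fold A.
  rewrite Cmod_minus_sym.
  assert (0 < Cmod (f v) * A) by nra.
  apply Rmult_lt_reg_r with (Cmod (f v) * A); auto.
  unfold Rdiv. rewrite Rmult_assoc, Rinv_l, Rmult_1_r by lra.
  eapply Rlt_trans. apply R2. apply Rmult_lt_compat_l; auto. nra.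
Qed.

Lemma ccont_div (f g : C -> C) (w : C) :
  ccont f w -> ccont g w -> g w <> RtoC 0 -> ccont (fun v => (f v / g v)%C) w.
Proof. intros. apply ccont_mult; auto. now apply ccont_inv. Qed.

Lemma ccont_comp (f g : C -> C) (w : C) :
  ccont g w -> ccont f (g w) -> ccont (fun v => f (g v)) w.
Proof.
  intros Hg Hf e He. destruct (Hf e He) as [d [P Q]].
  destruct (Hg d P) as [d' [P' Q']]. exists d'. split; auto.
Qed.

Lemma cderiv_ccont (f : C -> C) (w l : C) : cderiv f w l -> ccont f w.
Proof.
  intros [psi [d [Hd [E [Hp _]]]]].
  apply ccont_ext_loc with (f := fun v => (f w + psi v * (v - w))%C) (d := d); auto.
  intros; symmetry; auto.
  apply ccont_plus. apply ccont_const. apply ccont_mult; auto.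
  apply ccont_minus. apply ccont_id. apply ccont_const.
Qed.

Lemma cderiv_ext_loc (f g : C -> C) (w l : C) (d : R) :
  0 < d -> (forall v, Cmod (v - w) < d -> f v = g v) -> cderiv f w l -> cderiv g w l.
Proof.
  intros Hd E [psi [d' [Hd' [E' H]]]].
  exists psi, (Rmin d d'). split. now apply Rmin_glb_lt. split; auto.
  intros v Hv. rewrite <- !E. apply E'.
  eapply Rlt_le_trans. apply Hv. apply Rmin_r.
  rewrite Cmod_minus_diag; auto.
  eapply Rlt_le_trans. apply Hv. apply Rmin_l.
Qed.

Lemma cderiv_ext (f g : C -> C) (w l : C) :
  (forall v, f v = g v) -> cderiv f w l -> cderiv g w l.
Proof. intros E. apply cderiv_ext_loc with 1; auto. lra. Qed.

Lemma cderiv_eq (f : C -> C) (w l l' : C) : cderiv f w l -> l = l' -> cderiv f w l'.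
Proof. now intros H <-. Qed.

Lemma cderiv_const (k w : C) : cderiv (fun _ => k) w (RtoC 0).
Proof.
  exists (fun _ => RtoC 0), 1. split. lra. split. intros; ring. split.
  apply ccont_const. reflexivity.
Qed.

Lemma cderiv_id (w : C) : cderiv (fun v => v) w (RtoC 1).
Proof.
  exists (fun _ => RtoC 1), 1. split. lra. split. intros; ring. split.
  apply ccont_const. reflexivity.
Qed.

Lemma cderiv_plus (f g : C -> C) (w a b : C) :
  cderiv f w a -> cderiv g w b -> cderiv (fun v => (f v + g v)%C) w (a + b)%C.
Proof.
  intros [p [d [Hd [E [H1 H2]]]]] [p' [d' [Hd' [E' [H1' H2']]]]].
  exists (fun v => (p v + p' v)%C), (Rmin d d'). split. now apply Rmin_glb_lt. split.
  - intros v Hv. rewrite E, E'. ring.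
    eapply Rlt_le_trans. apply Hv. apply Rmin_r.
    eapply Rlt_le_trans. apply Hv. apply Rmin_l.
  - split. now apply ccont_plus. now subst.
Qed.

Lemma cderiv_mult (f g : C -> C) (w a b : C) :
  cderiv f w a -> cderiv g w b ->
  cderiv (fun v => (f v * g v)%C) w (a * g w + f w * b)%C.
Proof.
  intros Hf Hg. pose proof (cderiv_ccont _ _ _ Hg) as Cg.
  destruct Hf as [p [d [Hd [E [H1 H2]]]]]. destruct Hg as [p' [d' [Hd' [E' [H1' H2']]]]].
  exists (fun v => (p v * g v + f w * p' v)%C), (Rmin d d'). split. now apply Rmin_glb_lt. split.
  - intros v Hv. rewrite E, E'. ring.
    eapply Rlt_le_trans. apply Hv. apply Rmin_r.
    eapply Rlt_le_trans. apply Hv. apply Rmin_l.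
  - split. apply ccont_plus; apply ccont_mult; auto. apply ccont_const. now subst.
Qed.

Lemma cderiv_scal (f : C -> C) (k w a : C) :
  cderiv f w a -> cderiv (fun v => (k * f v)%C) w (k * a)%C.
Proof.
  intros H. eapply cderiv_eq. apply cderiv_mult. apply cderiv_const. apply H. cbv beta. ring.
Qed.

Lemma cderiv_opp (f : C -> C) (w a : C) :
  cderiv f w a -> cderiv (fun v => (- f v)%C) w (- a)%C.
Proof.
  intros H. apply cderiv_ext with (fun v => (- (1) * f v)%C). intros; ring.
  eapply cderiv_eq. apply cderiv_scal. apply H. cbv beta. ring.
Qed.

Lemma cderiv_minus (f g : C -> C) (w a b : C) :
  cderiv f w a -> cderiv g w b -> cderiv (fun v => (f v - g v)%C) w (a - b)%C.
Proof. intros. apply cderiv_plus; auto. now apply cderiv_opp. Qed.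

Lemma cderiv_comp (f g : C -> C) (w a b : C) :
  cderiv g w b -> cderiv f (g w) a -> cderiv (fun v => f (g v)) w (a * b)%C.
Proof.
  intros Hg Hf. pose proof (cderiv_ccont _ _ _ Hg) as Cg.
  destruct Hf as [p [d [Hd [E [H1 H2]]]]]. destruct Hg as [p' [d' [Hd' [E' [H1' H2']]]]].
  destruct (Cg d Hd) as [d2 [Hd2 Q2]].
  exists (fun v => (p (g v) * p' v)%C), (Rmin d' d2). split. now apply Rmin_glb_lt. split.
  - intros v Hv. rewrite E. rewrite (E' v) at 2. ring.
    eapply Rlt_le_trans. apply Hv. apply Rmin_l.
    apply Q2. eapply Rlt_le_trans. apply Hv. apply Rmin_r.
  - split. apply ccont_mult; auto. now apply (ccont_comp p g). now subst.
Qed.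

Lemma cderiv_inv_id (w : C) : w <> RtoC 0 -> cderiv (fun v => (/ v)%C) w (- / (w * w))%C.
Proof.
  intros N. destruct (ccont_nz_loc (fun v => v) w (ccont_id w) N) as [d [Hd Q]].
  exists (fun v => (- / (v * w))%C), d. split; auto. split.
  - intros v Hv. destruct (Q v Hv). field. auto.
  - split; auto. apply ccont_opp. apply ccont_inv.
    apply ccont_mult. apply ccont_id. apply ccont_const. now apply Cmult_neq_0.
Qed.

Lemma cderiv_inv (f : C -> C) (w a : C) :
  cderiv f w a -> f w <> RtoC 0 -> cderiv (fun v => (/ f v)%C) w (- a / (f w * f w))%C.
Proof.
  intros H N. eapply cderiv_eq. apply (cderiv_comp (fun v => (/ v)%C) f). apply H.
  now apply cderiv_inv_id. cbv beta. field; auto.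
Qed.

Lemma cderiv_div (f g : C -> C) (w a b : C) :
  cderiv f w a -> cderiv g w b -> g w <> RtoC 0 ->
  cderiv (fun v => (f v / g v)%C) w ((a * g w - f w * b) / (g w * g w))%C.
Proof.
  intros Hf Hg N. eapply cderiv_eq. apply cderiv_mult. apply Hf. apply cderiv_inv.
  apply Hg. auto. cbv beta. field. auto.
Qed.

(** The slope form makes the product, chain and inverse rules algebraic; the epsilon form serves in
    estimates. For the converse the slope is the difference quotient, completed by [l] at [w]. *)
Lemma cderiv_eps (f : C -> C) (w l : C) :
  cderiv f w l <-> (forall eps, 0 < eps -> exists del, 0 < del /\
    forall v, Cmod (v - w) < del -> Cmod (f v - f w - l * (v - w)) <= eps * Cmod (v - w)).
Proof.
  split.
  - intros [p [d [Hd [E [H1 H2]]]]] e He. destruct (H1 e He) as [d' [Hd' Q]].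
    exists (Rmin d d'). split. now apply Rmin_glb_lt. intros v Hv.
    rewrite E by (eapply Rlt_le_trans; [apply Hv | apply Rmin_l]).
    replace (f w + p v * (v - w) - f w - l * (v - w))%C with ((p v - p w) * (v - w))%C
      by (rewrite H2; ring).
    rewrite Cmod_mult. apply Rmult_le_compat_r. apply Cmod_ge_0. left. apply Q.
    eapply Rlt_le_trans; [apply Hv | apply Rmin_r].
  - intros H.
    exists (fun v => if Ceq_dec v w then l else ((f v - f w) / (v - w))%C), 1.
    split. lra. split; [|split].
    + intros v _. destruct (Ceq_dec v w) as [->|N]. ring. field. now apply Cminus_eq_contra.
    + intros e He. destruct (H (e/2)) as [d [Hd Q]]. lra.
      exists d. split; auto. intros v Hv.
      destruct (Ceq_dec w w) as [_|]; [|easy].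
      destruct (Ceq_dec v w) as [->|N]. rewrite Cmod_minus_diag; lra.
      apply Cminus_eq_contra in N.
      replace ((f v - f w) / (v - w) - l)%C with ((f v - f w - l * (v - w)) / (v - w))%C
        by (field; auto).
      rewrite Cmod_div by auto. specialize (Q v Hv).
      assert (0 < Cmod (v - w)) by now apply Cmod_gt_0.
      apply Rmult_lt_reg_r with (Cmod (v - w)); auto.
      unfold Rdiv. rewrite Rmult_assoc, Rinv_l by lra. nra.
    + destruct (Ceq_dec w w); easy.
Qed.

Lemma cderiv_unique (f : C -> C) (w a b : C) : cderiv f w a -> cderiv f w b -> a = b.
Proof.
  intros Ha Hb. apply NNPP. intros N.
  assert (HN : 0 < Cmod (a - b)) by (apply Cmod_gt_0; now apply Cminus_eq_contra).
  destruct (proj1 (cderiv_eps _ _ _) Ha (Cmod (a - b) / 4)) as [d1 [P1 Q1]]. lra.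
  destruct (proj1 (cderiv_eps _ _ _) Hb (Cmod (a - b) / 4)) as [d2 [P2 Q2]]. lra.
  (* One real increment [t] inside both neighbourhoods suffices: the two linear approximations
     differ there by [Cmod (a - b) * t], while each error is at most a quarter of that. *)
  set (t := Rmin d1 d2 / 2).
  assert (Ht : 0 < t) by (apply Rdiv_lt_0_compat; [now apply Rmin_glb_lt|lra]).
  assert (Et : Cmod (w + RtoC t - w) = t).
  { replace (w + RtoC t - w)%C with (RtoC t) by ring. rewrite Cmod_R. apply Rabs_pos_eq; lra. }
  pose proof (Rmin_l d1 d2). pose proof (Rmin_r d1 d2).
  specialize (Q1 (w + RtoC t)%C). specialize (Q2 (w + RtoC t)%C).
  rewrite Et in *. unfold t in Q1 at 1. unfold t in Q2 at 1.
  specialize (Q1 ltac:(lra)). specialize (Q2 ltac:(lra)).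
  set (F := (f (w + RtoC t)%C - f w)%C) in *.
  pose proof (Cmod_triangle_inv (F - b * (w + RtoC t - w)) (F - a * (w + RtoC t - w))).
  pose proof (Cmod_triangle (F - b * (w + RtoC t - w)) (- (F - a * (w + RtoC t - w)))).
  rewrite Cmod_opp in H2.
  replace (F - b * (w + RtoC t - w) + - (F - a * (w + RtoC t - w)))%C
    with ((a - b) * (w + RtoC t - w))%C in H2 by ring.
  rewrite Cmod_mult, Et in H2. nra.
Qed.

Lemma is_derive_cderiv (f : C -> C) (w l : C) :
  @is_derive C_AbsRing C_NormedModule f w l -> cderiv f w l.
Proof.
  intros [_ H]. specialize (H w (fun P HP => HP)).
  apply cderiv_eps. intros e He. destruct (H (mkposreal e He)) as [d Hd].
  exists (pos d). split. apply cond_pos. intros v Hv.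
  specialize (Hd v Hv). simpl in Hd.
  eapply Rle_trans. 2: apply Hd.
  right. unfold norm; simpl. f_equal. unfold minus, plus, opp, scal; simpl. unfold mult; simpl.
  ring.
Qed.

Lemma entire_cderiv (f : C -> C) (w : C) : entire f -> cderiv f w (C_derive f w).
Proof. intros H. apply is_derive_cderiv. apply C_derive_correct; auto. Qed.

Definition centire (f : C -> C) : Prop := forall w, exists l, cderiv f w l.

Lemma entire_centire (f : C -> C) : entire f -> centire f.
Proof. intros H w. exists (C_derive f w). now apply entire_cderiv. Qed.

(** * Goursat's theorem in a half plane *)

Lemma continuous_eps (f : R -> R) (x : R) :
  (forall eps, 0 < eps -> exists del, 0 < del /\
    forall y, Rabs (y - x) < del -> Rabs (f y - f x) < eps) -> continuous f x.
Proof.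
  intros H. apply continuity_pt_filterlim. intros e He. destruct (H e He) as [d [Hd Q]].
  exists d. split; auto. intros y [_ Hy]. apply Q. exact Hy.
Qed.

Lemma Cmod_vert (x y y' : R) : Cmod ((x, y) - (x, y'))%C = Rabs (y - y').
Proof.
  replace ((x, y) - (x, y'))%C with (Ci * RtoC (y - y'))%C.
  rewrite Cmod_mult, Cmod_Ci, Cmod_R. ring.
  apply injective_projections; simpl; ring.
Qed.

Lemma Cmod_horiz (x x' y : R) : Cmod ((x, y) - (x', y))%C = Rabs (x - x').
Proof.
  replace ((x, y) - (x', y))%C with (RtoC (x - x')).
  rewrite Cmod_R. ring.
  apply injective_projections; simpl; ring.
Qed.

Lemma Re_minus (a b : C) : Re (a - b)%C = Re a - Re b.
Proof. reflexivity. Qed.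
Lemma Im_minus (a b : C) : Im (a - b)%C = Im a - Im b.
Proof. reflexivity. Qed.

Lemma ccont_vert (G : C -> C) (x y : R) :
  ccont G (x, y) -> continuous (fun y => Re (G (x, y))) y.
Proof.
  intros H. apply continuous_eps. intros e He. destruct (H e He) as [d [Hd Q]].
  exists d. split; auto. intros y' Hy. rewrite <- Re_minus.
  eapply Rle_lt_trans. apply re_le_Cmod. apply Q. now rewrite Cmod_vert.
Qed.

Lemma ccont_horiz (G : C -> C) (x y : R) :
  ccont G (x, y) -> continuous (fun x => Im (G (x, y))) x.
Proof.
  intros H. apply continuous_eps. intros e He. destruct (H e He) as [d [Hd Q]].
  exists d. split; auto. intros y' Hy. rewrite <- Im_minus.
  eapply Rle_lt_trans. apply Im_le_Cmod. apply Q. now rewrite Cmod_horiz.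
Qed.

Lemma RInt_near_const (f : R -> R) (a b m e : R) :
  a <= b -> ex_RInt f a b -> (forall x, a < x < b -> Rabs (f x - m) <= e) ->
  Rabs (RInt f a b - m * (b - a)) <= e * (b - a).
Proof.
  intros Hab Hf H.
  assert (H1 : RInt (fun _ => m - e) a b <= RInt f a b).
  { apply RInt_le; auto. apply ex_RInt_const. intros x Hx.
    specialize (H x Hx). apply Rabs_le_between in H. lra. }
  assert (H2 : RInt f a b <= RInt (fun _ => m + e) a b).
  { apply RInt_le; auto. apply ex_RInt_const. intros x Hx.
    specialize (H x Hx). apply Rabs_le_between in H. lra. }
  rewrite RInt_const in H1, H2. unfold scal in *; simpl in *. unfold mult in *; simpl in *.
  apply Rabs_le_between. lra.
Qed.

Section Rectangles.
Variable G : C -> C.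
Variable S : R.
Hypothesis HG : forall x y, x < S -> exists l, cderiv G (x, y) l.

Let U x y1 y2 := RInt (fun y => Re (G (x, y))) y1 y2.
Let V y x1 x2 := RInt (fun x => Im (G (x, y))) x1 x2.

(* Imaginary part of the integral of [G] along the boundary of the rectangle. *)
Let bnd x1 x2 y1 y2 := U x2 y1 y2 - U x1 y1 y2 - (V y2 x1 x2 - V y1 x1 x2).

Lemma ccont_strip x y : x < S -> ccont G (x, y).
Proof. intros H. destruct (HG x y H) as [l Hl]. eapply cderiv_ccont; eauto. Qed.

Lemma ex_U x y1 y2 : x < S -> ex_RInt (fun y => Re (G (x, y))) y1 y2.
Proof. intros H. apply (ex_RInt_continuous (V := R_CompleteNormedModule)). intros y _. apply ccont_vert. now apply ccont_strip. Qed.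

Lemma ex_V y x1 x2 : x1 < S -> x2 < S -> ex_RInt (fun x => Im (G (x, y))) x1 x2.
Proof.
  intros H1 H2. apply (ex_RInt_continuous (V := R_CompleteNormedModule)). intros x Hx. apply ccont_horiz. apply ccont_strip.
  eapply Rle_lt_trans. apply Hx. now apply Rmax_lub_lt.
Qed.

(** Each inner edge is traversed twice, in opposite directions. *)
Lemma bnd_split x1 xm x2 y1 ym y2 : x1 < S -> xm < S -> x2 < S ->
  bnd x1 x2 y1 y2 = bnd x1 xm y1 ym + bnd xm x2 y1 ym + bnd x1 xm ym y2 + bnd xm x2 ym y2.
Proof.
  intros H1 H2 H3. unfold bnd.
  assert (EU : forall x, x < S -> U x y1 y2 = U x y1 ym + U x ym y2).
  { intros x Hx. symmetry. unfold U. apply (RInt_Chasles (V := R_CompleteNormedModule)); now apply ex_U. }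
  assert (EV : forall y, V y x1 x2 = V y x1 xm + V y xm x2).
  { intros y. symmetry. unfold V. apply (RInt_Chasles (V := R_CompleteNormedModule)); now apply ex_V. }
  rewrite !EU, !EV by auto. ring.
Qed.

(** The affine part of [G] contributes nothing: the vertical and the horizontal pair of sides each
    yield [Re l * s * t], with opposite signs. The error term is at most [eps * (s + t)] on each of
    the four sides. *)
Lemma bnd_local x y s t x0 y0 l eps :
  0 <= s -> 0 <= t -> x + s < S -> x <= x0 <= x + s -> y <= y0 <= y + t ->
  (forall v, Cmod (v - (x0, y0)) <= s + t ->
     Cmod (G v - G (x0, y0) - l * (v - (x0, y0))) <= eps * Cmod (v - (x0, y0))) ->
  0 <= eps ->
  Rabs (bnd x (x + s) y (y + t)) <= 2 * eps * (s + t) ^ 2.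
Proof.
  intros Hs Ht HS Hx Hy H He.
  assert (K : forall a b, x <= a <= x + s -> y <= b <= y + t ->
     Cmod (G (a, b) - G (x0, y0) - l * ((a, b) - (x0, y0))) <= eps * (s + t)).
  { intros a b Ha Hb.
    assert (D : Cmod ((a, b) - (x0, y0)) <= s + t).
    { eapply Rle_trans. apply Cmod_le_Re_Im. simpl.
      apply Rplus_le_compat; apply Rabs_le_between; lra. }
    eapply Rle_trans. apply H. exact D. apply Rmult_le_compat_l; auto. }
  assert (KR : forall a b, x <= a <= x + s -> y <= b <= y + t ->
     Rabs (Re (G (a, b)) - Re (G (x0, y0)) - Re (l * ((a, b) - (x0, y0)))) <= eps * (s + t)).
  { intros a b Ha Hb. rewrite <- !Re_minus. eapply Rle_trans. 2: apply (K a b Ha Hb). apply re_le_Cmod. }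
  assert (KI : forall a b, x <= a <= x + s -> y <= b <= y + t ->
     Rabs (Im (G (a, b)) - Im (G (x0, y0)) - Im (l * ((a, b) - (x0, y0)))) <= eps * (s + t)).
  { intros a b Ha Hb. rewrite <- !Im_minus. eapply Rle_trans. 2: apply (K a b Ha Hb). apply Im_le_Cmod. }
  assert (EU : Rabs (RInt (fun b => minus (Re (G (x + s, b))) (Re (G (x, b)))) y (y + t)
      - Re l * s * (y + t - y)) <= 2 * eps * (s + t) * (y + t - y)).
  { apply RInt_near_const. lra.
    apply (ex_RInt_minus (V := R_NormedModule)); apply ex_U; lra.
    intros b Hb. unfold minus, plus, opp; simpl.
    pose proof (KR (x + s) b ltac:(lra) ltac:(lra)) as K1.
    pose proof (KR x b ltac:(lra) ltac:(lra)) as K2.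
    destruct l as [l1 l2]. simpl in *.
    apply Rabs_le_between in K1, K2. apply Rabs_le_between. lra. }
  assert (EV : Rabs (RInt (fun a => minus (Im (G (a, y + t))) (Im (G (a, y)))) x (x + s)
      - Re l * t * (x + s - x)) <= 2 * eps * (s + t) * (x + s - x)).
  { apply RInt_near_const. lra.
    apply (ex_RInt_minus (V := R_NormedModule)); apply ex_V; lra.
    intros a Ha. unfold minus, plus, opp; simpl.
    pose proof (KI a (y + t) ltac:(lra) ltac:(lra)) as K1.
    pose proof (KI a y ltac:(lra) ltac:(lra)) as K2.
    destruct l as [l1 l2]. simpl in *.
    apply Rabs_le_between in K1, K2. apply Rabs_le_between. lra. }
  rewrite (RInt_minus (V := R_CompleteNormedModule)) in EU by (apply ex_U; lra).
  rewrite (RInt_minus (V := R_CompleteNormedModule)) in EV by (apply ex_V; lra).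
  unfold bnd, U, V. unfold minus, plus, opp in EU, EV; simpl in EU, EV.
  apply Rabs_le_between in EU, EV. apply Rabs_le_between. nra.
Qed.

(** Goursat's bisection: one of the four quarters carries at least a quarter of the integral. The
    nested rectangles shrink to a point, where differentiability makes the integral too small. *)
Lemma bnd_zero x y s t : 0 <= s -> 0 <= t -> x + s < S -> bnd x (x + s) y (y + t) = 0.
Proof.
  intros Hs Ht HS. apply NNPP. intros N.
  set (e0 := Rabs (bnd x (x + s) y (y + t))).
  assert (He0 : 0 < e0) by now apply Rabs_pos_lt.
  (* [p] is the lower left corner of a rectangle of the [n]-th generation, whose sides are
     [s / 2 ^ n] and [t / 2 ^ n]. *)
  set (bad := fun n (p : R * R) =>
    e0 / 4 ^ n <= Rabs (bnd (fst p) (fst p + s / 2 ^ n) (snd p) (snd p + t / 2 ^ n))).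
  set (next := fun n (p q : R * R) => bad (Datatypes.S n) q /\
    fst p <= fst q /\ fst q + s / 2 ^ (Datatypes.S n) <= fst p + s / 2 ^ n /\
    snd p <= snd q /\ snd q + t / 2 ^ (Datatypes.S n) <= snd p + t / 2 ^ n).
  assert (Step : forall n p, fst p + s / 2 ^ n < S -> bad n p -> exists q, next n p q).
  { intros n [a b] Hp Hb. unfold bad, next in *. simpl in *.
    assert (H2 : 0 < 2 ^ n) by (apply pow_lt; lra).
    assert (H4 : 0 < 4 ^ n) by (apply pow_lt; lra).
    set (s' := s / (2 * 2 ^ n)). set (t' := t / (2 * 2 ^ n)).
    assert (Es : s / 2 ^ n = s' + s') by (unfold s'; field; lra).
    assert (Et : t / 2 ^ n = t' + t') by (unfold t'; field; lra).
    assert (Ee : e0 / 4 ^ n = 4 * (e0 / (4 * 4 ^ n))) by (field; lra).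
    assert (0 <= s') by (apply Rdiv_le_0_compat; lra).
    assert (0 <= t') by (apply Rdiv_le_0_compat; lra).
    rewrite Es, Et, Ee in *. set (e := e0 / (4 * 4 ^ n)) in *.
    rewrite (bnd_split a (a + s') _ b (b + t') _) in Hb by lra.
    replace (a + (s' + s')) with (a + s' + s') in Hb by ring.
    replace (b + (t' + t')) with (b + t' + t') in Hb by ring.
    destruct (Rle_dec e (Rabs (bnd a (a + s') b (b + t')))) as [C1|C1].
    { exists (a, b). unfold bad. simpl. fold s' t' e. lra. }
    destruct (Rle_dec e (Rabs (bnd (a + s') (a + s' + s') b (b + t')))) as [C2|C2].
    { exists (a + s', b). unfold bad. simpl. fold s' t' e. lra. }
    destruct (Rle_dec e (Rabs (bnd a (a + s') (b + t') (b + t' + t')))) as [C3|C3].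
    { exists (a, b + t'). unfold bad. simpl. fold s' t' e. lra. }
    destruct (Rle_dec e (Rabs (bnd (a + s') (a + s' + s') (b + t') (b + t' + t')))) as [C4|C4].
    { exists (a + s', b + t'). unfold bad. simpl. fold s' t' e. lra. }
    exfalso.
    match type of Hb with _ <= Rabs (?A + ?B + ?C + ?D) =>
      pose proof (Rabs_triang (A + B + C) D); pose proof (Rabs_triang (A + B) C);
      pose proof (Rabs_triang A B) end.
    lra. }
  set (pick := fun n p => epsilon (inhabits p) (next n p)).
  set (sq := fix sq n := match n with O => (x, y) | Datatypes.S m => pick m (sq m) end).
  assert (Inv : forall n, fst (sq n) + s / 2 ^ n < S /\ bad n (sq n) /\ next n (sq n) (sq (Datatypes.S n))).
  { assert (K : forall n p, fst p + s / 2 ^ n < S -> bad n p -> next n p (pick n p)).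
    { intros n p H1 H2. unfold pick. apply epsilon_spec. now apply Step. }
    induction n as [|n [I1 [I2 I3]]].
    - assert (B0 : bad O (x, y)).
      { unfold bad. simpl. rewrite !Rdiv_1_r. fold e0. lra. }
      assert (S0 : fst (x, y) + s / 2 ^ 0 < S) by (simpl; rewrite Rdiv_1_r; lra).
      split; [exact S0|split; [exact B0|]]. apply (K O (x, y)); auto.
    - assert (S1 : fst (sq (Datatypes.S n)) + s / 2 ^ Datatypes.S n < S).
      { destruct I3 as [_ [_ [I3 _]]]. lra. }
      assert (B1 : bad (Datatypes.S n) (sq (Datatypes.S n))) by apply I3.
      split; [exact S1|split; [exact B1|]]. apply (K (Datatypes.S n)); auto. }
  assert (Mon : forall n k, fst (sq n) <= fst (sq (n + k)%nat) /\
     fst (sq (n + k)%nat) + s / 2 ^ (n + k) <= fst (sq n) + s / 2 ^ n /\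
     snd (sq n) <= snd (sq (n + k)%nat) /\
     snd (sq (n + k)%nat) + t / 2 ^ (n + k) <= snd (sq n) + t / 2 ^ n).
  { intros n k. induction k as [|k IH].
    - rewrite Nat.add_0_r. lra.
    - rewrite Nat.add_succ_r. destruct (Inv (n + k)%nat) as [_ [_ [_ I]]]. lra. }
  assert (Pos : forall r n, 0 <= r -> 0 <= r / 2 ^ n).
  { intros r n Hr. apply Rdiv_le_0_compat; auto. apply pow_lt; lra. }
  (* Every lower left corner lies below and to the left of every upper right corner, so the suprema
     of the lower left coordinates give a point common to all rectangles. *)
  assert (Cross : forall n m, fst (sq m) <= fst (sq n) + s / 2 ^ n /\
      snd (sq m) <= snd (sq n) + t / 2 ^ n).
  { intros n m. destruct (le_ge_dec n m) as [L|L].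
    - replace m with (n + (m - n))%nat by lia.
      pose proof (Mon n (m - n)%nat). pose proof (Pos s (n + (m - n))%nat Hs).
      pose proof (Pos t (n + (m - n))%nat Ht). lra.
    - replace n with (m + (n - m))%nat by lia.
      pose proof (Mon m (n - m)%nat). pose proof (Pos s (m + (n - m))%nat Hs).
      pose proof (Pos t (m + (n - m))%nat Ht). lra. }
  assert (Sup : forall w : nat -> R, (forall n k, w n <= w (n + k)%nat) ->
     forall r, (forall n m, w m <= w n + r / 2 ^ n) ->
     exists l, forall n, w n <= l <= w n + r / 2 ^ n).
  { intros w Hw r Hr.
    destruct (completeness (fun z => exists n, z = w n)) as [l [L1 L2]].
    - exists (w O + r / 2 ^ 0). intros z [n ->]. auto.
    - exists (w O). now exists O.
    - exists l. intros n. split. apply L1. now exists n. apply L2. intros z [m ->]. auto. }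
  destruct (Sup (fun n => fst (sq n)) (fun n k => proj1 (Mon n k)) s (fun n m => proj1 (Cross n m))) as [x0 Hx0].
  destruct (Sup (fun n => snd (sq n)) (fun n k => proj1 (proj2 (proj2 (Mon n k)))) t (fun n m => proj2 (Cross n m))) as [y0 Hy0].
  assert (Hx0S : x0 < S).
  { specialize (Hx0 O). destruct (Inv O) as [I _]. simpl in *. lra. }
  destruct (HG x0 y0 Hx0S) as [l Hl].
  assert (Hst : 0 < (s + t + 1) ^ 2) by (apply pow_lt; lra).
  (* The local bound on the [n]-th rectangle becomes [2 * eps * (s + t) ^ 2 / 4 ^ n], at most half
     of [e0 / 4 ^ n]. The [+ 1] keeps the denominator positive when [s = t = 0]. *)
  set (eps := e0 / (4 * (s + t + 1) ^ 2)).
  assert (Heps : 0 < eps) by (apply Rdiv_lt_0_compat; lra).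
  destruct (proj1 (cderiv_eps _ _ _) Hl eps Heps) as [d [Hd Q]].
  destruct (pow_lt_1_zero (/2) ltac:(rewrite Rabs_pos_eq; lra) (d / (s + t + 1))) as [n Hn].
  { apply Rdiv_lt_0_compat; lra. }
  specialize (Hn n (le_n n)). rewrite Rabs_pos_eq in Hn by (apply pow_le; lra).
  rewrite pow_inv in Hn.
  assert (H2 : 0 < 2 ^ n) by (apply pow_lt; lra).
  assert (Hi : 0 < / 2 ^ n) by now apply Rinv_0_lt_compat.
  destruct (Inv n) as [I1 [I2 _]]. unfold bad in I2.
  specialize (Hx0 n). specialize (Hy0 n). cbv beta in *.
  assert (Hlt : (s + t + 1) * / 2 ^ n < d).
  { apply Rmult_lt_compat_l with (r := s + t + 1) in Hn; [|lra].
    replace ((s + t + 1) * (d / (s + t + 1))) with d in Hn by (field; lra). exact Hn. }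
  pose proof (bnd_local (fst (sq n)) (snd (sq n)) (s / 2 ^ n) (t / 2 ^ n) x0 y0 l eps
    (Pos s n Hs) (Pos t n Ht) I1 Hx0 Hy0) as BL.
  assert (BL' := BL (fun v Hv => Q v ltac:(unfold Rdiv in Hv; nra)) ltac:(lra)). clear BL.
  assert (E4 : 4 ^ n = 2 ^ n * 2 ^ n) by (rewrite <- Rpow_mult_distr; f_equal; ring).
  rewrite E4 in I2.
  assert (F : e0 / (2 ^ n * 2 ^ n) <= 2 * eps * (s / 2 ^ n + t / 2 ^ n) ^ 2) by lra.
  replace (2 * eps * (s / 2 ^ n + t / 2 ^ n) ^ 2) with (2 * eps * (s + t) ^ 2 / (2 ^ n * 2 ^ n)) in F by (field; lra).
  apply Rmult_le_compat_r with (r := 2 ^ n * 2 ^ n) in F; [|nra].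
  unfold Rdiv in F. rewrite !Rmult_assoc in F. rewrite Rinv_l in F by nra.
  rewrite !Rmult_1_r in F.
  assert (eps * (4 * (s + t + 1) ^ 2) = e0) by (unfold eps; field; lra).
  assert ((s + t) ^ 2 <= (s + t + 1) ^ 2) by nra.
  nra.
Qed.

(** By periodicity the two horizontal sides of the rectangle cancel in [bnd_zero]. *)
Lemma strip_periodic_integral T x1 x2 :
  0 <= T -> (forall x, G (x, T) = G (x, 0)) -> x1 <= x2 -> x2 < S ->
  RInt (fun y => Re (G (x1, y))) 0 T = RInt (fun y => Re (G (x2, y))) 0 T.
Proof.
  intros HT HP H12 HS.
  pose proof (bnd_zero x1 0 (x2 - x1) T ltac:(lra) HT ltac:(lra)) as B.
  replace (x1 + (x2 - x1)) with x2 in B by ring.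
  replace (0 + T) with T in B by ring.
  unfold bnd, U, V in B.
  rewrite (RInt_ext (fun x => Im (G (x, T))) (fun x => Im (G (x, 0)))) in B.
  lra. intros; now rewrite HP.
Qed.
End Rectangles.

(** * Estimates at the center of a disc *)

Lemma Cexp_plus (a b : C) : Cexp (a + b)%C = (Cexp a * Cexp b)%C.
Proof.
  destruct a as [a1 a2], b as [b1 b2]. unfold Cexp. simpl.
  rewrite exp_plus, cos_plus, sin_plus. apply injective_projections; simpl; ring.
Qed.

Lemma Cexp_0 : Cexp (RtoC 0) = RtoC 1.
Proof.
  unfold Cexp. simpl. rewrite exp_0, cos_0, sin_0. apply injective_projections; simpl; ring.
Qed.

Lemma Cmod_Cexp (w : C) : Cmod (Cexp w) = exp (Re w).
Proof.
  unfold Cmod, Cexp. simpl.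
  replace (_ + _) with (Rsqr (exp (Re w)) * (Rsqr (sin (Im w)) + Rsqr (cos (Im w))))
    by (unfold Rsqr; ring).
  rewrite sin2_cos2, Rmult_1_r. apply sqrt_Rsqr. left. apply exp_pos.
Qed.

Lemma Cexp_nz (w : C) : Cexp w <> RtoC 0.
Proof. apply Cmod_gt_0. rewrite Cmod_Cexp. apply exp_pos. Qed.

Lemma derivable_pt_lim_0_bound (f : R -> R) (l e : R) : 0 < e -> derivable_pt_lim f 0 l ->
  exists d, 0 < d /\ forall h, Rabs h < d -> Rabs (f h - f 0 - l * h) <= e * Rabs h.
Proof.
  intros He H. destruct (H e He) as [d Hd]. exists (pos d). split. apply cond_pos.
  intros h Hh. destruct (Req_dec h 0) as [->|N].
  - rewrite Rabs_R0. replace (f 0 - f 0 - l * 0) with 0 by ring. rewrite Rabs_R0. lra.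
  - specialize (Hd h N Hh). rewrite Rplus_0_l in Hd.
    replace (f h - f 0 - l * h) with (((f h - f 0) / h - l) * h) by (field; auto).
    rewrite Rabs_mult. apply Rmult_le_compat_r. apply Rabs_pos. lra.
Qed.

Lemma cderiv_Cexp_0 : cderiv Cexp (RtoC 0) (RtoC 1).
Proof.
  apply cderiv_eps. intros e He.
  (* The four error terms below are at most [k], [3 * k], [3 * k] and [2 * k] times [m], hence the
     [9]; [k <= 1] serves to bound [Rabs (exp x)] by 3. *)
  set (k := Rmin 1 (e / 9)).
  assert (Hk : 0 < k) by (apply Rmin_glb_lt; lra).
  assert (Hk1 : k <= 1) by apply Rmin_l. assert (Hk2 : k <= e / 9) by apply Rmin_r.
  destruct (derivable_pt_lim_0_bound exp 1 k Hk) as [d1 [P1 Q1]].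
  { rewrite <- exp_0 at 1. apply derivable_pt_lim_exp. }
  destruct (derivable_pt_lim_0_bound cos 0 k Hk) as [d2 [P2 Q2]].
  { pose proof (derivable_pt_lim_cos 0) as D. now rewrite sin_0, Ropp_0 in D. }
  destruct (derivable_pt_lim_0_bound sin 1 k Hk) as [d3 [P3 Q3]].
  { rewrite <- cos_0 at 1. apply derivable_pt_lim_sin. }
  exists (Rmin (Rmin d1 d2) (Rmin d3 k)). split.
  { repeat apply Rmin_glb_lt; auto; lra. }
  intros [x y] Hv.
  replace ((x, y) - RtoC 0)%C with ((x, y) : C) in * by (apply injective_projections; simpl; ring).
  set (m := Cmod (x, y)) in *.
  assert (Hx : Rabs x <= m) by apply (re_le_Cmod (x, y)).
  assert (Hy : Rabs y <= m) by apply (Im_le_Cmod (x, y)).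
  pose proof (Rmin_l (Rmin d1 d2) (Rmin d3 k)). pose proof (Rmin_r (Rmin d1 d2) (Rmin d3 k)).
  pose proof (Rmin_l d1 d2). pose proof (Rmin_r d1 d2).
  pose proof (Rmin_l d3 k). pose proof (Rmin_r d3 k).
  specialize (Q1 x ltac:(lra)). specialize (Q2 y ltac:(lra)). specialize (Q3 y ltac:(lra)).
  rewrite exp_0 in Q1. rewrite cos_0 in Q2. rewrite sin_0 in Q3.
  rewrite Cexp_0.
  eapply Rle_trans. apply Cmod_le_Re_Im. simpl. rewrite !Rmult_1_l, !Rmult_0_l, Rminus_0_r, Rplus_0_r.
  set (E := exp x - 1 - 1 * x) in *. set (c := cos y - 1 - 0 * y) in *. set (s := sin y - 0 - 1 * y) in *.
  assert (Ex : exp x - 1 = E + x) by (unfold E; ring).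
  assert (Hm : 0 <= m) by apply Cmod_ge_0.
  pose proof (Rabs_pos x). pose proof (Rabs_pos y).
  assert (KE : Rabs (exp x - 1) <= 2 * Rabs x).
  { rewrite Ex. eapply Rle_trans. apply Rabs_triang. nra. }
  assert (K3 : Rabs (exp x) <= 3).
  { replace (exp x) with ((exp x - 1) + 1) by ring. eapply Rle_trans. apply Rabs_triang.
    rewrite Rabs_R1. lra. }
  replace (exp x * cos y + - (1) + - x) with (E + exp x * c) by (unfold E, c; ring).
  replace (exp x * sin y + - 0 + - y) with (exp x * s + (exp x - 1) * y)
    by (unfold s; ring).
  pose proof (Rabs_triang E (exp x * c)). pose proof (Rabs_triang (exp x * s) ((exp x - 1) * y)).
  rewrite !Rabs_mult in *.
  assert (Rabs (exp x) * Rabs c <= 3 * (k * m)).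
  { apply Rmult_le_compat; try apply Rabs_pos; auto. nra. }
  assert (Rabs (exp x) * Rabs s <= 3 * (k * m)).
  { apply Rmult_le_compat; try apply Rabs_pos; auto. nra. }
  assert (Rabs (exp x - 1) * Rabs y <= (2 * k) * m).
  { apply Rmult_le_compat; try apply Rabs_pos; auto. lra. }
  assert (Rabs E <= k * m) by nra.
  assert (9 * k * m <= e * m) by (apply Rmult_le_compat_r; lra).
  lra.
Qed.

Lemma cderiv_Cexp (w : C) : cderiv Cexp w (Cexp w).
Proof.
  apply cderiv_ext with (fun v => (Cexp w * Cexp (v - w))%C).
  { intros v. rewrite <- Cexp_plus. f_equal. ring. }
  eapply cderiv_eq. apply cderiv_scal.
  apply (cderiv_comp Cexp (fun v => (v - w)%C)). apply cderiv_minus. apply cderiv_id. apply cderiv_const.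
  cbv beta. replace (w - w)%C with (RtoC 0) by ring. apply cderiv_Cexp_0. ring.
Qed.

(* [F (c + exp w)] is holomorphic and [2 i pi]-periodic in a left half plane, so
   its mean over a vertical period does not depend on the abscissa. *)
Lemma center_Re_le (F : C -> C) (c : C) (r r' K : R) : 0 < r < r' ->
  (forall v, 0 < Cmod (v - c) < r' -> exists l, cderiv F v l) -> ccont F c ->
  (forall v, Cmod (v - c) = r -> Re (F v) <= K) -> Re (F c) <= K.
Proof.
  intros Hr HF Hc HK. apply Rnot_lt_le. intros N.
  set (G := fun w => F (c + Cexp w)%C).
  assert (HG : forall x y, x < ln r' -> exists l, cderiv G (x, y) l).
  { intros x y Hx. destruct (HF (c + Cexp (x, y))%C) as [l Hl].
    - replace (c + Cexp (x, y) - c)%C with (Cexp (x, y)) by ring. rewrite Cmod_Cexp. simpl.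
      split. apply exp_pos. rewrite <- (exp_ln r') by lra. now apply exp_increasing.
    - eexists. apply (cderiv_comp F (fun w => (c + Cexp w)%C)).
      apply cderiv_plus. apply cderiv_const. apply cderiv_Cexp. apply Hl. }
  set (e := (Re (F c) - K) / 2).
  destruct (Hc e) as [d [Hd Q]]. unfold e; lra.
  (* The circle of radius [exp x1] around [c] is so small that [Re F] exceeds [Re (F c) - e] on it,
     by continuity at [c]. The mean over it equals the mean over the circle of radius [r], which is
     at most [K]. *)
  set (x1 := Rmin (ln r) (ln (d / 2))).
  assert (HT : 0 <= 2 * PI) by (pose proof PI_RGT_0; lra).
  pose proof (strip_periodic_integral G (ln r') HG (2 * PI) x1 (ln r) HT) as SP.
  assert (E : RInt (fun y => Re (G (x1, y))) 0 (2 * PI) = RInt (fun y => Re (G (ln r, y))) 0 (2 * PI)).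
  { apply SP. 2: apply Rmin_l. 2: apply ln_increasing; lra.
    intros x. unfold G. do 2 f_equal. unfold Cexp. simpl.
    now rewrite cos_2PI, sin_2PI, cos_0, sin_0. }
  assert (Hl : ln r < ln r') by (apply ln_increasing; lra).
  assert (L1 : RInt (fun y => Re (G (ln r, y))) 0 (2 * PI) <= RInt (fun _ => K) 0 (2 * PI)).
  { apply RInt_le; auto. now apply (ex_U G (ln r')). apply ex_RInt_const.
    intros y _. apply HK. replace (c + Cexp (ln r, y) - c)%C with (Cexp (ln r, y)) by ring.
    rewrite Cmod_Cexp. simpl. apply exp_ln. lra. }
  assert (L2 : RInt (fun _ => Re (F c) - e) 0 (2 * PI) <= RInt (fun y => Re (G (x1, y))) 0 (2 * PI)).
  { apply RInt_le; auto. apply ex_RInt_const. apply (ex_U G (ln r')); auto.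
    eapply Rle_lt_trans. apply Rmin_l. auto.
    intros y _. assert (B : Cmod (G (x1, y) - F c) < e).
    { apply Q. replace (c + Cexp (x1, y) - c)%C with (Cexp (x1, y)) by ring.
      rewrite Cmod_Cexp. simpl. apply Rle_lt_trans with (d / 2); [|lra].
      rewrite <- (exp_ln (d / 2)) by lra.
      destruct (Rmin_r (ln r) (ln (d / 2))) as [L|L]; fold x1 in L.
      left. now apply exp_increasing. rewrite L. lra. }
    pose proof (re_le_Cmod (G (x1, y) - F c)) as B2. rewrite Re_minus in B2.
    pose proof (Rle_lt_trans _ _ _ B2 B) as B3. apply Rabs_lt_between in B3. lra. }
  rewrite RInt_const in L1, L2. unfold scal in L1, L2; simpl in L1, L2.
  unfold mult in L1, L2; simpl in L1, L2.
  pose proof PI_RGT_0. rewrite E in L2. unfold e in L2. nra.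
Qed.

(** Multiplying [F] by [Cconj (F c)] makes its value at [c] equal to [Cmod (F c) ^ 2], so the bound
    for real parts applies. *)
Lemma center_Cmod_le (F : C -> C) (c : C) (r r' K : R) : 0 < r < r' ->
  (forall v, 0 < Cmod (v - c) < r' -> exists l, cderiv F v l) -> ccont F c ->
  (forall v, Cmod (v - c) = r -> Cmod (F v) <= K) -> Cmod (F c) <= K.
Proof.
  intros Hr HF Hc HK.
  pose proof (Cmod_ge_0 (F c)) as [Hp|Hp].
  - assert (H : Re (Cconj (F c) * F c) <= Cmod (F c) * K).
    { apply (center_Re_le (fun v => (Cconj (F c) * F v)%C) c r r'); auto.
      - intros v Hv. destruct (HF v Hv) as [l Hl]. eexists. apply cderiv_scal. apply Hl.
      - apply ccont_mult; auto. apply ccont_const.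
      - intros v Hv. eapply Rle_trans. apply Rle_abs. eapply Rle_trans. apply re_le_Cmod.
        rewrite Cmod_mult, Cmod_conj. apply Rmult_le_compat_l; auto. lra. }
    rewrite Cmult_comm, <- Cmod2_conj, re_RtoC in H. nra.
  - rewrite <- Hp. eapply Rle_trans. apply Cmod_ge_0. apply (HK (c + RtoC r)%C).
    replace (c + RtoC r - c)%C with (RtoC r) by ring. rewrite Cmod_R. apply Rabs_pos_eq. lra.
Qed.

(** The difference quotient, completed by the derivative, is continuous at [w] and differentiable
    wherever else [f] is: exactly what the estimates at the center of a disc require. *)
Lemma cderiv_slope (f : C -> C) (w l : C) : cderiv f w l ->
  exists psi : C -> C, (forall v, v <> w -> psi v = ((f v - f w) / (v - w))%C) /\
    psi w = l /\ ccont psi w /\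
    (forall v a, v <> w -> cderiv f v a -> exists b, cderiv psi v b).
Proof.
  intros [p [d [Hd [E [H1 H2]]]]].
  set (psi := fun v => if Ceq_dec v w then l else ((f v - f w) / (v - w))%C).
  assert (Ep : forall v, v <> w -> psi v = ((f v - f w) / (v - w))%C).
  { intros v N. unfold psi. destruct (Ceq_dec v w); easy. }
  assert (Ew : psi w = l) by (unfold psi; destruct (Ceq_dec w w); easy).
  exists psi. split; [exact Ep|split; [exact Ew|split]].
  - apply (ccont_ext_loc p psi w d Hd); auto. intros v Hv. destruct (Ceq_dec v w) as [->|N]. now rewrite Ew.
    rewrite Ep, E by auto. field. now apply Cminus_eq_contra.
  - intros v a N Ha. eexists.
    apply cderiv_ext_loc with (f := fun u => ((f u - f w) / (u - w))%C) (d := Cmod (v - w)).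
    apply Cmod_gt_0. now apply Cminus_eq_contra.
    intros u Hu. symmetry. apply Ep. intros ->. rewrite Cmod_minus_sym in Hu. lra.
    apply cderiv_div. apply cderiv_minus. apply Ha. apply cderiv_const.
    apply cderiv_minus. apply cderiv_id. apply cderiv_const. now apply Cminus_eq_contra.
Qed.

(** The slope of [h] at [c] has the value [l] there. On the circle it is at most [2 * M / r], since
    [h c] is also bounded by [M]. *)
Lemma cauchy_estimate (h : C -> C) (c l : C) (r r' M : R) : 0 < r < r' ->
  (forall v, Cmod (v - c) < r' -> exists a, cderiv h v a) -> cderiv h c l ->
  (forall v, Cmod (v - c) = r -> Cmod (h v) <= M) -> Cmod l <= 2 * M / r.
Proof.
  intros Hr Hh Hl HM.
  assert (Mc : Cmod (h c) <= M).
  { apply (center_Cmod_le h c r r'); auto. intros v Hv. apply Hh. lra. eapply cderiv_ccont; eauto. }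
  destruct (cderiv_slope h c l Hl) as [psi [E [El [Cp Dp]]]].
  rewrite <- El. apply (center_Cmod_le psi c r r'); auto.
  - intros v Hv. destruct (Hh v) as [a Ha]. lra. apply (Dp v a); auto.
    intros ->. rewrite Cmod_minus_diag in Hv. lra.
  - intros v Hv. assert (N : v <> c). { intros ->. rewrite Cmod_minus_diag in Hv. lra. }
    rewrite E by auto. rewrite Cmod_div by now apply Cminus_eq_contra. rewrite Hv.
    apply Rmult_le_compat_r. left. apply Rinv_0_lt_compat. lra.
    pose proof (Cmod_triangle (h v) (- h c)). rewrite Cmod_opp in H.
    specialize (HM v Hv). unfold Cminus. lra.
Qed.

Lemma unimodular_plus_inv (b : C) : Cmod b = 1 -> (b + / b)%C = RtoC (2 * Re b).
Proof.
  intros H. assert (H2 : Re b ^ 2 + Im b ^ 2 = 1) by (rewrite <- Cmod2_alt, H; ring).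
  destruct b as [x y]. simpl in *. unfold Cinv. apply injective_projections; simpl.
  - rewrite H2. field.
  - rewrite H2. field.
Qed.

(* The kernel [b + /b + 2] is real and lies in [0, 4] on the circle, and its
   simple pole at [c] picks up the derivative. *)
Lemma borel_caratheodory (h : C -> C) (c l : C) (r r' A : R) : 0 < r < r' ->
  (forall v, Cmod (v - c) < r' -> exists a, cderiv h v a) -> cderiv h c l ->
  (forall v, Cmod (v - c) = r -> Re (h v) <= A) -> Cmod l <= 4 * (A - Re (h c)) / r.
Proof.
  intros Hr Hh Hl HA.
  assert (Ac : Re (h c) <= A).
  { apply (center_Re_le h c r r'); auto. intros v Hv. apply Hh. lra. eapply cderiv_ccont; eauto. }
  destruct (Cmod_ge_0 l) as [Hp|Hp].
  2: { rewrite <- Hp. apply Rdiv_le_0_compat; lra. }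
  destruct (cderiv_slope h c l Hl) as [psi [E [El [Cp Dp]]]].
  (* A rotation: [al * l] is the nonnegative real number [Cmod l]. *)
  set (al := (Cconj l / RtoC (Cmod l))%C).
  assert (Nl : RtoC (Cmod l) <> RtoC 0) by (intros K; apply RtoC_inj in K; lra).
  assert (Mal : Cmod al = 1).
  { unfold al. rewrite Cmod_div by auto. rewrite Cmod_conj, Cmod_R, Rabs_pos_eq by lra. field. lra. }
  assert (Nal : al <> RtoC 0) by (apply Cmod_gt_0; lra).
  assert (Nr : RtoC r <> RtoC 0) by (intros K; apply RtoC_inj in K; lra).
  (* With [b = al * r / (v - c)] this is [(b + / b + 2) * (h v - h c)] off [c]. Writing the singular
     part [b * (h v - h c)] as [al * r * psi v] gives it a continuous value at [c], and
     [F c = r * Cmod l]. *)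
  set (F := fun v => (al * RtoC r * psi v + ((v - c) / (al * RtoC r) + RtoC 2) * (h v - h c))%C).
  assert (Fc : F c = RtoC (r * Cmod l)).
  { unfold F. rewrite El. replace (h c - h c)%C with (RtoC 0) by ring.
    replace (al * RtoC r * l)%C with (RtoC r * (l * Cconj l) / RtoC (Cmod l))%C by (unfold al; field; auto).
    rewrite <- Cmod2_conj. rewrite RtoC_mult, RtoC_pow. field. auto. }
  assert (K : Re (F c) <= 4 * (A - Re (h c))).
  { apply (center_Re_le F c r r'); auto.
    - intros v Hv. assert (N : v <> c). { intros ->. rewrite Cmod_minus_diag in Hv. lra. }
      destruct (Hh v) as [a Ha]. lra. destruct (Dp v a N Ha) as [b Hb].
      eexists. unfold F. apply cderiv_plus. apply cderiv_scal. apply Hb.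
      apply cderiv_mult. apply cderiv_plus. apply cderiv_mult. apply cderiv_minus. apply cderiv_id.
      apply cderiv_const. apply cderiv_const. apply cderiv_const.
      apply cderiv_minus. apply Ha. apply cderiv_const.
    - unfold F. apply ccont_plus. apply ccont_mult; auto. apply ccont_const.
      apply ccont_mult. apply ccont_plus. apply ccont_mult. apply ccont_minus. apply ccont_id.
      apply ccont_const. apply ccont_const. apply ccont_const.
      apply ccont_minus. eapply cderiv_ccont; eauto. apply ccont_const.
    - intros v Hv. assert (N : v <> c). { intros ->. rewrite Cmod_minus_diag in Hv. lra. }
      assert (N' : (v - c)%C <> RtoC 0) by now apply Cminus_eq_contra.
      set (b := (al * RtoC r / (v - c))%C).
      assert (Mb : Cmod b = 1).
      { unfold b. rewrite Cmod_div, Cmod_mult, Mal, Cmod_R, Hv, Rabs_pos_eq by (auto; lra). field. lra. }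
      replace (F v) with ((b + / b + RtoC 2) * (h v - h c))%C.
      2: { unfold F, b. rewrite E by auto. field. auto. }
      rewrite unimodular_plus_inv by auto. rewrite <- RtoC_plus, re_scal_l, Re_minus.
      specialize (HA v Hv). pose proof (re_le_Cmod b) as B. rewrite Mb in B.
      apply Rabs_le_between in B. nra. }
  rewrite Fc, re_RtoC in K.
  apply Rmult_le_reg_l with r. lra.
  replace (r * (4 * (A - Re (h c)) / r)) with (4 * (A - Re (h c))) by (field; lra). exact K.
Qed.

(** * Logarithms of zero-free functions *)

(** Squares are used because [compactness_value_2d] speaks of rectangles. *)
Definition in_square (c : C) (r : R) (v : C) : Prop :=
  Rabs (Re (v - c)) <= r /\ Rabs (Im (v - c)) <= r.

Lemma in_square_disc (c v : C) (r : R) : Cmod (v - c) <= r -> in_square c r v.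
Proof.
  intros H. split; eapply Rle_trans; try apply H. apply re_le_Cmod. apply Im_le_Cmod.
Qed.

(** Heine-Borel for a property that is monotone in a bound: local bounds yield a uniform one. It
    serves to bound [Cmod (f v)], the radii of uniform continuity and the indices of zeros. *)
Lemma compact_bound (Q : C -> R -> Prop) (c : C) (r : R) :
  (forall v M M', M <= M' -> Q v M -> Q v M') ->
  (forall t, in_square c r t -> exists eta M, 0 < eta /\ forall v, Cmod (v - t) < eta -> Q v M) ->
  exists M, forall v, in_square c r v -> Q v M.
Proof.
  intros Mon Loc.
  (* One positive number encodes both data at a point: a radius [2 * d] and a bound [/ d]. A
     positive lower bound for [d] is then an upper bound for all the bounds. The factor 2 allows for
     a distance [d] in each coordinate. *)
  set (good := fun u v (d : posreal) => forall v', Cmod (v' - (u, v)) < 2 * d -> Q v' (/ d)).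
  set (delta := fun u v => epsilon (inhabits (mkposreal 1 Rlt_0_1)) (good u v)).
  assert (Hg : forall u v, in_square c r (u, v) -> good u v (delta u v)).
  { intros u v H. unfold delta. apply epsilon_spec.
    destruct (Loc _ H) as [eta [M [He HM]]].
    assert (HM1 : 0 < Rabs M + 1) by (pose proof (Rabs_pos M); lra).
    assert (Hd : 0 < Rmin (eta / 2) (/ (Rabs M + 1))).
    { apply Rmin_glb_lt. lra. now apply Rinv_0_lt_compat. }
    exists (mkposreal _ Hd). intros v' Hv'. simpl in *.
    apply Mon with M.
    - apply Rle_trans with (Rabs M + 1). pose proof (Rle_abs M). lra.
      pose proof (Rinv_le_contravar _ _ Hd (Rmin_r (eta / 2) (/ (Rabs M + 1)))) as L.
      now rewrite Rinv_inv in L.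
    - apply HM. pose proof (Rmin_l (eta / 2) (/ (Rabs M + 1))). lra. }
  destruct (compactness_value_2d (Re c - r) (Re c + r) (Im c - r) (Im c + r) delta) as [d Hd].
  exists (/ d). intros [x y] [Hx Hy]. rewrite Re_minus in Hx. rewrite Im_minus in Hy.
  simpl in Hx, Hy. apply Rabs_le_between in Hx, Hy.
  apply NNPP. intros N. apply (Hd x y); try lra. intros [u [v [Hu [Hv [H1 [H2 H3]]]]]].
  apply N. apply Mon with (/ delta u v).
  - apply Rinv_le_contravar. apply cond_pos. exact H3.
  - apply Hg.
    + split. rewrite Re_minus. simpl. apply Rabs_le_between; lra.
      rewrite Im_minus. simpl. apply Rabs_le_between; lra.
    + eapply Rle_lt_trans. apply Cmod_le_Re_Im. rewrite Re_minus, Im_minus. simpl. lra.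
Qed.

Lemma Re_ge_near_1 (w : C) : 1 - Cmod (w - RtoC 1) <= Re w.
Proof.
  pose proof (re_le_Cmod (w - RtoC 1)) as H. rewrite Re_minus, re_RtoC in H.
  apply Rabs_le_between in H. lra.
Qed.

(** The principal logarithm, meaningful for [0 < Re w] only. It is applied to quotients of values of
    a function at nearby points. *)
Definition Clog (w : C) : C := (ln (Cmod w), atan (Im w / Re w)).

Lemma Cexp_Clog (w : C) : 0 < Re w -> Cexp (Clog w) = w.
Proof.
  intros H. assert (N : w <> RtoC 0). { intros ->. rewrite re_RtoC in H. lra. }
  apply Cmod_gt_0 in N. unfold Cexp, Clog. simpl. rewrite exp_ln by auto.
  rewrite cos_atan, sin_atan.
  assert (E : Cmod w = Re w * sqrt (1 + (Im w / Re w)²)).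
  { rewrite <- (sqrt_Rsqr (Re w)) at 1 by lra. rewrite <- sqrt_mult_alt by apply Rle_0_sqr.
    unfold Cmod. f_equal. unfold Rsqr, Re, Im in *. field. lra. }
  assert (S : 0 < sqrt (1 + (Im w / Re w)²)).
  { apply sqrt_lt_R0. pose proof (Rle_0_sqr (Im w / Re w)). lra. }
  rewrite E. destruct w as [x y]. simpl in *. apply injective_projections; simpl; field; lra.
Qed.

Lemma Clog_1 : Clog (RtoC 1) = RtoC 0.
Proof.
  unfold Clog. rewrite Cmod_1, ln_1. simpl. replace (0 / 1) with 0 by field.
  now rewrite atan_0.
Qed.

Lemma ccont_Re (w : C) : ccont (fun v => RtoC (Re v)) w.
Proof.
  intros e He. exists e. split; auto. intros v Hv. rewrite <- RtoC_minus, Cmod_R, <- Re_minus.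
  eapply Rle_lt_trans. apply re_le_Cmod. auto.
Qed.

Lemma ccont_Im (w : C) : ccont (fun v => RtoC (Im v)) w.
Proof.
  intros e He. exists e. split; auto. intros v Hv. rewrite <- RtoC_minus, Cmod_R, <- Im_minus.
  eapply Rle_lt_trans. apply Im_le_Cmod. auto.
Qed.

Lemma ccont_real_comp (phi : R -> R) (f : C -> R) (w : C) :
  ccont (fun v => RtoC (f v)) w -> continuity_pt phi (f w) -> ccont (fun v => RtoC (phi (f v))) w.
Proof.
  intros Hf Hp e He. destruct (Hp e He) as [d [Hd Q]]. destruct (Hf d Hd) as [d' [Hd' Q']].
  exists d'. split; auto. intros v Hv. specialize (Q' v Hv).
  rewrite <- RtoC_minus, Cmod_R in *.
  destruct (Req_dec (f w) (f v)) as [E|N]. rewrite E, Rminus_diag, Rabs_R0. auto.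
  apply Q. split. split; easy. exact Q'.
Qed.

Lemma ccont_Cmod (w : C) : ccont (fun v => RtoC (Cmod v)) w.
Proof.
  intros e He. exists e. split; auto. intros v Hv. rewrite <- RtoC_minus, Cmod_R.
  eapply Rle_lt_trans. 2: apply Hv. apply Rabs_le_between.
  pose proof (Cmod_triangle_inv v w). pose proof (Cmod_triangle_inv w v).
  rewrite (Cmod_minus_sym w v) in H0. lra.
Qed.

Lemma ccont_Clog (w : C) : 0 < Re w -> ccont Clog w.
Proof.
  intros H. assert (N : w <> RtoC 0). { intros ->. rewrite re_RtoC in H. lra. }
  apply Cmod_gt_0 in N.
  assert (NR : RtoC (Re w) <> RtoC 0) by (intros K; apply RtoC_inj in K; lra).
  apply ccont_ext_loc with
    (f := fun v => (RtoC (ln (Cmod v)) + Ci * RtoC (atan (Im v / Re v)))%C) (d := 1). lra.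
  { intros v _. unfold Clog. apply injective_projections; simpl; ring. }
  apply ccont_plus.
  - apply (ccont_real_comp ln Cmod). apply ccont_Cmod.
    apply derivable_continuous_pt. exists (/ Cmod w). now apply derivable_pt_lim_ln.
  - apply ccont_mult. apply ccont_const.
    apply (ccont_real_comp atan (fun v => Im v / Re v)).
    + destruct (ccont_nz_loc _ _ (ccont_Re w) NR) as [d [Hd Q]].
      apply ccont_ext_loc with (f := fun v => (RtoC (Im v) / RtoC (Re v))%C) (d := d); auto.
      { intros v Hv. destruct (Q v Hv) as [Q1 _]. rewrite RtoC_div; auto.
        intros K. apply Q1. now rewrite K. }
      apply ccont_div; auto. apply ccont_Im. apply ccont_Re.
    + apply derivable_continuous_pt. apply derivable_pt_atan.
Qed.

(** The inverse function rule in terms of slopes: the slope of [Clog] at [w] is the inverse of the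
    slope of [Cexp] at [Clog w], taken at [Clog v]. *)
Lemma cderiv_Clog (w : C) : 0 < Re w -> cderiv Clog w (/ w)%C.
Proof.
  intros H. destruct (cderiv_slope Cexp (Clog w) _ (cderiv_Cexp _)) as [psi [E [Ew [Cp _]]]].
  rewrite Cexp_Clog in Ew by auto.
  assert (Cc : ccont (fun v => psi (Clog v)) w) by (apply ccont_comp; auto; now apply ccont_Clog).
  assert (Nz : w <> RtoC 0). { intros ->. rewrite re_RtoC in H. lra. }
  assert (N : psi (Clog w) <> RtoC 0) by (now rewrite Ew).
  destruct (ccont_nz_loc _ _ Cc N) as [d [Hd Q]].
  exists (fun v => (/ psi (Clog v))%C), (Rmin d (Re w)). split. now apply Rmin_glb_lt.
  split; [|split].
  - intros v Hv. destruct (Q v) as [Q1 _]. eapply Rlt_le_trans. apply Hv. apply Rmin_l.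
    assert (Pv : 0 < Re v).
    { pose proof (re_le_Cmod (v - w)) as B. rewrite Re_minus in B.
      pose proof (Rmin_r d (Re w)). apply Rabs_le_between in B. lra. }
    destruct (Ceq_dec (Clog v) (Clog w)) as [Eq|Ne].
    + assert (v = w). { rewrite <- (Cexp_Clog v), Eq by auto. now apply Cexp_Clog. }
      subst v. ring.
    + rewrite E in * by auto. rewrite !Cexp_Clog in * by auto.
      assert ((Clog v - Clog w)%C <> RtoC 0) by now apply Cminus_eq_contra.
      assert ((v - w)%C <> RtoC 0).
      { apply Cminus_eq_contra. intros ->. now apply Ne. }
      field. auto.
  - apply ccont_inv; auto.
  - now rewrite Ew.
Qed.

(** The segment from [c] to [v] is cut into equal pieces so short that the quotient of the values of
    [g] at successive points stays in the right half plane. The sum of the principal logarithms of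
    these quotients telescopes, and each summand is differentiable in [v]. *)
Lemma log_exists (g : C -> C) (c : C) (r : R) : 0 < r ->
  (forall v, in_square c r v -> (exists l, cderiv g v l) /\ g v <> RtoC 0) ->
  exists h, h c = RtoC 0 /\
    forall v, Cmod (v - c) < r -> (exists l, cderiv h v l) /\ g v = (g c * Cexp (h v))%C.
Proof.
  intros Hr Hg.
  (* Here [/ M] is a radius within which quotients of values of [g] have positive real part. More
     than [r * M] pieces make all steps shorter than [/ M]. *)
  destruct (compact_bound (fun v M => 0 < M /\ forall v', Cmod (v' - v) * M < 1 ->
    0 < Re (g v' / g v)) c r) as [M HM].
  { intros v M M' L [H1 H2]. split. lra. intros v' Hv'. apply H2.
    eapply Rle_lt_trans. 2: apply Hv'. apply Rmult_le_compat_l; auto. apply Cmod_ge_0. }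
  { intros t Ht. destruct (Hg t Ht) as [[l Hl] N].
    assert (HA : 0 < Cmod (g t)) by now apply Cmod_gt_0.
    destruct (cderiv_ccont _ _ _ Hl (Cmod (g t) / 4)) as [d [Hd Q]]. lra.
    exists (d / 2), (2 / d). split. lra. intros v Hv. split. apply Rdiv_lt_0_compat; lra.
    intros v' Hv'.
    assert (Hv2 : Cmod (v' - v) < d / 2).
    { apply Rmult_lt_reg_r with (2 / d). apply Rdiv_lt_0_compat; lra.
      replace (d / 2 * (2 / d)) with 1 by (field; lra). auto. }
    assert (Hv3 : Cmod (v' - t) < d).
    { replace (v' - t)%C with ((v' - v) + (v - t))%C by ring.
      eapply Rle_lt_trans. apply Cmod_triangle. lra. }
    pose proof (Q v ltac:(lra)) as Q1. pose proof (Q v' Hv3) as Q2.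
    pose proof (Cmod_triangle_inv (g t) (g t - g v)) as T1.
    replace (g t - (g t - g v))%C with (g v) in T1 by ring.
    rewrite (Cmod_minus_sym (g t)) in T1.
    assert (Nv : g v <> RtoC 0) by (apply Cmod_gt_0; lra).
    eapply Rlt_le_trans. 2: apply Re_ge_near_1.
    replace (g v' / g v - RtoC 1)%C with (((g v' - g t) + - (g v - g t)) / g v)%C by (field; auto).
    rewrite Cmod_div by auto.
    pose proof (Cmod_triangle (g v' - g t) (- (g v - g t))) as T2. rewrite Cmod_opp in T2.
    apply Rlt_0_minus. apply Rmult_lt_reg_r with (Cmod (g v)). lra.
    unfold Rdiv. rewrite Rmult_assoc, Rinv_l by lra. lra. }
  assert (HMc : 0 < M).
  { apply (HM c). apply in_square_disc. rewrite Cmod_minus_diag. lra. }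
  destruct (nfloor_ex (r * M)) as [n Hn]. { apply Rmult_le_pos; lra. }
  set (N := INR (S n)).
  assert (HN : r * M < N) by (unfold N; rewrite S_INR; lra).
  assert (HN0 : 0 < N) by (apply lt_0_INR; lia).
  set (pt := fun k v => (c + RtoC (INR k / N) * (v - c))%C).
  assert (Hpt : forall k v, (k <= S n)%nat -> Cmod (v - c) < r -> Cmod (pt k v - c) < r).
  { intros k v Hk Hv. unfold pt. replace (c + RtoC (INR k / N) * (v - c) - c)%C
      with (RtoC (INR k / N) * (v - c))%C by ring.
    rewrite Cmod_mult, Cmod_R.
    assert (0 <= INR k / N <= 1).
    { apply le_INR in Hk. fold N in Hk. pose proof (pos_INR k). split.
      apply Rdiv_le_0_compat; lra. apply Rmult_le_reg_r with N; auto.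
      unfold Rdiv. rewrite Rmult_assoc, Rinv_l by lra. lra. }
    rewrite Rabs_pos_eq by lra. pose proof (Cmod_ge_0 (v - c)). nra. }
  assert (Ind : forall k, (k <= S n)%nat -> exists h, h c = RtoC 0 /\
    forall v, Cmod (v - c) < r -> (exists l, cderiv h v l) /\ g (pt k v) = (g c * Cexp (h v))%C).
  { induction k as [|k IH]; intros Hk.
    - exists (fun _ => RtoC 0). split; auto. intros v Hv. split. eexists. apply cderiv_const.
      rewrite Cexp_0. unfold pt. simpl.
      replace (c + RtoC (0 / N) * (v - c))%C with c. ring.
      replace (0 / N) with 0 by (field; lra). ring.
    - destruct IH as [h [H0 Hh]]. lia.
      assert (Sq : forall j v, (j <= S n)%nat -> Cmod (v - c) < r ->
        (exists l, cderiv g (pt j v) l) /\ g (pt j v) <> RtoC 0).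
      { intros j v Hj Hv. apply Hg. apply in_square_disc. left. now apply Hpt. }
      assert (RP : forall v, Cmod (v - c) < r -> 0 < Re (g (pt (S k) v) / g (pt k v))).
      { intros v Hv. destruct (HM (pt k v)) as [_ HM2].
        apply in_square_disc. left. apply Hpt; auto. lia.
        apply HM2. unfold pt.
        replace (c + RtoC (INR (S k) / N) * (v - c) - (c + RtoC (INR k / N) * (v - c)))%C
          with (RtoC (INR (S k) / N - INR k / N) * (v - c))%C by (rewrite RtoC_minus; ring).
        rewrite Cmod_mult, Cmod_R, S_INR.
        replace ((INR k + 1) / N - INR k / N) with (/ N) by (field; lra).
        rewrite Rabs_pos_eq by (left; now apply Rinv_0_lt_compat).
        apply Rmult_lt_reg_l with N; auto.
        replace (N * (/ N * Cmod (v - c) * M)) with (Cmod (v - c) * M) by (field; lra).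
        nra. }
      assert (Dp : forall j v, cderiv (pt j) v (RtoC (INR j / N))).
      { intros j v. unfold pt. eapply cderiv_eq. apply cderiv_plus. apply cderiv_const.
        apply cderiv_scal. apply cderiv_minus. apply cderiv_id. apply cderiv_const. ring. }
      exists (fun v => (h v + Clog (g (pt (S k) v) / g (pt k v)))%C). split.
      + rewrite H0. replace (pt (S k) c) with c by (unfold pt; ring).
        replace (pt k c) with c by (unfold pt; ring).
        replace (g c / g c)%C with (RtoC 1). rewrite Clog_1. ring.
        destruct (Hg c) as [_ Ng]. apply in_square_disc. rewrite Cmod_minus_diag; lra.
        field; auto.
      + intros v Hv. destruct (Hh v Hv) as [[l Hl] Eh].
        destruct (Sq (S k) v ltac:(lia) Hv) as [[l1 D1] N1].
        destruct (Sq k v ltac:(lia) Hv) as [[l2 D2] N2].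
        split.
        * eexists. apply cderiv_plus. apply Hl.
          apply (cderiv_comp Clog (fun v => (g (pt (S k) v) / g (pt k v))%C)).
          apply cderiv_div. apply (cderiv_comp g (pt (S k))). apply Dp. apply D1.
          apply (cderiv_comp g (pt k)). apply Dp. apply D2. auto.
          apply cderiv_Clog. now apply RP.
        * rewrite Cexp_plus, Cexp_Clog by now apply RP.
          rewrite Cmult_assoc, <- Eh. field. auto. }
  destruct (Ind (S n) (le_n _)) as [h [H0 Hh]]. exists h. split; auto.
  intros v Hv. destruct (Hh v Hv) as [H1 H2]. split; auto. rewrite <- H2. f_equal.
  unfold pt. fold N. replace (N / N) with 1 by (field; lra). ring.
Qed.

Lemma cderiv_line (h : C -> C) (c d l : C) (t : R) :
  cderiv h (c + RtoC t * d)%C l ->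
  is_derive (fun s => Re (h (c + RtoC s * d)%C)) t (Re (l * d)%C).
Proof.
  intros H. apply is_derive_Reals. intros e He.
  assert (Hm : 0 < Cmod d + 1) by (pose proof (Cmod_ge_0 d); lra).
  destruct (proj1 (cderiv_eps _ _ _) H (e / 2 / (Cmod d + 1))) as [del [Hd Q]].
  { apply Rdiv_lt_0_compat; lra. }
  assert (Hp : 0 < del / (Cmod d + 1)) by (apply Rdiv_lt_0_compat; lra).
  exists (mkposreal _ Hp). intros s Ns Hs. simpl in Hs.
  specialize (Q (c + RtoC (t + s) * d)%C).
  replace (c + RtoC (t + s) * d - (c + RtoC t * d))%C with (RtoC s * d)%C in Q by (rewrite RtoC_plus; ring).
  rewrite Cmod_mult, Cmod_R in Q.
  pose proof (Rabs_pos_lt s Ns) as Ps. pose proof (Cmod_ge_0 d) as Pd.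
  assert (B : Rabs s * (Cmod d + 1) < del).
  { apply Rmult_lt_compat_r with (r := Cmod d + 1) in Hs; auto.
    replace (del / (Cmod d + 1) * (Cmod d + 1)) with del in Hs by (field; lra). exact Hs. }
  specialize (Q ltac:(nra)).
  set (X := (h (c + RtoC (t + s) * d) - h (c + RtoC t * d) - l * (RtoC s * d))%C) in *.
  replace ((Re (h (c + RtoC (t + s) * d)%C) - Re (h (c + RtoC t * d)%C)) / s - Re (l * d)%C) with (Re X / s).
  2: { unfold X. replace (l * (RtoC s * d))%C with (RtoC s * (l * d))%C by ring.
       rewrite !Re_minus, re_scal_l. field. auto. }
  unfold Rdiv. rewrite Rabs_mult, Rabs_inv. apply Rmult_lt_reg_r with (Rabs s); auto.
  rewrite Rmult_assoc, Rinv_l by lra. rewrite Rmult_1_r.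
  eapply Rle_lt_trans. apply re_le_Cmod. eapply Rle_lt_trans. apply Q.
  apply Rle_lt_trans with (e / 2 * Rabs s); [|nra].
  replace (e / 2 / (Cmod d + 1) * (Rabs s * Cmod d)) with (e / 2 * Rabs s * (Cmod d / (Cmod d + 1))) by (field; lra).
  rewrite <- (Rmult_1_r (e / 2 * Rabs s)) at 2. apply Rmult_le_compat_l. nra.
  apply Rmult_le_reg_r with (Cmod d + 1); auto. unfold Rdiv.
  rewrite Rmult_assoc, Rinv_l by lra. lra.
Qed.

Lemma MVT_unit (f : R -> R) : (forall t, 0 <= t <= 1 -> ex_derive f t) ->
  exists t, 0 <= t <= 1 /\ f 1 - f 0 = Derive f t.
Proof.
  intros H. destruct (MVT_gen f 0 1 (Derive f)) as [t [Ht E]].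
  - intros x Hx. rewrite Rmin_left, Rmax_right in Hx by lra. apply Derive_correct. apply H. lra.
  - intros x Hx. rewrite Rmin_left, Rmax_right in Hx by lra.
    apply continuity_pt_filterlim. apply (ex_derive_continuous f x). now apply H.
  - rewrite Rmin_left, Rmax_right in Ht by lra. exists t. split; auto. rewrite E. ring.
Qed.

(** The real mean value theorem is applied to the component of [h] in the direction of the total
    increment [D]. It yields [Cmod D ^ 2 <= Cmod D * (M * Cmod d)]. *)
Lemma cderiv_mean_value (h : C -> C) (c d : C) (M : R) :
  (forall t, 0 <= t <= 1 -> exists l, cderiv h (c + RtoC t * d)%C l /\ Cmod l <= M) ->
  Cmod (h (c + d)%C - h c)%C <= M * Cmod d.
Proof.
  intros H. set (D := (h (c + d) - h c)%C).
  set (f := fun t => Re (Cconj D * h (c + RtoC t * d)%C)).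
  assert (Df : forall t, 0 <= t <= 1 -> exists l, Cmod l <= M /\ is_derive f t (Re (Cconj D * l * d)%C)).
  { intros t Ht. destruct (H t Ht) as [l [Hl HM]]. exists l. split; auto.
    apply (cderiv_line (fun v => (Cconj D * h v)%C)). now apply cderiv_scal. }
  destruct (MVT_unit f) as [t [Ht E]].
  { intros t Ht. destruct (Df t Ht) as [l [_ Hl]]. eexists. apply Hl. }
  destruct (Df t Ht) as [l [HM Hl]]. rewrite (is_derive_unique _ _ _ Hl) in E.
  unfold f in E. replace (c + RtoC 1 * d)%C with (c + d)%C in E by ring.
  replace (c + RtoC 0 * d)%C with c in E by ring.
  rewrite <- Re_minus in E. replace (Cconj D * h (c + d) - Cconj D * h c)%C with (D * Cconj D)%C in E
    by (unfold D at 1; ring).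
  rewrite <- Cmod2_conj, re_RtoC in E.
  pose proof (re_le_Cmod (Cconj D * l * d)) as B. rewrite !Cmod_mult, Cmod_conj in B.
  pose proof (Rle_abs (Re (Cconj D * l * d)%C)).
  pose proof (Cmod_ge_0 D). pose proof (Cmod_ge_0 d). pose proof (Cmod_ge_0 l).
  assert (Cmod l * Cmod d <= M * Cmod d) by (apply Rmult_le_compat_r; auto).
  destruct H1 as [H1|H1].
  - apply Rmult_le_reg_l with (Cmod D); auto. nra.
  - rewrite <- H1. nra.
Qed.

(* Harnack's inequality along a ray: by Borel-Caratheodory [P = A - Re h] satisfies [|P'| <= 8 P]. *)
Lemma harnack_derivative (h : C -> C) (c0 : C) (rho A : R) : 0 < rho -> h c0 = RtoC 0 ->
  (forall v, Cmod (v - c0) < 2 * rho -> (exists l, cderiv h v l) /\ Re (h v) <= A) ->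
  forall c l, Cmod (c - c0) < rho -> cderiv h c l -> Cmod l <= 8 * exp 8 * A / rho.
Proof.
  intros Hr H0 Hh.
  assert (BC : forall c l, Cmod (c - c0) < rho -> cderiv h c l -> Cmod l <= 8 * (A - Re (h c)) / rho).
  { intros c l Hc Hl.
    assert (Tr : forall v, Cmod (v - c) < rho -> Cmod (v - c0) < 2 * rho).
    { intros v Hv. replace (v - c0)%C with ((v - c) + (c - c0))%C by ring.
      eapply Rle_lt_trans. apply Cmod_triangle. lra. }
    replace (8 * (A - Re (h c)) / rho) with (4 * (A - Re (h c)) / (rho / 2)) by (field; lra).
    apply (borel_caratheodory h c l (rho / 2) rho A); auto. lra.
    intros v Hv. apply Hh. auto. intros v Hv. apply Hh. apply Tr. lra. }
  intros c l Hc Hl. set (d := (c - c0)%C).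
  assert (On : forall t, 0 <= t <= 1 -> Cmod (c0 + RtoC t * d - c0) < rho).
  { intros t Ht. replace (c0 + RtoC t * d - c0)%C with (RtoC t * d)%C by ring.
    rewrite Cmod_mult, Cmod_R, Rabs_pos_eq by lra. unfold d. pose proof (Cmod_ge_0 (c - c0)). nra. }
  (* Along the ray the derivative of [P = A - Re h] is at most [8 * P / rho * Cmod d <= 8 * P], so
     [Q] does not increase, and [P] at [c] is at most [exp 8] times its value [A] at [c0]. *)
  set (Q := fun t => exp (- 8 * t) * (A - Re (h (c0 + RtoC t * d)%C))).
  assert (DQ : forall t, 0 <= t <= 1 -> exists a, is_derive Q t a /\ a <= 0).
  { intros t Ht. destruct (Hh (c0 + RtoC t * d)%C) as [[m Hm] HA].
    { specialize (On t Ht). lra. }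
    pose proof (BC _ m (On t Ht) Hm) as B. pose proof (cderiv_line h c0 d m t Hm) as DL.
    set (P := A - Re (h (c0 + RtoC t * d)%C)) in *.
    exists (- 8 * exp (- 8 * t) * P + exp (- 8 * t) * (0 - Re (m * d)%C)). split.
    - unfold Q, P. apply (is_derive_mult (fun t => exp (- 8 * t)) (fun t => A - Re (h (c0 + RtoC t * d)%C))).
      + auto_derive; auto. ring.
      + apply (is_derive_minus (fun _ => A) (fun t => Re (h (c0 + RtoC t * d)%C))). apply (is_derive_const A t). exact DL.
      + intros; apply Rmult_comm.
    - pose proof (exp_pos (- 8 * t)).
      assert (Rabs (Re (m * d)%C) <= 8 * P).
      { eapply Rle_trans. apply re_le_Cmod. rewrite Cmod_mult.
        apply Rle_trans with (8 * P / rho * rho). apply Rmult_le_compat; try apply Cmod_ge_0; auto.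
        unfold d; lra. right; field; lra. }
      apply Rabs_le_between in H1. nra. }
  destruct (MVT_unit Q) as [t [Ht E]].
  { intros t Ht. destruct (DQ t Ht) as [a [Ha _]]. eexists; eauto. }
  destruct (DQ t Ht) as [a [Ha Hn]]. rewrite (is_derive_unique _ _ _ Ha) in E.
  unfold Q in E. replace (c0 + RtoC 0 * d)%C with c0 in E by ring.
  replace (c0 + RtoC 1 * d)%C with c in E by (unfold d; ring).
  rewrite H0, re_RtoC, Rmult_0_r, exp_0 in E.
  assert (F : A - Re (h c) <= exp 8 * A).
  { apply Rmult_le_reg_l with (exp (- 8 * 1)). apply exp_pos.
    rewrite <- Rmult_assoc, <- exp_plus. replace (-8 * 1 + 8) with 0 by ring. rewrite exp_0. lra. }
  eapply Rle_trans. apply BC; eauto.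
  unfold Rdiv. apply Rmult_le_compat_r. left. now apply Rinv_0_lt_compat. lra.
Qed.

(** With [h] a logarithm of [g], the difference [h (v + d) - h v] is at most
    [8 * exp 8 * A / rho * Cmod d] near [c0], by the mean value inequality. Its derivative at [c0]
    is the wanted variation, so Cauchy's estimate on radius [rho / 4] applies, without a second
    derivative of [h]; this gives [64 = 8 * 2 * 4]. *)
Lemma log_derivative_variation (g : C -> C) (c0 p m0 m : C) (rho A : R) : 0 < rho ->
  (forall v, in_square c0 (2 * rho) v -> (exists l, cderiv g v l) /\ g v <> RtoC 0) ->
  (forall v, Cmod (v - c0) < 2 * rho -> Cmod (g v) <= Cmod (g c0) * exp A) ->
  Cmod (p - c0) <= rho / 4 -> cderiv g c0 m0 -> cderiv g p m ->
  Cmod (m / g p - m0 / g c0) <= 64 * exp 8 * A * Cmod (p - c0) / rho ^ 2.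
Proof.
  intros Hr Hg HA Hp D0 Dp.
  destruct (log_exists g c0 (2 * rho)) as [h [H0 Hh]]; auto. lra.
  assert (N0 : g c0 <> RtoC 0).
  { apply Hg. apply in_square_disc. rewrite Cmod_minus_diag. lra. }
  assert (Ng : forall v, Cmod (v - c0) < 2 * rho -> g v <> RtoC 0).
  { intros v Hv. apply Hg. apply in_square_disc. lra. }
  assert (P0 : 0 < Cmod (g c0)) by now apply Cmod_gt_0.
  assert (Hh' : forall v, Cmod (v - c0) < 2 * rho -> (exists l, cderiv h v l) /\ Re (h v) <= A).
  { intros v Hv. destruct (Hh v Hv) as [Hl E]. split; auto.
    specialize (HA v Hv). rewrite E, Cmod_mult, Cmod_Cexp in HA.
    apply Rmult_le_reg_l in HA; auto. apply Rnot_lt_le. intros L.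
    apply exp_increasing in L. lra. }
  assert (HD : forall v l, Cmod (v - c0) < 2 * rho -> cderiv g v l -> cderiv h v (l / g v)%C).
  { intros v l Hv Hl. destruct (Hh v Hv) as [[b Hb] E].
    eapply cderiv_eq. apply Hb.
    assert (l = (g c0 * (Cexp (h v) * b))%C).
    { apply (cderiv_unique g v); auto.
      apply cderiv_ext_loc with (f := fun u => (g c0 * Cexp (h u))%C) (d := 2 * rho - Cmod (v - c0)).
      lra. intros u Hu. symmetry. apply Hh. replace (u - c0)%C with ((u - v) + (v - c0))%C by ring.
      eapply Rle_lt_trans. apply Cmod_triangle. lra.
      apply cderiv_scal. apply (cderiv_comp Cexp h); auto. apply cderiv_Cexp. }
    rewrite E, H. field. split; auto. apply Cexp_nz. }
  pose proof (harnack_derivative h c0 rho A Hr H0 Hh') as HK.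
  set (d := (p - c0)%C) in *.
  set (D := fun v => (h (v + d) - h v)%C).
  replace (64 * exp 8 * A * Cmod d / rho ^ 2)
    with (2 * (8 * exp 8 * A / rho * Cmod d) / (rho / 4)) by (field; lra).
  assert (Near : forall v t, Cmod (v - c0) < rho / 2 -> 0 <= t <= 1 -> Cmod (v + RtoC t * d - c0) < rho).
  { intros v t Hv Ht. replace (v + RtoC t * d - c0)%C with ((v - c0) + RtoC t * d)%C by ring.
    eapply Rle_lt_trans. apply Cmod_triangle. rewrite Cmod_mult, Cmod_R, Rabs_pos_eq by lra.
    pose proof (Cmod_ge_0 d). nra. }
  apply (cauchy_estimate D c0 _ (rho / 4) (rho / 2)). lra.
  - intros v Hv. destruct (Hh' v) as [[a Ha] _]. lra.
    destruct (Hh' (v + d)%C) as [[b Hb] _].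
    { pose proof (Near v 1 Hv ltac:(lra)) as B. replace (RtoC 1 * d)%C with d in B by ring. lra. }
    eexists. unfold D. apply cderiv_minus. 2: apply Ha.
    apply (cderiv_comp h (fun v => (v + d)%C)). apply cderiv_plus. apply cderiv_id. apply cderiv_const. apply Hb.
  - unfold D. apply cderiv_minus.
    + eapply cderiv_eq. apply (cderiv_comp h (fun v => (v + d)%C)). apply cderiv_plus. apply cderiv_id. apply cderiv_const.
      replace (c0 + d)%C with p by (unfold d; ring). apply HD; auto. fold d. lra. apply Dp. ring.
    + apply HD; auto. rewrite Cmod_minus_diag. lra.
  - intros v Hv. unfold D. apply cderiv_mean_value. intros t Ht.
    pose proof (Near v t ltac:(lra) Ht) as B. destruct (Hh' (v + RtoC t * d)%C) as [[a Ha] _]. lra.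
    exists a. split; auto. eapply HK; eauto.
Qed.

(** * The logarithmic derivative and the zeros *)

Lemma exp_le_exp (x y : R) : x <= y -> exp x <= exp y.
Proof. intros [H| ->]. left. now apply exp_increasing. apply Rle_refl. Qed.

Lemma RtoC_neq (x y : R) : x <> y -> RtoC x <> RtoC y.
Proof. intros N K. apply N. now apply RtoC_inj. Qed.

Lemma cderiv_pow (a w : C) (m : nat) : exists l, cderiv (fun v => Cpow (v - a) m) w l.
Proof.
  induction m as [|m [l IH]]; simpl. eexists; apply cderiv_const.
  eexists. apply cderiv_mult. apply cderiv_minus. apply cderiv_id. apply cderiv_const. apply IH.
Qed.

(** [has_multiplicity] with the differentiability of the cofactor expressed by [cderiv], the form
    obtained when a linear factor is divided out. *)
Definition cmult (f : C -> C) (w0 : C) (m : nat) : Prop :=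
  exists g, centire g /\ g w0 <> RtoC 0 /\ forall w, f w = (Cpow (w - w0) m * g w)%C.

(** [P] holds the indices of the zeros already divided out of the function originally listed by [z];
    the others must still count the multiplicities exactly. *)
Definition zeros_outside (f : C -> C) (z : Z -> Rbar) (P : Z -> Prop) : Prop :=
  forall x : R, exists l : list Z, NoDup l /\
    (forall n, In n l <-> z n = Finite x /\ ~ P n) /\ cmult f (RtoC x) (length l).

Lemma zeros_outside_ext (f : C -> C) (z : Z -> Rbar) (P P' : Z -> Prop) :
  (forall n, P n <-> P' n) -> zeros_outside f z P -> zeros_outside f z P'.
Proof.
  intros E H x. destruct (H x) as [l [H1 [H2 H3]]]. exists l. split; auto. split; auto.
  intros n. rewrite H2, E. tauto.
Qed.

Lemma lists_zeros_outside (f : C -> C) (z : Z -> Rbar) :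
  lists_zeros f z -> zeros_outside f z (fun _ => False).
Proof.
  intros [_ H] x. destruct (H x) as [l [H1 [H2 [g [G1 [G2 G3]]]]]]. exists l. split; auto. split.
  intros n. rewrite H2. tauto. exists g. split; auto. now apply entire_centire.
Qed.

(** At [x] the quotient is read off the factorization of [f], with one factor less. The work is to
    show that the multiplicities at the other points [y] are unchanged. *)
Lemma divide_zero (f : C -> C) (z : Z -> Rbar) (P : Z -> Prop) (n0 : Z) (x : R) :
  zeros_outside f z P -> z n0 = Finite x -> ~ P n0 ->
  exists g, centire g /\ (forall w, f w = ((w - RtoC x) * g w)%C) /\
    zeros_outside g z (fun n => P n \/ n = n0).
Proof.
  intros H Hz HP. destruct (H x) as [l [ND [Hl [k [Ck [Nk Ek]]]]]].
  assert (Hin : In n0 l) by now apply Hl.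
  destruct (in_split _ _ Hin) as [l1 [l2 El]].
  set (m := length (l1 ++ l2)).
  assert (Em : length l = S m) by (unfold m; rewrite El, !length_app; simpl; lia).
  rewrite Em in Ek. simpl in Ek.
  set (g := fun w => (Cpow (w - RtoC x) m * k w)%C).
  assert (Cg : centire g).
  { intros w. destruct (Ck w) as [b Hb]. destruct (cderiv_pow (RtoC x) w m) as [a Ha].
    eexists. apply cderiv_mult. apply Ha. apply Hb. }
  assert (Eg : forall w, f w = ((w - RtoC x) * g w)%C) by (intros w; rewrite Ek; unfold g; ring).
  exists g. split; [exact Cg|split; [exact Eg|]].
  intros y. destruct (Req_dec y x) as [->|N].
  - exists (l1 ++ l2). rewrite El in ND. split; [|split].
    + eapply NoDup_remove_1; eauto.
    + pose proof (NoDup_remove_2 _ _ _ ND) as N2. intros n. split.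
      * intros I. assert (n <> n0) by (intros ->; auto).
        assert (I2 : In n l). { rewrite El. apply in_app_iff. apply in_app_iff in I. simpl; tauto. }
        apply Hl in I2. tauto.
      * intros [E1 E2]. assert (I2 : In n l) by (apply Hl; tauto).
        rewrite El in I2. apply in_app_iff in I2. apply in_app_iff. simpl in I2.
        destruct I2 as [I2|[I2|I2]]; auto. subst n. tauto.
    + exists k. auto.
  - destruct (H y) as [ly [NDy [Hly [k' [Ck' [Nk' Ek']]]]]].
    exists ly. split; auto. split.
    { intros n. rewrite Hly. split; intros [E1 E2]; (split; [exact E1|]); [|tauto].
      intros [E3|E3]. auto. subst n. rewrite Hz in E1. injection E1; intros; lra. }
    set (m' := length ly) in *.
    assert (Nxy : (RtoC x - RtoC y)%C <> RtoC 0) by (apply Cminus_eq_contra; apply RtoC_neq; auto).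
    (* The cofactor at [y] has two expressions: [k' w / (w - x)], differentiable off [x], and
       [g w / (w - y) ^ m'], differentiable off [y]. They agree where both make sense, so no
       removable singularity has to be treated. *)
    set (k2 := fun w => if Ceq_dec w (RtoC x) then (g (RtoC x) / Cpow (RtoC x - RtoC y) m')%C
                        else (k' w / (w - RtoC x))%C).
    assert (K2 : forall w, w <> RtoC x -> k2 w = (k' w / (w - RtoC x))%C).
    { intros w Nw. unfold k2. destruct (Ceq_dec w (RtoC x)); easy. }
    assert (K2x : k2 (RtoC x) = (g (RtoC x) / Cpow (RtoC x - RtoC y) m')%C).
    { unfold k2. destruct (Ceq_dec (RtoC x) (RtoC x)); easy. }
    assert (Eg2 : forall w, g w = (Cpow (w - RtoC y) m' * k2 w)%C).
    { intros w. destruct (Ceq_dec w (RtoC x)) as [->|Nw].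
      - rewrite K2x. field. now apply Cpow_nz.
      - rewrite K2 by auto. apply Cminus_eq_contra in Nw.
        replace (g w) with (f w / (w - RtoC x))%C by (rewrite Eg; field; auto).
        rewrite Ek'. field. auto. }
    exists k2. split; [|split; [|exact Eg2]].
    + intros w. destruct (Ceq_dec w (RtoC x)) as [->|Nw].
      * destruct (Cg (RtoC x)) as [a Ha]. destruct (cderiv_pow (RtoC y) (RtoC x) m') as [b Hb].
        eexists. apply cderiv_ext_loc with (f := fun w => (g w / Cpow (w - RtoC y) m')%C)
          (d := Cmod (RtoC x - RtoC y)). now apply Cmod_gt_0.
        { intros v Hv. rewrite Eg2. field. apply Cpow_nz. apply Cminus_eq_contra. intros ->.
          rewrite Cmod_minus_sym in Hv. lra. }
        apply cderiv_div. apply Ha. apply Hb. now apply Cpow_nz.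
      * destruct (Ck' w) as [a Ha]. eexists.
        apply cderiv_ext_loc with (f := fun w => (k' w / (w - RtoC x))%C) (d := Cmod (w - RtoC x)).
        apply Cmod_gt_0. now apply Cminus_eq_contra.
        { intros v Hv. symmetry. apply K2. intros ->. rewrite Cmod_minus_sym in Hv. lra. }
        apply cderiv_div. apply Ha. apply cderiv_minus. apply cderiv_id. apply cderiv_const.
        now apply Cminus_eq_contra.
    + rewrite K2 by now apply RtoC_neq. unfold Cdiv. apply Cmult_neq_0; auto.
      intros K. assert (Q : (RtoC y - RtoC x)%C <> RtoC 0) by (apply Cminus_eq_contra; now apply RtoC_neq).
      apply C1_nz. rewrite <- (Cinv_r _ Q), K. ring.
Qed.

Fixpoint root_prod (zeta : nat -> R) (K : nat) (w : C) : C :=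
  match K with
  | O => RtoC 1
  | S k => (root_prod zeta k w * (w - RtoC (zeta k)))%C
  end.

Fixpoint csum (u : nat -> C) (K : nat) : C :=
  match K with
  | O => RtoC 0
  | S k => (csum u k + u k)%C
  end.

Lemma csum_minus (u v : nat -> C) (K : nat) :
  csum (fun k => (u k - v k)%C) K = (csum u K - csum v K)%C.
Proof. induction K as [|K IH]; simpl. ring. rewrite IH. ring. Qed.

Lemma divide_zeros (f : C -> C) (z : Z -> Rbar) (a : Z) (zeta : nat -> R) (K : nat) :
  centire f -> zeros_outside f z (fun _ => False) ->
  (forall k, (k < K)%nat -> z (a + Z.of_nat k)%Z = Finite (zeta k)) ->
  exists g, centire g /\ (forall w, f w = (root_prod zeta K w * g w)%C) /\
    zeros_outside g z (fun n => (a <= n < a + Z.of_nat K)%Z).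
Proof.
  intros Cf H. induction K as [|K IH]; intros Hz.
  - exists f. split; auto. split. intros; simpl; ring.
    eapply zeros_outside_ext. 2: apply H. intros n; simpl; lia.
  - destruct IH as [g [Cg [Eg Zg]]]. intros k Hk; apply Hz; lia.
    destruct (divide_zero g z _ (a + Z.of_nat K)%Z (zeta K) Zg) as [g' [Cg' [Eg' Zg']]].
    apply Hz; lia. lia.
    exists g'. split; auto. split.
    + intros w. rewrite Eg, Eg'. simpl. ring.
    + eapply zeros_outside_ext. 2: apply Zg'. intros n; cbv beta. lia.
Qed.

Lemma root_prod_le (zeta : nat -> R) (K : nat) (w v : C) :
  (forall k, (k < K)%nat -> Cmod (w - RtoC (zeta k)) <= Cmod (v - RtoC (zeta k))) ->
  Cmod (root_prod zeta K w) <= Cmod (root_prod zeta K v).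
Proof.
  induction K as [|K IH]; intros H; simpl. lra.
  rewrite !Cmod_mult. apply Rmult_le_compat; try apply Cmod_ge_0. apply IH; intros; apply H; lia.
  apply H. lia.
Qed.

Lemma cderiv_root_prod (zeta : nat -> R) (K : nat) (w : C) :
  (forall k, (k < K)%nat -> w <> RtoC (zeta k)) ->
  cderiv (root_prod zeta K) w (root_prod zeta K w * csum (fun k => (/ (w - RtoC (zeta k)))%C) K)%C.
Proof.
  induction K as [|K IH]; intros H; simpl.
  - eapply cderiv_eq. apply cderiv_const. ring.
  - eapply cderiv_eq. apply (cderiv_mult (root_prod zeta K) (fun w => (w - RtoC (zeta K))%C)).
    apply IH. intros; apply H; lia. apply cderiv_minus. apply cderiv_id. apply cderiv_const.
    cbv beta. field. apply Cminus_eq_contra. apply H; lia.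
Qed.

Lemma log_derivative_factor (f g : C -> C) (zeta : nat -> R) (K : nat) (w m : C) :
  centire g -> (forall v, f v = (root_prod zeta K v * g v)%C) -> f w <> RtoC 0 -> cderiv f w m ->
  exists m', cderiv g w m' /\
    (m / f w)%C = (csum (fun k => (/ (w - RtoC (zeta k)))%C) K + m' / g w)%C.
Proof.
  intros Cg E N Hm.
  assert (Ng : g w <> RtoC 0). { intros Q. apply N. rewrite E, Q. ring. }
  assert (Np : root_prod zeta K w <> RtoC 0). { intros Q. apply N. rewrite E, Q. ring. }
  assert (Nk : forall k, (k < K)%nat -> w <> RtoC (zeta k)).
  { clear - Np. intros k. induction K as [|K IH]; intros Hk. lia. simpl in Np.
    destruct (Nat.eq_dec k K) as [->|Nk]. intros Q. apply Np. rewrite Q. ring.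
    apply IH. intros Q. apply Np. rewrite Q. ring. lia. }
  destruct (Cg w) as [m' Hm']. exists m'. split; auto.
  pose proof (cderiv_mult _ _ _ _ _ (cderiv_root_prod zeta K w Nk) Hm') as D.
  apply (cderiv_ext _ f) in D. 2: intros; now rewrite E.
  rewrite (cderiv_unique _ _ _ _ Hm D), E. field. auto.
Qed.

(** This is the growth that [log_derivative_variation] tolerates: its bound is [A / rho ^ 2] up to a
    factor, with [A] of the size of [eps * rho ^ 2]. *)
Definition small_growth (f : C -> C) : Prop :=
  forall eps, 0 < eps -> exists r0, forall w, r0 <= Cmod w ->
    Cmod (f w) <= exp (eps * Cmod w ^ 2).

Lemma zeros_outside_nz (g : C -> C) (z : Z -> Rbar) (P : Z -> Prop) (x : R) :
  zeros_outside g z P -> (forall n, z n = Finite x -> P n) -> g (RtoC x) <> RtoC 0.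
Proof.
  intros H HP. destruct (H x) as [l [_ [Hl [k [_ [Nk Ek]]]]]].
  destruct l as [|n l].
  - rewrite Ek. simpl. now replace (RtoC 1 * k (RtoC x))%C with (k (RtoC x)) by ring.
  - exfalso. destruct (proj1 (Hl n) (or_introl eq_refl)) as [H1 H2]. auto.
Qed.

Lemma real_of_Im (w : C) : Im w = 0 -> w = RtoC (Re w).
Proof. intros H. destruct w as [x y]. simpl in *. subst. reflexivity. Qed.

(* Landau's argument: dividing [f] by the linear factors of all zeros of modulus
   at most [5 rho] leaves a zero-free function whose growth is no worse than that
   of [f], because those factors are larger on [|u - c0| >= 14 rho] than at [c0]. *)
Lemma log_derivative_limit (f : C -> C) (z : Z -> Rbar) (c0 p m0 m : C) (eps : R) :
  centire f -> small_growth f -> (forall w, f w = RtoC 0 -> Im w = 0) ->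
  zeros_outside f z (fun _ => False) ->
  f c0 <> RtoC 0 -> f p <> RtoC 0 -> cderiv f c0 m0 -> cderiv f p m -> 0 < eps ->
  exists R0, forall (r : R) (a : Z) (zeta : nat -> R) (K : nat), R0 <= r ->
    (forall k, (k < K)%nat -> z (a + Z.of_nat k)%Z = Finite (zeta k)) ->
    (forall n x, z n = Finite x -> (Rabs x <= r <-> (a <= n < a + Z.of_nat K)%Z)) ->
    Cmod (m / f p - m0 / f c0
      - csum (fun k => (/ (p - RtoC (zeta k)) - / (c0 - RtoC (zeta k)))%C) K) <= eps.
Proof.
  intros Cf Gf Rf Zf Nc Np Dc Dp He.
  assert (Pc : 0 < Cmod (f c0)) by now apply Cmod_gt_0.
  set (L := Rabs (ln (Cmod (f c0)))).
  assert (HL : 0 <= L) by apply Rabs_pos.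
  set (d := Cmod (p - c0)). assert (Hd : 0 <= d) by apply Cmod_ge_0.
  set (B := 64 * exp 8). assert (HB : 0 < B) by (pose proof (exp_pos 8); unfold B; lra).
  (* The final bound is [B * (401 * eta) * d]. Of the [401], [400] comes from [Cmod u <= 19 * rho]
     and [1] from the term [L], which is at most [eta * rho ^ 2]. *)
  set (eta := eps / (B * (d + 1) * 401)).
  assert (HBd : 0 < B * (d + 1) * 401) by (apply Rmult_lt_0_compat; [apply Rmult_lt_0_compat|]; lra).
  assert (Heta : 0 < eta) by now apply Rdiv_lt_0_compat.
  destruct (Gf eta Heta) as [r0 Hr0].
  assert (HLe : 0 <= L / eta) by now apply Rdiv_le_0_compat.
  (* With [r = 5 * rho], the square of half side [2 * rho] around [c0] lies in the disc of radius
     [r], as [rho >= Cmod c0]. The term [4 * d] puts [p] within [rho / 4] of [c0], [Rabs r0] makes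
     the growth bound available, and [1 + L / eta] absorbs [L]. *)
  exists (5 * (Cmod c0 + 4 * d + Rabs r0 + 1 + L / eta)).
  intros r a zeta K Hr Hz Hin.
  set (rho := r / 5).
  assert (Hc0 : 0 <= Cmod c0) by apply Cmod_ge_0.
  assert (Hr0' : 0 <= Rabs r0) by apply Rabs_pos. pose proof (Rle_abs r0) as Hr0''.
  assert (Hrho : Cmod c0 + 4 * d + Rabs r0 + 1 + L / eta <= rho) by (unfold rho; lra).
  assert (Er : r = 5 * rho) by (unfold rho; field).
  destruct (divide_zeros f z a zeta K Cf Zf Hz) as [g [Cg [Eg Zg]]].
  destruct (log_derivative_factor f g zeta K c0 m0 Cg Eg Nc Dc) as [m0' [Dc' Ec]].
  destruct (log_derivative_factor f g zeta K p m Cg Eg Np Dp) as [m' [Dp' Ep]].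
  rewrite csum_minus, Ec, Ep.
  match goal with |- Cmod ?X <= _ => replace X with (m' / g p - m0' / g c0)%C by ring end.
  (* [L] compensates for a small value of [Cmod (f c0)]: [exp (eta * Cmod u ^ 2) <= Cmod (f c0) *
     exp A]. *)
  set (A := eta * 400 * rho ^ 2 + L).
  apply Rle_trans with (B * A * d / rho ^ 2).
  - apply log_derivative_variation; auto. lra.
    + intros v Hv. split. apply Cg. intros Gv.
      assert (Fv : f v = RtoC 0) by (rewrite Eg, Gv; ring).
      apply Rf in Fv. apply real_of_Im in Fv.
      assert (Hv2 : Cmod v <= r).
      { replace v with ((v - c0) + c0)%C by ring. eapply Rle_trans. apply Cmod_triangle.
        destruct Hv as [V1 V2]. pose proof (Cmod_le_Re_Im (v - c0)). lra. }
      rewrite Fv in Gv. revert Gv. apply (zeros_outside_nz g z _ _ Zg).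
      intros n Hn. apply (Hin n (Re v) Hn). eapply Rle_trans. apply re_le_Cmod. auto.
    + intros v Hv.
      (* The bound is transported from a circle around [v] on which [Cmod u >= 13 * rho]: there each
         linear factor is at least [8 * rho] in modulus, while at [c0] it is at most [6 * rho]. *)
      apply (center_Cmod_le g v (16 * rho) (17 * rho)). lra. intros; apply Cg.
      destruct (Cg v) as [b Hb]. eapply cderiv_ccont; eauto.
      intros u Hu.
      assert (U1 : 14 * rho <= Cmod (u - c0) <= 18 * rho).
      { pose proof (Cmod_triangle (u - v) (v - c0)) as T1.
        replace (u - v + (v - c0))%C with (u - c0)%C in T1 by ring.
        pose proof (Cmod_triangle_inv (u - v) (c0 - v)) as T2.
        replace (u - v - (c0 - v))%C with (u - c0)%C in T2 by ring.
        rewrite (Cmod_minus_sym c0 v) in T2. lra. }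
      assert (U2 : 13 * rho <= Cmod u <= 19 * rho).
      { pose proof (Cmod_triangle (u - c0) c0) as T1.
        replace (u - c0 + c0)%C with u in T1 by ring.
        pose proof (Cmod_triangle_inv (u - c0) (- c0)) as T2.
        replace (u - c0 - (- c0))%C with u in T2 by ring.
        rewrite Cmod_opp in T2. lra. }
      assert (Zk : forall k, (k < K)%nat -> Rabs (zeta k) <= r).
      { intros k Hk. apply (Hin _ _ (Hz k Hk)). lia. }
      assert (PP : Cmod (root_prod zeta K c0) <= Cmod (root_prod zeta K u)).
      { apply root_prod_le. intros k Hk. specialize (Zk k Hk).
        pose proof (Cmod_triangle c0 (- RtoC (zeta k))) as T1. rewrite Cmod_opp, Cmod_R in T1.
        pose proof (Cmod_triangle_inv u (RtoC (zeta k))) as T2. rewrite Cmod_R in T2.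
        unfold Cminus at 1. lra. }
      assert (Pu : 0 < Cmod (root_prod zeta K u)).
      { eapply Rlt_le_trans. 2: apply PP. apply Cmod_gt_0. intros Q. apply Nc. rewrite Eg, Q. ring. }
      apply Rmult_le_reg_l with (Cmod (root_prod zeta K u)); auto.
      rewrite <- Cmod_mult, <- Eg.
      apply Rle_trans with (Cmod (f c0) * exp A).
      * eapply Rle_trans. apply Hr0. lra.
        rewrite <- (exp_ln (Cmod (f c0))) at 1 by auto. rewrite <- exp_plus.
        apply exp_le_exp. unfold A.
        assert (- L <= ln (Cmod (f c0))).
        { pose proof (Rle_abs (- ln (Cmod (f c0)))). rewrite Rabs_Ropp in H. fold L in H. lra. }
        assert (Cmod u ^ 2 <= 400 * rho ^ 2).
        { pose proof (Cmod_ge_0 u). nra. }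
        nra.
      * rewrite Eg, Cmod_mult. pose proof (Cmod_ge_0 (g c0)). pose proof (exp_pos A).
        rewrite !Rmult_assoc. apply Rmult_le_compat_r. nra. auto.
    + fold d. lra.
  - assert (LB : L <= eta * rho ^ 2).
    { assert (L / eta <= rho) by lra.
      apply Rmult_le_compat_l with (r := eta) in H; [|lra].
      replace (eta * (L / eta)) with L in H by (field; lra). nra. }
    assert (P2 : 0 < rho ^ 2) by (apply pow_lt; lra).
    apply Rle_trans with (B * (401 * eta) * d).
    + apply Rmult_le_reg_r with (rho ^ 2); auto.
      replace (B * A * d / rho ^ 2 * rho ^ 2) with (B * d * A) by (field; lra).
      replace (B * (401 * eta) * d * rho ^ 2) with (B * d * (401 * eta * rho ^ 2)) by ring.
      apply Rmult_le_compat_l. nra. unfold A. lra.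
    + replace (B * (401 * eta) * d) with (eps * (d / (d + 1))) by (unfold eta; field; lra).
      rewrite <- (Rmult_1_r eps) at 2. apply Rmult_le_compat_l. lra.
      apply Rmult_le_reg_r with (d + 1). lra. unfold Rdiv. rewrite Rmult_assoc, Rinv_l by lra. lra.
Qed.

(** * Indices of the zeros in a disc *)

Lemma listed_zero (f : C -> C) (z : Z -> Rbar) (n : Z) (x : R) :
  zeros_outside f z (fun _ => False) -> z n = Finite x -> f (RtoC x) = RtoC 0.
Proof.
  intros H Hn. destruct (H x) as [l [_ [Hl [k [_ [_ E]]]]]].
  assert (I : In n l) by (apply Hl; auto). destruct l as [|b l]. easy.
  rewrite E. simpl. ring.
Qed.

Lemma list_Z_bound (l : list Z) : exists M, forall n, In n l -> Rabs (IZR n) <= M.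
Proof.
  induction l as [|a l [M HM]]. exists 0. easy.
  exists (Rmax (Rabs (IZR a)) M). intros n [<-|I]. apply Rmax_l.
  eapply Rle_trans. now apply HM. apply Rmax_r.
Qed.

(** Near each point the cofactor does not vanish, so all zeros nearby coincide with that point and
    carry finitely many indices. Compactness makes the bound uniform. *)
Lemma bounded_zeros_index (f : C -> C) (z : Z -> Rbar) (r : R) :
  zeros_outside f z (fun _ => False) ->
  exists M, forall n x, z n = Finite x -> Rabs x <= r -> Rabs (IZR n) <= M.
Proof.
  intros H.
  destruct (compact_bound (fun v M => forall n, z n = Finite (Re v) -> Rabs (IZR n) <= M) (RtoC 0) r) as [M HM].
  - intros v M M' L Q n Hn. eapply Rle_trans. now apply Q. auto.
  - intros t _. destruct (H (Re t)) as [l [_ [Hl [k [Ck [Nk E]]]]]].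
    destruct (list_Z_bound l) as [M HM]. destruct (Ck (RtoC (Re t))) as [b Hb].
    destruct (ccont_nz_loc _ _ (cderiv_ccont _ _ _ Hb) Nk) as [d [Hd Q]].
    exists d, M. split; auto. intros v Hv n Hn. apply HM. apply Hl. split; auto.
    rewrite Hn. f_equal. apply NNPP. intros N.
    assert (F : f (RtoC (Re v)) <> RtoC 0).
    { rewrite E. apply Cmult_neq_0. apply Cpow_nz. apply Cminus_eq_contra. now apply RtoC_neq.
      apply Q. rewrite <- RtoC_minus, Cmod_R, <- Re_minus. eapply Rle_lt_trans. apply re_le_Cmod. auto. }
    apply F. eapply listed_zero; eauto.
  - exists M. intros n x Hn Hx. apply (HM (RtoC x)).
    apply in_square_disc. replace (RtoC x - RtoC 0)%C with (RtoC x) by ring. now rewrite Cmod_R.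
    now rewrite re_RtoC.
Qed.

Lemma Z_max_exists (P : Z -> Prop) (n0 : Z) (N : nat) : P n0 ->
  (forall n, P n -> (n <= n0 + Z.of_nat N)%Z) -> exists b, P b /\ forall n, P n -> (n <= b)%Z.
Proof.
  revert n0. induction N as [|N IH]; intros n0 H0 HB.
  - exists n0. split; auto. intros n Hn. specialize (HB n Hn). lia.
  - destruct (classic (exists n1, P n1 /\ (n0 < n1)%Z)) as [[n1 [P1 L1]]|Hno].
    + apply (IH n1); auto. intros n Hn. specialize (HB n Hn). lia.
    + exists n0. split; auto. intros n Hn. apply Z.nlt_ge. intros L. apply Hno. eauto.
Qed.

Lemma zeros_interval (f : C -> C) (z : Z -> Rbar) (r x0 : R) (n0 : Z) :
  (forall n, Rbar_le (z n) (z (n + 1)%Z)) -> zeros_outside f z (fun _ => False) ->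
  z n0 = Finite x0 -> Rabs x0 <= r ->
  exists (a : Z) (K : nat), forall n,
    (exists x, z n = Finite x /\ Rabs x <= r) <-> (a <= n < a + Z.of_nat K)%Z.
Proof.
  intros Mon H Hn0 Hx0.
  set (P := fun n => exists x, z n = Finite x /\ Rabs x <= r).
  destruct (bounded_zeros_index f z r H) as [M HM].
  assert (HP : forall n, P n -> Rabs (IZR n) <= M). { intros n [x [Q1 Q2]]. eauto. }
  assert (P0 : P n0) by (exists x0; auto).
  assert (HPn : forall n, P n -> (Z.abs n < up M)%Z).
  { intros n Hn. apply lt_IZR. rewrite abs_IZR. destruct (archimed M). specialize (HP n Hn). lra. }
  pose proof (HPn _ P0) as B0.
  destruct (Z_max_exists P n0 (Z.to_nat (2 * up M)) P0) as [b [Pb Hb]].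
  { intros n Hn. specialize (HPn n Hn). lia. }
  destruct (Z_max_exists (fun n => P (- n)%Z) (- n0) (Z.to_nat (2 * up M))) as [a [Pa Ha]].
  { now rewrite Z.opp_involutive. }
  { intros n Hn. specialize (HPn _ Hn). lia. }
  assert (Mon2 : forall n k, Rbar_le (z n) (z (n + Z.of_nat k)%Z)).
  { intros n k. induction k as [|k IH]. replace (n + Z.of_nat 0)%Z with n by lia. apply Rbar_le_refl.
    eapply Rbar_le_trans. apply IH. replace (n + Z.of_nat (S k))%Z with (n + Z.of_nat k + 1)%Z by lia. apply Mon. }
  exists (- a)%Z, (Z.to_nat (b + a + 1)). intros n. fold (P n). split.
  - intros Hn. pose proof (Hb n Hn). assert (- n <= a)%Z. { apply Ha. now rewrite Z.opp_involutive. } lia.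
  - intros Hn. destruct Pa as [xa [Q1 Q2]]. destruct Pb as [xb [Q3 Q4]].
    pose proof (Mon2 (- a)%Z (Z.to_nat (n + a))) as L1. pose proof (Mon2 n (Z.to_nat (b - n))) as L2.
    replace (- a + Z.of_nat (Z.to_nat (n + a)))%Z with n in L1 by lia.
    replace (n + Z.of_nat (Z.to_nat (b - n)))%Z with b in L2 by lia.
    rewrite Q1 in L1. rewrite Q3 in L2. destruct (z n) as [x| |] eqn:Ez; simpl in L1, L2; try easy.
    exists x. split; auto. apply Rabs_le_between in Q2, Q4. apply Rabs_le_between. lra.
Qed.

(** * Comparison with the cosine *)

(** [real] sends an infinite supremum to 0, so the supremum must first be shown finite, by
    compactness. *)
Lemma Cmod_le_max_modulus (f : C -> C) (w : C) : centire f ->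
  Cmod (f w) <= max_modulus f (Cmod w).
Proof.
  intros Cf.
  destruct (compact_bound (fun v M => Cmod (f v) <= M) (RtoC 0) (Cmod w)) as [M HM].
  - intros; lra.
  - intros t _. destruct (Cf t) as [l Hl]. destruct (cderiv_ccont _ _ _ Hl 1) as [d [Hd Q]]. lra.
    exists d, (Cmod (f t) + 1). split; auto. intros v Hv. specialize (Q v Hv).
    pose proof (Cmod_triangle_inv (f v) (f t)). lra.
  - unfold max_modulus. set (E := fun m => exists w0, Cmod w0 = Cmod w /\ m = Cmod (f w0)).
    destruct (Lub_Rbar_correct E) as [H1 H2].
    assert (HE : Rbar_le (Finite (Cmod (f w))) (Lub_Rbar E)) by (apply H1; now exists w).
    assert (HB : Rbar_le (Lub_Rbar E) (Finite M)).
    { apply H2. intros m [w0 [E1 ->]]. apply HM. apply in_square_disc.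
      replace (w0 - RtoC 0)%C with w0 by ring. lra. }
    destruct (Lub_Rbar E); simpl in *; easy.
Qed.

(** The slack [1/2] gives [ln (ln M) <= 3/2 * ln r], which is at most [ln eps + 2 * ln r] as soon as
    [ln r >= - 2 * ln eps]. *)
Lemma has_order_1_small_growth (f : C -> C) : centire f -> has_order f 1 -> small_growth f.
Proof.
  intros Cf H eps He. destruct (H (mkposreal (1/2) ltac:(lra))) as [_ [r0 Hr0]]. simpl in Hr0.
  exists (Rmax (Rmax r0 2) (exp (- 2 * ln eps))). intros w Hw.
  eapply Rle_trans. now apply Cmod_le_max_modulus.
  set (r := Cmod w) in *.
  pose proof (Rmax_l (Rmax r0 2) (exp (- 2 * ln eps))). pose proof (Rmax_r (Rmax r0 2) (exp (- 2 * ln eps))).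
  pose proof (Rmax_l r0 2). pose proof (Rmax_r r0 2).
  assert (Lr : 0 < ln r). { rewrite <- ln_1. apply ln_increasing; lra. }
  assert (Lr2 : - 2 * ln eps <= ln r).
  { rewrite <- (ln_exp (- 2 * ln eps)). destruct (Rle_lt_or_eq_dec (exp (- 2 * ln eps)) r) as [Q|Q]. lra.
    left. apply ln_increasing; auto. apply exp_pos. rewrite Q. lra. }
  specialize (Hr0 r ltac:(lra)). set (M := max_modulus f r) in *.
  assert (Hp : 0 < eps * r ^ 2) by (apply Rmult_lt_0_compat; auto; apply pow_lt; lra).
  (* For [M <= 1] the iterated logarithm carries no information, but the bound is trivial. *)
  destruct (Rle_dec M 1) as [L|L].
  { eapply Rle_trans. apply L. rewrite <- exp_0. apply exp_le_exp. lra. }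
  assert (LM : 0 < ln M). { rewrite <- ln_1. apply ln_increasing; lra. }
  rewrite <- (exp_ln M) by lra. apply exp_le_exp.
  rewrite <- (exp_ln (ln M)), <- (exp_ln (eps * r ^ 2)) by auto. apply exp_le_exp.
  rewrite ln_mult, ln_pow by (try apply pow_lt; lra).
  apply Rmult_lt_compat_r with (r := ln r) in Hr0; auto.
  unfold Rdiv at 1 in Hr0. rewrite Rmult_assoc, Rinv_l in Hr0 by lra. simpl INR. lra.
Qed.

Lemma Ccos_RtoC (x : R) : Ccos (RtoC x) = RtoC (cos x).
Proof.
  unfold Ccos, Cexp. simpl. replace (0 * x - 1 * 0) with 0 by ring.
  replace (0 * 0 + 1 * x) with x by ring. rewrite Ropp_0, exp_0, cos_neg, sin_neg.
  apply injective_projections; simpl; field.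
Qed.

(** Minus the complex sine, the derivative of [Ccos]. *)
Definition mCsin (w : C) : C := (Ci * (Cexp (Ci * w) - Cexp (- (Ci * w))) / RtoC 2)%C.

Lemma mCsin_RtoC (x : R) : mCsin (RtoC x) = RtoC (- sin x).
Proof.
  unfold mCsin, Cexp. simpl. replace (0 * x - 1 * 0) with 0 by ring.
  replace (0 * 0 + 1 * x) with x by ring. rewrite Ropp_0, exp_0, cos_neg, sin_neg.
  apply injective_projections; simpl; field.
Qed.

Lemma RtoC2_nz : RtoC 2 <> RtoC 0.
Proof. apply RtoC_neq. lra. Qed.

Lemma cderiv_Cexp_scal (k w : C) : cderiv (fun v => Cexp (k * v)%C) w (k * Cexp (k * w))%C.
Proof.
  eapply cderiv_eq. apply (cderiv_comp Cexp (fun v => (k * v)%C)). apply cderiv_scal. apply cderiv_id.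
  apply cderiv_Cexp. ring.
Qed.

Lemma cderiv_Ccos (w : C) : cderiv Ccos w (mCsin w).
Proof.
  apply cderiv_ext with (fun v => ((Cexp (Ci * v) + Cexp (- Ci * v)) * / RtoC 2)%C).
  { intros v. unfold Ccos. replace (- Ci * v)%C with (- (Ci * v))%C by ring. reflexivity. }
  eapply cderiv_eq. apply cderiv_mult. apply cderiv_plus; apply cderiv_Cexp_scal. apply cderiv_const.
  unfold mCsin. replace (- Ci * w)%C with (- (Ci * w))%C by ring. cbv beta. field; apply RtoC2_nz.
Qed.

Lemma cderiv_mCsin (w : C) : exists l, cderiv mCsin w l.
Proof.
  eexists. apply cderiv_ext with (fun v => ((Ci * (Cexp (Ci * v) - Cexp (- Ci * v))) * / RtoC 2)%C).
  { intros v. unfold mCsin. replace (- Ci * v)%C with (- (Ci * v))%C by ring. reflexivity. }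
  apply cderiv_mult. apply cderiv_scal. apply cderiv_minus; apply cderiv_Cexp_scal. apply cderiv_const.
Qed.

(** At a zero [Cexp (Ci * w)] and [Cexp (- (Ci * w))] are opposite. Equality of their moduli makes
    [w] real, and their difference is twice a nonzero number, so the zero is simple. *)
Lemma Ccos_zero (w : C) : Ccos w = RtoC 0 -> Im w = 0 /\ mCsin w <> RtoC 0.
Proof.
  intros H.
  assert (E : Cexp (Ci * w) = (- Cexp (- (Ci * w)))%C).
  { replace (Cexp (Ci * w)) with (Ccos w * RtoC 2 - Cexp (- (Ci * w)))%C.
    rewrite H. ring. unfold Ccos. field; apply RtoC2_nz. }
  split.
  - assert (M : Cmod (Cexp (Ci * w)) = Cmod (Cexp (- (Ci * w)))) by (rewrite E; apply Cmod_opp).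
    rewrite !Cmod_Cexp in M. apply exp_inv in M. destruct w as [x y]. simpl in *. lra.
  - unfold mCsin. rewrite E. intros K. apply (Cexp_nz (- (Ci * w))).
    replace (Cexp (- (Ci * w))) with
      (Ci * (Ci * (- Cexp (- (Ci * w)) - Cexp (- (Ci * w))) / RtoC 2))%C. rewrite K. ring.
    replace (Ci * (Ci * (- Cexp (- (Ci * w)) - Cexp (- (Ci * w))) / RtoC 2))%C with
      (Ci * Ci * (- Cexp (- (Ci * w))))%C by (field; apply RtoC2_nz).
    replace (Ci * Ci)%C with (- (1))%C. ring.
    apply injective_projections; simpl; ring.
Qed.

Lemma Cmod_Ccos_le (w : C) : Cmod (Ccos w) <= exp (Cmod w).
Proof.
  unfold Ccos. rewrite Cmod_div by apply RtoC2_nz. rewrite Cmod_R, Rabs_pos_eq by lra.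
  pose proof (Cmod_triangle (Cexp (Ci * w)) (Cexp (- (Ci * w)))) as T. rewrite !Cmod_Cexp in T.
  assert (K : forall v, Cmod v = Cmod w -> exp (Re v) <= exp (Cmod w)).
  { intros v <-. apply exp_le_exp. eapply Rle_trans. apply Rle_abs. apply re_le_Cmod. }
  pose proof (K (Ci * w)%C ltac:(rewrite Cmod_mult, Cmod_Ci; ring)).
  pose proof (K (- (Ci * w))%C ltac:(rewrite Cmod_opp, Cmod_mult, Cmod_Ci; ring)). lra.
Qed.

(* Stands in for the removable singularity theorem at the zeros of the cosine. *)
Lemma cderiv_slope_at (f f' psi : C -> C) (w s : C) :
  (forall v, cderiv f v (f' v)) -> cderiv f' w s ->
  (forall v, v <> w -> psi v = ((f v - f w) / (v - w))%C) -> psi w = f' w ->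
  cderiv psi w (s / RtoC 2)%C.
Proof.
  intros Hf Hs Hp Hw. apply cderiv_eps. intros e He.
  destruct (proj1 (cderiv_eps _ _ _) Hs e He) as [d [Hd Q]].
  exists d. split; auto. intros v Hv.
  destruct (Ceq_dec v w) as [->|N].
  { replace (psi w - psi w - s / RtoC 2 * (w - w))%C with (RtoC 0) by (field; apply RtoC2_nz).
    rewrite Cmod_0, Cmod_minus_diag. lra. }
  assert (N' : (v - w)%C <> RtoC 0) by now apply Cminus_eq_contra.
  (* Up to a constant, [f] minus its expected quadratic Taylor polynomial. Its derivative is the
     first-order error of [f'] at [w], hence at most [e * Cmod (v - w)] on the segment. *)
  set (H := fun u => (f u - f' w * u - s / RtoC 2 * ((u - w) * (u - w)))%C).
  assert (HH : forall u, cderiv H u (f' u - f' w - s * (u - w))%C).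
  { intros u. unfold H. eapply cderiv_eq. apply cderiv_minus. apply cderiv_minus. apply Hf.
    apply cderiv_scal. apply cderiv_id. apply cderiv_scal. apply cderiv_mult; apply cderiv_minus;
    try apply cderiv_id; apply cderiv_const. cbv beta. field; apply RtoC2_nz. }
  assert (MV : Cmod (H (w + (v - w))%C - H w) <= e * Cmod (v - w) * Cmod (v - w)).
  { apply cderiv_mean_value. intros t Ht. eexists. split. apply HH.
    assert (Et : Cmod (w + RtoC t * (v - w) - w) = t * Cmod (v - w)).
    { replace (w + RtoC t * (v - w) - w)%C with (RtoC t * (v - w))%C by ring.
      rewrite Cmod_mult, Cmod_R, Rabs_pos_eq; lra. }
    pose proof (Cmod_ge_0 (v - w)).
    assert (Lt : t * Cmod (v - w) <= 1 * Cmod (v - w)) by (apply Rmult_le_compat_r; lra).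
    eapply Rle_trans. apply Q. rewrite Et. lra. rewrite Et. apply Rmult_le_compat_l; lra. }
  replace (w + (v - w))%C with v in MV by ring.
  replace (psi v - psi w - s / RtoC 2 * (v - w))%C with ((H v - H w) / (v - w))%C.
  2: { rewrite Hp, Hw by auto. unfold H. field; auto. }
  rewrite Cmod_div by auto. assert (0 < Cmod (v - w)) by now apply Cmod_gt_0.
  apply Rmult_le_reg_r with (Cmod (v - w)); auto. unfold Rdiv. rewrite Rmult_assoc, Rinv_l by lra. lra.
Qed.

Section Cosine.
Variables (c d : R).
Hypothesis Hc : 0 < c.
Let g := fun w => Ccos (RtoC c * w + RtoC d)%C.
Let g' := fun w => (RtoC c * mCsin (RtoC c * w + RtoC d))%C.

Lemma cderiv_affine_Ccos w : cderiv g w (g' w).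
Proof.
  unfold g, g'. eapply cderiv_eq. apply (cderiv_comp Ccos (fun w => (RtoC c * w + RtoC d)%C)).
  apply cderiv_plus. apply cderiv_scal. apply cderiv_id. apply cderiv_const. apply cderiv_Ccos. ring.
Qed.

Lemma affine_Ccos_zero w : g w = RtoC 0 -> Im w = 0 /\ g' w <> RtoC 0.
Proof.
  intros H. destruct (Ccos_zero _ H) as [H1 H2]. split.
  - destruct w as [x y]. simpl in *. nra.
  - unfold g'. apply Cmult_neq_0; auto. apply RtoC_neq. lra.
Qed.

Lemma affine_Ccos_small_growth : small_growth g.
Proof.
  intros e He. exists ((c + Rabs d) / e + 1). intros w Hw.
  eapply Rle_trans. apply Cmod_Ccos_le. apply exp_le_exp.
  eapply Rle_trans. apply Cmod_triangle. rewrite Cmod_mult, !Cmod_R, (Rabs_pos_eq c) by lra.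
  pose proof (Rabs_pos d).
  assert (0 <= (c + Rabs d) / e) by (apply Rdiv_le_0_compat; lra).
  assert ((c + Rabs d) <= e * Cmod w).
  { apply Rle_trans with (e * ((c + Rabs d) / e)). right; field; lra.
    apply Rmult_le_compat_l; lra. }
  nra.
Qed.

(** Each zero is simple and, [u] being injective, has a single index. The cofactor is the slope at
    the zero, whose differentiability there is [cderiv_slope_at]. *)
Lemma affine_Ccos_zeros_outside (z : Z -> Rbar) (u : Z -> R) :
  (forall n, z n = Finite (u n)) -> (forall n m, u n = u m -> n = m) ->
  (forall x, cos (c * x + d) = 0 <-> exists n, x = u n) ->
  zeros_outside g z (fun _ => False).
Proof.
  intros Hz Inj Hu x.
  assert (Gx : g (RtoC x) = RtoC (cos (c * x + d))).
  { unfold g. rewrite <- RtoC_mult, <- RtoC_plus. apply Ccos_RtoC. }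
  destruct (classic (exists n, x = u n)) as [[n En]|No].
  - assert (G0 : g (RtoC x) = RtoC 0). { rewrite Gx. f_equal. apply Hu. now exists n. }
    exists (n :: nil). split; [|split].
    + constructor. easy. constructor.
    + intros m. rewrite Hz. simpl. split.
      * intros [<-|[]]. split; auto. now rewrite En.
      * intros [E _]. left. apply Inj. injection E. congruence.
    + destruct (cderiv_slope g (RtoC x) _ (cderiv_affine_Ccos _)) as [psi [E [Ex [_ Dp]]]].
      exists psi. split; [|split].
      * intros w. destruct (Ceq_dec w (RtoC x)) as [->|N].
        -- destruct (cderiv_mCsin (RtoC c * RtoC x + RtoC d)%C) as [s Hs].
           eexists. apply (cderiv_slope_at g g' psi (RtoC x)); auto. apply cderiv_affine_Ccos.
           unfold g'. apply cderiv_scal.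
           apply (cderiv_comp mCsin (fun w => (RtoC c * w + RtoC d)%C)).
           apply cderiv_plus. apply cderiv_scal. apply cderiv_id. apply cderiv_const. apply Hs.
        -- eapply Dp; auto. apply cderiv_affine_Ccos.
      * rewrite Ex. now apply affine_Ccos_zero.
      * intros w. simpl. destruct (Ceq_dec w (RtoC x)) as [->|N].
        -- rewrite G0. ring.
        -- rewrite E by auto. rewrite G0. field. now apply Cminus_eq_contra.
  - exists nil. split; [|split].
    + constructor.
    + intros m. simpl. split; [easy|]. rewrite Hz. intros [E _]. apply No. exists m. injection E. auto.
    + exists g. split; [|split].
      * intros w. eexists. apply cderiv_affine_Ccos.
      * rewrite Gx. apply RtoC_neq. intros K. apply No. now apply Hu.
      * intros w. simpl. ring.
Qed.
End Cosine.

Lemma Cmod_all_le_eq (x y : C) : (forall e, 0 < e -> Cmod (x - y) <= e) -> x = y.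
Proof.
  intros H. apply NNPP. intros N. apply Cminus_eq_contra in N. apply Cmod_gt_0 in N.
  specialize (H (Cmod (x - y) / 2) ltac:(lra)). lra.
Qed.

(** The sums in [log_derivative_limit] depend on [z] alone, so they cancel between [f] and [g]. *)
Lemma same_zeros_log_derivative (f g : C -> C) (z : Z -> Rbar) (n0 : Z) (x0 : R) (c0 p a0 a b0 b : C) :
  centire f -> small_growth f -> (forall w, f w = RtoC 0 -> Im w = 0) ->
  centire g -> small_growth g -> (forall w, g w = RtoC 0 -> Im w = 0) ->
  (forall n, Rbar_le (z n) (z (n + 1)%Z)) -> z n0 = Finite x0 ->
  zeros_outside f z (fun _ => False) -> zeros_outside g z (fun _ => False) ->
  f c0 <> RtoC 0 -> f p <> RtoC 0 -> g c0 <> RtoC 0 -> g p <> RtoC 0 ->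
  cderiv f c0 a0 -> cderiv f p a -> cderiv g c0 b0 -> cderiv g p b ->
  (a / f p - a0 / f c0)%C = (b / g p - b0 / g c0)%C.
Proof.
  intros F1 F2 F3 G1 G2 G3 Mon Hn0 Zf Zg N1 N2 N3 N4 D1 D2 D3 D4.
  apply Cmod_all_le_eq. intros e He.
  destruct (log_derivative_limit f z c0 p a0 a (e / 2)) as [R1 H1]; auto. lra.
  destruct (log_derivative_limit g z c0 p b0 b (e / 2)) as [R2 H2]; auto. lra.
  set (r := Rmax (Rabs x0) (Rmax R1 R2)).
  destruct (zeros_interval f z r x0 n0 Mon Zf Hn0) as [i [K HK]]. apply Rmax_l.
  set (zeta := fun k => real (z (i + Z.of_nat k)%Z)).
  assert (Hz : forall k, (k < K)%nat -> z (i + Z.of_nat k)%Z = Finite (zeta k)).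
  { intros k Hk. destruct (proj2 (HK (i + Z.of_nat k)%Z) ltac:(lia)) as [x [E _]].
    unfold zeta. rewrite E. reflexivity. }
  assert (Hin : forall n x, z n = Finite x -> (Rabs x <= r <-> (i <= n < i + Z.of_nat K)%Z)).
  { intros n x E. rewrite <- HK. split. intros L. exists x. auto.
    intros [y [Ey Ly]]. rewrite E in Ey. injection Ey as <-. auto. }
  pose proof (Rmax_r (Rabs x0) (Rmax R1 R2)). pose proof (Rmax_l R1 R2). pose proof (Rmax_r R1 R2).
  specialize (H1 r i zeta K ltac:(unfold r; lra) Hz Hin).
  specialize (H2 r i zeta K ltac:(unfold r; lra) Hz Hin).
  set (S := csum _ K) in *.
  replace (a / f p - a0 / f c0 - (b / g p - b0 / g c0))%C with
    ((a / f p - a0 / f c0 - S) + - (b / g p - b0 / g c0 - S))%C by (unfold Cdiv; ring).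
  eapply Rle_trans. apply Cmod_triangle. rewrite Cmod_opp. lra.
Qed.

(** The quotient [F] of [f] by [g * exp (B w)] has derivative 0 off the zeros. At the zeros both
    sides of the identity vanish. *)
Lemma quotient_constant (f g : C -> C) (q : R) (B : C) :
  centire f -> centire g ->
  (forall w, f w = RtoC 0 <-> g w = RtoC 0) -> (forall w, g w = RtoC 0 -> Im w = 0) ->
  f (RtoC q) <> RtoC 0 ->
  (forall w a b, f w <> RtoC 0 -> cderiv f w a -> cderiv g w b -> (a / f w - b / g w)%C = B) ->
  forall w, f w = (f (RtoC q) / (g (RtoC q) * Cexp (B * RtoC q)) * Cexp (B * w) * g w)%C.
Proof.
  intros Cf Cg Hz Hr Nq HB.
  assert (Ng : forall w, f w <> RtoC 0 -> g w <> RtoC 0) by (intros w N K; apply N; now apply Hz).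
  set (F := fun w => (f w / (g w * Cexp (B * w)))%C).
  assert (DF : forall w, f w <> RtoC 0 -> cderiv F w (RtoC 0)).
  { intros w N. destruct (Cf w) as [a Ha]. destruct (Cg w) as [b Hb].
    pose proof (HB w a b N Ha Hb) as E. pose proof (Cexp_nz (B * w)) as NE. pose proof (Ng w N) as N2.
    eapply cderiv_eq. apply cderiv_div. apply Ha. apply cderiv_mult. apply Hb. apply cderiv_Cexp_scal.
    now apply Cmult_neq_0. rewrite <- E. field. rewrite E. auto. }
  (* The zeros are real, so a segment leaving the real axis at a point where [f] does not vanish
     avoids them. Hence nonreal points connect to [q], and a real point connects to [q] through its
     translate by [Ci]. *)
  assert (Seg : forall c d, Im c = 0 -> Im d <> 0 -> f c <> RtoC 0 -> F (c + d)%C = F c).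
  { intros c d Hc Hd N. apply Cmod_all_le_eq. intros e He.
    apply Rle_trans with (0 * Cmod d); [|lra]. apply cderiv_mean_value. intros t Ht.
    exists (RtoC 0). rewrite Cmod_0. split; [|lra]. apply DF.
    destruct (Req_dec t 0) as [->|Nt]. now replace (c + RtoC 0 * d)%C with c by ring.
    intros K. apply Hz, Hr in K. destruct c as [c1 c2], d as [d1 d2]. simpl in *.
    assert (t * d2 = 0) by lra. apply Rmult_integral in H. tauto. }
  assert (Const : forall w, f w <> RtoC 0 -> F w = F (RtoC q)).
  { assert (NR : forall w, Im w <> 0 -> F w = F (RtoC q)).
    { intros w N. replace w with (RtoC q + (w - RtoC q))%C at 1 by ring. apply Seg; auto.
      rewrite Im_minus, im_RtoC. lra. }
    intros w N. destruct (Req_dec (Im w) 0) as [E|E]; auto.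
    rewrite <- (Seg w Ci E); auto. apply NR.
    destruct w as [x y]; simpl in *; lra. simpl. lra. }
  intros w. destruct (classic (f w = RtoC 0)) as [E|N].
  - rewrite E. apply Hz in E. rewrite E. ring.
  - specialize (Const w N). unfold F in Const. rewrite <- Const. field. split. apply Cexp_nz. auto.
Qed.

Lemma arithmetic_zeros_cosine (f : C -> C) (z : Z -> Rbar) (x0 d q a : R) :
  centire f -> small_growth f -> (forall x : R, Im (f (RtoC x)) = 0) ->
  (forall w, f w = RtoC 0 -> Im w = 0) ->
  (forall n, Rbar_le (z n) (z (n + 1)%Z)) -> zeros_outside f z (fun _ => False) ->
  0 < d -> (forall n, z n = Finite (x0 + IZR n * d)) ->
  f (RtoC q) <> RtoC 0 -> cderiv f (RtoC q) (RtoC a * f (RtoC q))%C ->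
  exists A B C0 D : R, forall w,
    f w = (RtoC A * Cexp (RtoC B * w) * Ccos (RtoC C0 * w + RtoC D))%C.
Proof.
  intros Cf Gf Rf If Mon Zf Hd Hz Nq Dq.
  set (c := PI / d). assert (Hc : 0 < c) by (apply Rdiv_lt_0_compat; auto; apply PI_RGT_0).
  (* The affine map [c * x + e] sends [x0] to [PI / 2] and a step [d] to a step [PI], so it carries
     the given zeros to those of the cosine. *)
  set (e := PI / 2 - c * x0).
  set (g := fun w => Ccos (RtoC c * w + RtoC e)%C).
  assert (Hcd : c * d = PI) by (unfold c; field; lra).
  assert (Zg : zeros_outside g z (fun _ => False)).
  { apply (affine_Ccos_zeros_outside c e Hc z (fun n => x0 + IZR n * d)); auto.
    - intros n m E. apply eq_IZR. apply Rmult_eq_reg_r with d; lra.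
    - intros x. split.
      + intros H. apply cos_eq_0_0 in H. destruct H as [k Hk]. exists k.
        apply Rmult_eq_reg_l with c; [|lra].
        replace (c * (x0 + IZR k * d)) with (c * x0 + IZR k * (c * d)) by ring. rewrite Hcd.
        unfold e in Hk. lra.
      + intros [k ->]. apply cos_eq_0_1. exists k.
        replace (c * (x0 + IZR k * d)) with (c * x0 + IZR k * (c * d)) by ring. rewrite Hcd. unfold e. ring. }
  assert (Cg : centire g) by (intros w; eexists; apply cderiv_affine_Ccos).
  assert (Ig : forall w, g w = RtoC 0 -> Im w = 0) by (intros w H; now apply (affine_Ccos_zero c e Hc)).
  assert (Gg : small_growth g) by now apply affine_Ccos_small_growth.
  assert (Char : forall u, zeros_outside u z (fun _ => False) -> (forall w, u w = RtoC 0 -> Im w = 0) ->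
     forall w, u w = RtoC 0 <-> exists n, w = RtoC (x0 + IZR n * d)).
  { intros u Zu Iu w. split.
    - intros H. pose proof (real_of_Im w (Iu w H)) as E. apply NNPP. intros N.
      rewrite E in H. revert H. apply (zeros_outside_nz u z _ _ Zu). intros n Hn. apply N. exists n.
      rewrite Hz in Hn. injection Hn as ->. auto.
    - intros [n ->]. apply (listed_zero u z n); auto. }
  assert (Same : forall w, f w = RtoC 0 <-> g w = RtoC 0).
  { intros w. rewrite (Char f Zf If), (Char g Zg Ig). tauto. }
  assert (Ng : g (RtoC q) <> RtoC 0) by (rewrite <- Same; auto).
  assert (Gq : g (RtoC q) = RtoC (cos (c * q + e))).
  { unfold g. rewrite <- RtoC_mult, <- RtoC_plus. apply Ccos_RtoC. }
  assert (Hcos : cos (c * q + e) <> 0). { intros K. apply Ng. now rewrite Gq, K. }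
  (* The constant difference of the two logarithmic derivatives, evaluated at [q], where that of [f]
     is [a]. It is therefore real. *)
  set (B := a - c * - sin (c * q + e) / cos (c * q + e)).
  assert (Log : forall w m k, f w <> RtoC 0 -> cderiv f w m -> cderiv g w k -> (m / f w - k / g w)%C = RtoC B).
  { intros w m k N Hm Hk.
    assert (Nw : g w <> RtoC 0) by (rewrite <- Same; auto).
    pose proof (cderiv_affine_Ccos c e (RtoC q)) as Dg.
    pose proof (same_zeros_log_derivative f g z 0%Z _ (RtoC q) w _ m _ k Cf Gf If Cg Gg Ig Mon (Hz 0%Z)
      Zf Zg Nq N Ng Nw Dq Hm Dg Hk) as E.
    rewrite Gq in E. rewrite <- RtoC_mult, <- RtoC_plus, mCsin_RtoC in E.
    assert (EB : RtoC B = (RtoC a * f (RtoC q) / f (RtoC q) - RtoC c * RtoC (- sin (c * q + e)) / RtoC (cos (c * q + e)))%C).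
    { unfold B. rewrite RtoC_minus, RtoC_div, RtoC_mult by auto. field. split; auto.
      now apply RtoC_neq. }
    rewrite EB.
    replace (m / f w)%C with (RtoC a * f (RtoC q) / f (RtoC q) + (m / f w - RtoC a * f (RtoC q) / f (RtoC q)))%C by (unfold Cdiv; ring).
    rewrite E. unfold Cdiv. ring. }
  exists (Re (f (RtoC q)) / (cos (c * q + e) * exp (B * q))), B, c, e.
  intros w. rewrite (quotient_constant f g q (RtoC B) Cf Cg Same Ig Nq Log w).
  fold (g w). do 2 f_equal.
  assert (Ex : Cexp (RtoC B * RtoC q) = RtoC (exp (B * q))).
  { rewrite <- RtoC_mult. unfold Cexp. rewrite re_RtoC, im_RtoC, cos_0, sin_0.
    apply injective_projections; simpl; ring. }
  rewrite Gq, Ex. pose proof (exp_pos (B * q)).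
  rewrite RtoC_div, RtoC_mult by (apply Rmult_integral_contrapositive; split; lra).
  now rewrite <- (real_of_Im (f (RtoC q)) (Rf q)).
Qed.

(** * Gaps between zeros *)

Fixpoint rsum (u : nat -> R) (K : nat) : R :=
  match K with
  | O => 0
  | S k => rsum u k + u k
  end.

Lemma csum_RtoC (u : nat -> C) (v : nat -> R) (K : nat) :
  (forall k, (k < K)%nat -> u k = RtoC (v k)) -> csum u K = RtoC (rsum v K).
Proof.
  induction K as [|K IH]; intros H; simpl. reflexivity.
  rewrite IH, H, RtoC_plus; auto.
Qed.

Lemma rsum_nonneg (u : nat -> R) (K : nat) :
  (forall k, (k < K)%nat -> 0 <= u k) -> 0 <= rsum u K.
Proof.
  induction K as [|K IH]; intros H; simpl. lra.
  pose proof (IH (fun k Hk => H k (Nat.lt_lt_succ_r _ _ Hk))). specialize (H K (Nat.lt_succ_diag_r K)). lra.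
Qed.

Lemma rsum_ge_term (u : nat -> R) (K k : nat) :
  (forall k, (k < K)%nat -> 0 <= u k) -> (k < K)%nat -> u k <= rsum u K.
Proof.
  induction K as [|K IH]; intros H Hk. lia. simpl.
  destruct (Nat.eq_dec k K) as [->|N].
  - assert (0 <= rsum u K) by (apply rsum_nonneg; intros; apply H; lia). lra.
  - assert (u k <= rsum u K) by (apply IH; [intros; apply H|]; lia).
    specialize (H K ltac:(lia)). lra.
Qed.

Lemma rsum_opp (u : nat -> R) (K : nat) : rsum (fun k => - u k) K = - rsum u K.
Proof. induction K as [|K IH]; simpl. ring. rewrite IH. ring. Qed.

Lemma rsum_shift (u v : nat -> R) (K : nat) :
  rsum (fun k => u k - v k) (S K) = u O - v K + rsum (fun k => u (S k) - v k) K.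
Proof.
  induction K as [|K IH]. simpl. ring.
  change (rsum (fun k => u k - v k) (S (S K))) with
    (rsum (fun k => u k - v k) (S K) + (u (S K) - v (S K))).
  rewrite IH. simpl. ring.
Qed.

Lemma Rinv_le_of_ge_sign (x y : R) : y <= x -> 0 < x * y -> / x <= / y.
Proof.
  intros H P. assert (x <> 0 /\ y <> 0) by (split; intros ->; lra).
  apply Rmult_le_reg_l with (x * y); auto.
  replace (x * y * / x) with y by (field; tauto). replace (x * y * / y) with x by (field; tauto). auto.
Qed.

Section Main.
Variables (f : C -> C) (z : Z -> Rbar) (a q p : R).
Let D := C_derive f.
Let h := fun w => (D w + RtoC a * f w)%C.
Hypothesis Ef : entire f.
Hypothesis Gf : small_growth f.
Hypothesis Rf : forall x : R, Im (f (RtoC x)) = 0.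
Hypothesis If : forall w : C, f w = RtoC 0 -> Im w = 0.
Hypothesis Mon : forall n, Rbar_le (z n) (z (n + 1)%Z).
Hypothesis Zf : zeros_outside f z (fun _ => False).
Hypothesis Hqp : q < p.
Hypothesis Hq : h (RtoC q) = RtoC 0.
Hypothesis Hp : h (RtoC p) = RtoC 0.
Hypothesis Hno : forall x : R, q < x < p -> h (RtoC x) <> RtoC 0.

Lemma Df w : cderiv f w (D w).
Proof. now apply entire_cderiv. Qed.

Lemma Cf : centire f.
Proof. now apply entire_centire. Qed.

Lemma mon_le n m : (n <= m)%Z -> Rbar_le (z n) (z m).
Proof.
  intros H. replace m with (n + Z.of_nat (Z.to_nat (m - n)))%Z by lia.
  induction (Z.to_nat (m - n)) as [|k IH].
  - replace (n + Z.of_nat 0)%Z with n by lia. apply Rbar_le_refl.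
  - eapply Rbar_le_trans. apply IH.
    replace (n + Z.of_nat (S k))%Z with (n + Z.of_nat k + 1)%Z by lia. apply Mon.
Qed.

Lemma mon_le_R n m x y : (n <= m)%Z -> z n = Finite x -> z m = Finite y -> x <= y.
Proof. intros H E1 E2. pose proof (mon_le n m H) as L. now rewrite E1, E2 in L. Qed.

(** [Re (- Ci * f)] is [Im f], which vanishes identically on the real axis, and so does its
    derivative. *)
Lemma real_derivative_real (x : R) : Im (D (RtoC x)) = 0.
Proof.
  assert (H : is_derive (fun s => Re (- Ci * f (RtoC 0 + RtoC s * RtoC 1))%C) x (Re (- Ci * D (RtoC x) * RtoC 1)%C)).
  { apply (cderiv_line (fun v => (- Ci * f v)%C)). apply cderiv_scal.
    replace (RtoC 0 + RtoC x * RtoC 1)%C with (RtoC x) by ring. apply Df. }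
  apply is_derive_ext with (g := fun _ => 0) in H.
  - pose proof (is_derive_unique _ _ _ H) as E. rewrite Derive_const in E.
    destruct (D (RtoC x)) as [d1 d2]. simpl in *. lra.
  - intros t. replace (RtoC 0 + RtoC t * RtoC 1)%C with (RtoC t) by ring.
    specialize (Rf t). destruct (f (RtoC t)) as [f1 f2]. simpl in *. rewrite Rf. ring.
Qed.

(* Rolle's theorem for [exp (a x) f x]. *)
Lemma zero_between (x y : R) : x < y -> f (RtoC x) = RtoC 0 -> f (RtoC y) = RtoC 0 ->
  exists c, x < c < y /\ h (RtoC c) = RtoC 0.
Proof.
  intros Hxy Hx Hy.
  destruct (MVT_cor2 (fun t => exp (a * t) * Re (f (RtoC t)))
    (fun t => exp (a * t) * Re (h (RtoC t))) x y Hxy) as [c [E Hc]].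
  - intros c _. apply is_derive_Reals.
    replace (exp (a * c) * Re (h (RtoC c))) with
      (a * exp (a * c) * Re (f (RtoC c)) + exp (a * c) * Re (D (RtoC c))).
    2: { unfold h. destruct (D (RtoC c)), (f (RtoC c)). simpl. ring. }
    apply (is_derive_mult (fun t => exp (a * t)) (fun t => Re (f (RtoC t)))).
    + auto_derive; auto. ring.
    + apply is_derive_ext with (fun s => Re (f (RtoC 0 + RtoC s * RtoC 1)%C)).
      intros t. do 2 f_equal. ring.
      replace (D (RtoC c)) with (D (RtoC c) * RtoC 1)%C by ring. apply cderiv_line.
      replace (RtoC 0 + RtoC c * RtoC 1)%C with (RtoC c) by ring. apply Df.
    + intros; apply Rmult_comm.
  - exists c. split; auto. rewrite Hx, Hy, re_RtoC in E.
    assert (E2 : Re (h (RtoC c)) = 0).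
    { pose proof (exp_pos (a * c)). apply Rmult_eq_reg_l with (exp (a * c) * (y - x)).
      lra. apply Rgt_not_eq. apply Rmult_lt_0_compat; lra. }
    apply injective_projections; [exact E2|].
    unfold h. pose proof (real_derivative_real c) as E3. specialize (Rf c).
    destruct (D (RtoC c)), (f (RtoC c)). simpl in *. rewrite E3, Rf. ring.
Qed.

Lemma double_zero (i j : Z) (x : R) : i <> j -> z i = Finite x -> z j = Finite x -> h (RtoC x) = RtoC 0.
Proof.
  intros N Hi Hj. destruct (Zf x) as [l [ND [Hl [k [Ck [Nk E]]]]]].
  assert (I : In i l) by (apply Hl; auto). assert (J : In j l) by (apply Hl; auto).
  destruct l as [|n1 [|n2 l]]; [easy| simpl in I, J; lia |]. simpl in E.
  destruct (Ck (RtoC x)) as [b Hb]. destruct (cderiv_pow (RtoC x) (RtoC x) (length l)) as [b' Hb'].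
  assert (D0 : cderiv f (RtoC x) (RtoC 0)).
  { apply cderiv_ext with (fun w => ((w - RtoC x) * ((w - RtoC x) * (Cpow (w - RtoC x) (length l) * k w)))%C).
    intros v. rewrite E. ring.
    eapply cderiv_eq.
    apply cderiv_mult. apply cderiv_minus. apply cderiv_id. apply cderiv_const.
    apply cderiv_mult. apply cderiv_minus. apply cderiv_id. apply cderiv_const.
    apply cderiv_mult. apply Hb'. apply Hb. cbv beta. ring. }
  unfold h. rewrite (cderiv_unique _ _ _ _ (Df (RtoC x)) D0), E. ring.
Qed.

(** A common zero of [f] and [f' + a f] is a zero of [f'], hence a multiple zero of [f] with two
    indices. Monotonicity makes two adjacent terms equal. *)
Lemma double_zero_gap (x : R) : f (RtoC x) = RtoC 0 -> h (RtoC x) = RtoC 0 -> zero_gap z (Finite 0).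
Proof.
  intros F H. destruct (Zf x) as [l [ND [Hl [k [Ck [Nk E]]]]]].
  assert (Dx : D (RtoC x) = RtoC 0).
  { replace (D (RtoC x)) with (h (RtoC x) - RtoC a * f (RtoC x))%C by (unfold h; ring). rewrite H, F. ring. }
  assert (Adj : forall i j, (i < j)%Z -> z i = Finite x -> z j = Finite x -> zero_gap z (Finite 0)).
  { intros i j L Hi Hj. pose proof (mon_le i (i + 1) ltac:(lia)) as L1. pose proof (mon_le (i + 1) j ltac:(lia)) as L2.
    rewrite Hi in L1. rewrite Hj in L2. exists i. rewrite Hi. split. left. reflexivity.
    destruct (z (i + 1)%Z) as [y| |]; simpl in *; try easy. unfold Rbar_minus; simpl. f_equal. lra. }
  destruct l as [|n1 [|n2 l]].
  - exfalso. apply Nk. rewrite E in F. simpl in F. rewrite <- F. ring.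
  - exfalso. apply Nk. destruct (Ck (RtoC x)) as [b Hb].
    rewrite <- Dx. apply (cderiv_unique f (RtoC x)). 2: apply Df.
    apply cderiv_ext with (fun w => ((w - RtoC x) * k w)%C). intros v. rewrite E. simpl. ring.
    eapply cderiv_eq. apply cderiv_mult. apply cderiv_minus. apply cderiv_id. apply cderiv_const. apply Hb.
    cbv beta. ring.
  - destruct (proj1 (Hl n1) (or_introl eq_refl)) as [H1 _].
    destruct (proj1 (Hl n2) (or_intror (or_introl eq_refl))) as [H2 _].
    assert (n1 <> n2). { intros ->. apply NoDup_cons_iff in ND. apply ND. now left. }
    destruct (Z.lt_total n1 n2) as [L|[L|L]]; [eauto|easy|eauto].
Qed.

Lemma listed_nodes_bounded (x : R) : exists N : nat, forall n, z n = Finite x -> (Z.abs n <= Z.of_nat N)%Z.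
Proof.
  destruct (Zf x) as [l [_ [Hl _]]]. destruct (list_Z_bound l) as [M HM].
  exists (Z.to_nat (up M)). intros n Hn. assert (I : In n l) by (apply Hl; auto).
  specialize (HM n I). destruct (archimed M). assert (IZR (Z.abs n) < IZR (up M)) by (rewrite abs_IZR; lra).
  apply lt_IZR in H1. lia.
Qed.

Lemma zero_listed (x : R) : f (RtoC x) = RtoC 0 -> exists n, z n = Finite x.
Proof.
  intros F. apply NNPP. intros N. apply (zeros_outside_nz f z _ x Zf) in F; auto.
  intros n Hn. apply N. eauto.
Qed.

(** After the last index of [q] comes a larger zero [y], or [p_infty]. By Rolle's theorem [f' + a f]
    vanishes between [q] and [y], so [y] cannot precede [p]. *)
Lemma gap_at_multiple_left : f (RtoC q) = RtoC 0 -> exists d, zero_gap z d /\ Rbar_le (Finite (p - q)) d.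
Proof.
  intros F. destruct (zero_listed q F) as [n0 Hn0]. destruct (listed_nodes_bounded q) as [N HN].
  destruct (Z_max_exists (fun n => z n = Finite q) n0 (N + N) Hn0) as [b [Hb Mb]].
  { intros n Hn. pose proof (HN n Hn). pose proof (HN n0 Hn0). lia. }
  exists (Rbar_minus (z (b + 1)%Z) (z b)). split. { exists b. split; auto. left. now rewrite Hb. }
  pose proof (Mon b) as L. rewrite Hb in *.
  destruct (z (b + 1)%Z) as [y| |] eqn:Ey; simpl in L; try easy; unfold Rbar_minus; simpl; auto.
  assert (y <> q). { intros ->. specialize (Mb _ Ey). lia. }
  destruct (Rle_dec p y) as [L2|L2]. lra. exfalso.
  destruct (zero_between q y) as [c [Hc Hc2]]; auto. lra. eapply listed_zero; eauto.
  apply (Hno c); auto. lra.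
Qed.

Lemma gap_at_multiple_right : f (RtoC p) = RtoC 0 -> exists d, zero_gap z d /\ Rbar_le (Finite (p - q)) d.
Proof.
  intros F. destruct (zero_listed p F) as [n0 Hn0]. destruct (listed_nodes_bounded p) as [N HN].
  destruct (Z_max_exists (fun n => z (- n)%Z = Finite p) (- n0) (N + N)) as [b [Hb Mb]].
  { now rewrite Z.opp_involutive. }
  { intros n Hn. pose proof (HN _ Hn). pose proof (HN n0 Hn0). lia. }
  set (m := (- b - 1)%Z). assert (Em : (m + 1 = - b)%Z) by (unfold m; lia).
  exists (Rbar_minus (z (m + 1)%Z) (z m)). split. { exists m. split; auto. right. now rewrite Em, Hb. }
  pose proof (Mon m) as L. rewrite Em, Hb in *.
  destruct (z m) as [y| |] eqn:Ey; simpl in L; try easy; unfold Rbar_minus; simpl; auto.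
  assert (y <> p). { intros ->. assert (- m <= b)%Z. apply Mb. now rewrite Z.opp_involutive. lia. }
  destruct (Rle_dec y q) as [L2|L2]. lra. exfalso.
  destruct (zero_between y p) as [c [Hc Hc2]]; auto. lra. eapply listed_zero; eauto.
  apply (Hno c); auto. lra.
Qed.

(** * The case where neither [q] nor [p] is a zero of [f] *)

Section NonZero.
Hypothesis Nq : f (RtoC q) <> RtoC 0.
Hypothesis Np : f (RtoC p) <> RtoC 0.

Lemma log_derivative_at (x : R) : h (RtoC x) = RtoC 0 -> f (RtoC x) <> RtoC 0 ->
  (D (RtoC x) / f (RtoC x))%C = RtoC (- a).
Proof.
  intros H N. replace (D (RtoC x)) with (h (RtoC x) - RtoC a * f (RtoC x))%C by (unfold h; ring).
  rewrite H, RtoC_opp. field. auto.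
Qed.

Lemma zeros_ne (n : Z) (x : R) : z n = Finite x -> x <> q /\ x <> p.
Proof. intros H. split; intros ->; [apply Nq | apply Np]; eapply listed_zero; eauto. Qed.

(** The logarithmic derivative of [f] is [- a] at both [q] and [p], so the limit in
    [log_derivative_limit] is 0. *)
Lemma partial_sum_small (eps : R) : 0 < eps ->
  exists R0, forall (r : R) (i : Z) (zeta : nat -> R) (K : nat), R0 <= r ->
    (forall k, (k < K)%nat -> z (i + Z.of_nat k)%Z = Finite (zeta k)) ->
    (forall n x, z n = Finite x -> (Rabs x <= r <-> (i <= n < i + Z.of_nat K)%Z)) ->
    Rabs (rsum (fun k => / (p - zeta k) - / (q - zeta k)) K) <= eps.
Proof.
  intros He.
  destruct (log_derivative_limit f z (RtoC q) (RtoC p) _ _ eps Cf Gf If Zf Nq Np (Df _) (Df _) He) as [R0 HR].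
  exists R0. intros r i zeta K Hr Hz Hin. specialize (HR r i zeta K Hr Hz Hin).
  rewrite !log_derivative_at in HR by auto.
  rewrite (csum_RtoC _ (fun k => / (p - zeta k) - / (q - zeta k))) in HR.
  - set (s := rsum _ K) in *.
    replace (RtoC (- a) - RtoC (- a) - RtoC s)%C with (- RtoC s)%C in HR by ring.
    now rewrite Cmod_opp, Cmod_R in HR.
  - intros k Hk. destruct (zeros_ne _ _ (Hz k Hk)) as [N1 N2].
    rewrite <- !RtoC_minus, <- !RtoC_inv, <- RtoC_minus by lra. reflexivity.
Qed.

Lemma interval_data (n0 : Z) (x0 r : R) : z n0 = Finite x0 -> Rabs x0 <= r ->
  exists (i : Z) (zeta : nat -> R) (K : nat),
    (forall k, (k < S K)%nat -> z (i + Z.of_nat k)%Z = Finite (zeta k)) /\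
    (forall n x, z n = Finite x -> (Rabs x <= r <-> (i <= n < i + Z.of_nat (S K))%Z)).
Proof.
  intros H0 Hr. destruct (zeros_interval f z r x0 n0 Mon Zf H0 Hr) as [i [K HK]].
  assert (B0 : (i <= n0 < i + Z.of_nat K)%Z) by (apply HK; eauto).
  destruct K as [|K]. lia.
  exists i, (fun k => real (z (i + Z.of_nat k)%Z)), K. split.
  - intros k Hk. destruct (proj2 (HK (i + Z.of_nat k)%Z) ltac:(lia)) as [x [E _]].
    now rewrite E.
  - intros n x E. rewrite <- HK. split. intros L. exists x. auto.
    intros [y [Ey Ly]]. rewrite E in Ey. injection Ey as <-. auto.
Qed.

(** If every zero is outside [(q, p)], each term [/ (p - x) - / (q - x)] is negative, and a single
    term keeps the partial sums away from 0. If there are no zeros at all, [f' / f] is constant, and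
    [f' + a f] vanishes between [q] and [p] too. *)
Lemma zero_in_between : exists n0 x0, z n0 = Finite x0 /\ q < x0 < p.
Proof.
  apply NNPP. intros No.
  assert (Out : forall n x, z n = Finite x -> 0 < (p - x) * (q - x)).
  { intros n x E. destruct (zeros_ne n x E). destruct (Rle_dec x q) as [L|L]. nra.
    destruct (Rle_dec p x) as [L'|L']. nra. exfalso. apply No. exists n, x. split; auto. lra. }
  destruct (classic (exists n1 x1, z n1 = Finite x1)) as [[n1 [x1 E1]]|None].
  - pose proof (Out n1 x1 E1) as P1.
    assert (T : forall x, 0 < (p - x) * (q - x) -> 0 < - (/ (p - x) - / (q - x))).
    { intros x P. assert (p - x <> 0 /\ q - x <> 0) by (split; intros K; rewrite K in P; lra).
      replace (- (/ (p - x) - / (q - x))) with ((p - q) * / ((p - x) * (q - x))) by (field; tauto).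
      apply Rmult_lt_0_compat. lra. now apply Rinv_0_lt_compat. }
    pose proof (T x1 P1) as T1. set (t := - (/ (p - x1) - / (q - x1))) in *.
    destruct (partial_sum_small (t / 2)) as [R0 HR]. lra.
    destruct (interval_data n1 x1 (Rmax R0 (Rabs x1)) E1 (Rmax_r _ _)) as [i [zeta [K [Hz Hin]]]].
    specialize (HR _ i zeta (S K) (Rmax_l _ _) Hz Hin).
    assert (B1 : (i <= n1 < i + Z.of_nat (S K))%Z) by (apply (Hin n1 x1 E1); apply Rmax_r).
    assert (Hk : (Z.to_nat (n1 - i) < S K)%nat) by lia.
    assert (Ek : zeta (Z.to_nat (n1 - i)) = x1).
    { pose proof (Hz _ Hk) as E. replace (i + Z.of_nat (Z.to_nat (n1 - i)))%Z with n1 in E by lia.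
      rewrite E1 in E. now injection E. }
    pose proof (rsum_ge_term (fun k => - (/ (p - zeta k) - / (q - zeta k))) (S K) (Z.to_nat (n1 - i))) as G.
    cbv beta in G. rewrite Ek, rsum_opp in G. fold t in G.
    assert (t <= - rsum (fun k => / (p - zeta k) - / (q - zeta k)) (S K)).
    { apply G; auto. intros k Hk2. left. apply T. apply (Out _ _ (Hz k Hk2)). }
    apply Rabs_le_between in HR. lra.
  - assert (Nz : forall x, f (RtoC x) <> RtoC 0).
    { intros x F. destruct (zero_listed x F) as [n Hn]. apply None. eauto. }
    set (m := (q + p) / 2). apply (Hno m). unfold m; lra.
    assert (E : (D (RtoC m) / f (RtoC m))%C = RtoC (- a)).
    { rewrite <- (log_derivative_at q) by auto. apply Cmod_all_le_eq. intros e He.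
      destruct (log_derivative_limit f z (RtoC q) (RtoC m) _ _ e Cf Gf If Zf Nq (Nz m) (Df _) (Df _) He) as [R0 HR].
      (* No [z n] is finite, so the empty sum is the admissible one. *)
      specialize (HR R0 0%Z (fun _ => 0) O (Rle_refl _)). simpl in HR.
      replace (D (RtoC m) / f (RtoC m) - D (RtoC q) / f (RtoC q))%C with
        (D (RtoC m) / f (RtoC m) - D (RtoC q) / f (RtoC q) - RtoC 0)%C by (unfold Cdiv; ring).
      apply HR. intros; lia. intros n x Hn. exfalso. eauto. }
    unfold h. replace (D (RtoC m)) with (D (RtoC m) / f (RtoC m) * f (RtoC m))%C.
    rewrite E, RtoC_opp. ring. field. apply Nz.
Qed.

Section Gaps.
Variables (n0 : Z) (x0 : R).
Hypothesis H0 : z n0 = Finite x0.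
Hypothesis Hx0 : q < x0 < p.

(** A zero of smaller index in [(q, x0]] would force a zero of [f' + a f] in [(q, p)]: by Rolle's
    theorem, or because [x0] would be multiple. *)
Lemma zeros_left (n : Z) (x : R) : (n < n0)%Z -> z n = Finite x -> x < q.
Proof.
  intros L E. destruct (zeros_ne n x E). pose proof (mon_le_R n n0 x x0 ltac:(lia) E H0).
  apply Rnot_le_lt. intros L2.
  destruct (Req_dec x x0) as [->|N].
  - apply (Hno x0); auto. apply (double_zero n n0); auto. lia.
  - destruct (zero_between x x0) as [c [Hc Hc2]]. lra. eapply listed_zero; eauto. eapply listed_zero; eauto.
    apply (Hno c); auto. lra.
Qed.

Lemma zeros_right (n : Z) (x : R) : (n0 < n)%Z -> z n = Finite x -> p < x.
Proof.
  intros L E. destruct (zeros_ne n x E). pose proof (mon_le_R n0 n x0 x ltac:(lia) H0 E).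
  apply Rnot_le_lt. intros L2.
  destruct (Req_dec x x0) as [->|N].
  - apply (Hno x0); auto. apply (double_zero n n0); auto. lia.
  - destruct (zero_between x0 x) as [c [Hc Hc2]]. lra. eapply listed_zero; eauto. eapply listed_zero; eauto.
    apply (Hno c); auto. lra.
Qed.

(* Shifting the second sum by one index pairs [p - z_{n+1}] with [q - z_n], which
   have the same sign and differ by the gap minus [p - q]. *)
Lemma shifted_sum_small (eps : R) : 0 < eps ->
  exists R0, Rabs x0 <= R0 /\ forall r, R0 <= r -> exists (i : Z) (zeta : nat -> R) (K : nat),
    (forall k, (k <= K)%nat -> z (i + Z.of_nat k)%Z = Finite (zeta k)) /\
    (forall n x, z n = Finite x -> (Rabs x <= r <-> (i <= n <= i + Z.of_nat K)%Z)) /\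
    (i <= n0 <= i + Z.of_nat K)%Z /\ zeta O < p /\ q < zeta K /\
    Rabs (/ (p - zeta O) - / (q - zeta K) + rsum (fun k => / (p - zeta (S k)) - / (q - zeta k)) K) <= eps.
Proof.
  intros He. destruct (partial_sum_small eps He) as [R0 HR].
  exists (Rmax R0 (Rabs x0)). split. apply Rmax_r. intros r Hr.
  pose proof (Rmax_l R0 (Rabs x0)). pose proof (Rmax_r R0 (Rabs x0)).
  destruct (interval_data n0 x0 r H0 ltac:(lra)) as [i [zeta [K [Hz Hin]]]].
  specialize (HR r i zeta (S K) ltac:(lra) Hz Hin). rewrite (rsum_shift (fun k => / (p - zeta k)) (fun k => / (q - zeta k))) in HR.
  assert (B0 : (i <= n0 < i + Z.of_nat (S K))%Z) by (apply (Hin n0 x0 H0); lra).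
  exists i, zeta, K. split; [|split; [|split; [|split; [|split]]]]; auto.
  - intros k Hk. apply Hz. lia.
  - intros n x E. rewrite (Hin n x E). lia.
  - lia.
  - pose proof (Hz O ltac:(lia)) as E. replace (i + Z.of_nat 0)%Z with i in E by lia.
    pose proof (mon_le_R i n0 _ x0 ltac:(lia) E H0). lra.
  - pose proof (Hz K ltac:(lia)) as E.
    pose proof (mon_le_R n0 (i + Z.of_nat K) x0 _ ltac:(lia) H0 E). lra.
Qed.

(** Passing [n0] is what the shift by one index accounts for: before it [x < q] and [y <= x0 < p],
    from it on [x >= x0 > q] and [y > p]. *)
Lemma consecutive_same_sign (n : Z) (x y : R) : z n = Finite x -> z (n + 1)%Z = Finite y ->
  0 < (p - y) * (q - x).
Proof.
  intros Ex Ey. destruct (Z_lt_le_dec n n0) as [L|L].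
  - pose proof (zeros_left n x L Ex). pose proof (mon_le_R (n + 1) n0 y x0 ltac:(lia) Ey H0).
    apply Rmult_lt_0_compat; lra.
  - pose proof (zeros_right (n + 1) y ltac:(lia) Ey). pose proof (mon_le_R n0 n x0 x ltac:(lia) H0 Ex).
    replace ((p - y) * (q - x)) with ((y - p) * (x - q)) by ring. apply Rmult_lt_0_compat; lra.
Qed.

(** Stated at every finite term in both directions, so that it also excludes a first and a last
    zero. *)
Definition equal_gaps : Prop := forall n x, z n = Finite x ->
  z (n + 1)%Z = Finite (x + (p - q)) /\ z (n - 1)%Z = Finite (x - (p - q)).

Lemma equal_gaps_of_steps :
  (forall n x, z n = Finite x -> is_finite (z (n + 1)%Z) /\ is_finite (z (n - 1)%Z)) ->
  (forall n x y, z n = Finite x -> z (n + 1)%Z = Finite y -> / (p - y) = / (q - x)) -> equal_gaps.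
Proof.
  intros HF HT.
  assert (St : forall n x y, z n = Finite x -> z (n + 1)%Z = Finite y -> y = x + (p - q)).
  { intros n x y Ex Ey. pose proof (HT n x y Ex Ey) as E. apply Rinv_eq_reg in E. lra. }
  intros n x E. destruct (HF n x E) as [F1 F2]. split.
  - rewrite <- F1 in *. f_equal. apply (St n); auto.
  - rewrite <- F2 in *. f_equal.
    pose proof (St (n - 1)%Z (real (z (n - 1)%Z)) x (eq_sym F2)) as Q.
    replace (n - 1 + 1)%Z with n in Q by lia. specialize (Q E). lra.
Qed.

Lemma index_at (i n : Z) (zeta : nat -> R) (K : nat) (x : R) :
  (forall k, (k <= K)%nat -> z (i + Z.of_nat k)%Z = Finite (zeta k)) ->
  z n = Finite x -> (i <= n <= i + Z.of_nat K)%Z -> zeta (Z.to_nat (n - i)) = x.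
Proof.
  intros Hz E L. pose proof (Hz (Z.to_nat (n - i)) ltac:(lia)) as Q.
  replace (i + Z.of_nat (Z.to_nat (n - i)))%Z with n in Q by lia. rewrite E in Q. now injection Q.
Qed.

Lemma gap_step (n : Z) (x y : R) : z n = Finite x -> z (n + 1)%Z = Finite y ->
  zero_gap z (Finite (y - x)).
Proof. intros Ex Ey. exists n. rewrite Ex, Ey. split; auto. left. reflexivity. Qed.

(** The end terms [/ (p - zeta O)] and [- / (q - zeta K)] are positive and the paired terms are
    nonnegative, so every one of them is bounded by the small total. *)
Lemma large_gaps_equal :
  (forall d, zero_gap z d -> Rbar_le (Finite (p - q)) d) -> equal_gaps.
Proof.
  intros HG.
  assert (Tpos : forall n x y, z n = Finite x -> z (n + 1)%Z = Finite y -> 0 <= / (p - y) - / (q - x)).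
  { intros n x y Ex Ey. pose proof (HG _ (gap_step n x y Ex Ey)) as L. simpl in L.
    pose proof (consecutive_same_sign n x y Ex Ey).
    assert (/ (q - x) <= / (p - y)); [|lra]. apply Rinv_le_of_ge_sign; lra. }
  assert (Sm : forall e n x, 0 < e -> z n = Finite x -> exists i zeta K,
    (forall k, (k <= K)%nat -> z (i + Z.of_nat k)%Z = Finite (zeta k)) /\
    (i <= n <= i + Z.of_nat K)%Z /\
    (forall y, z (n + 1)%Z = Finite y -> (n + 1 <= i + Z.of_nat K)%Z) /\
    zeta O < p /\ q < zeta K /\ / (p - zeta O) <= e /\ - / (q - zeta K) <= e /\
    forall k, (k < K)%nat -> / (p - zeta (S k)) - / (q - zeta k) <= e).
  { intros e n x He E. destruct (shifted_sum_small e He) as [R0 [HR0 HR]].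
    (* If the next term is infinite, [y1] is 0, which only affects the radius. *)
    set (y1 := real (z (n + 1)%Z)).
    destruct (HR (Rmax R0 (Rmax (Rabs x) (Rabs y1))) (Rmax_l _ _)) as [i [zeta [K [Hz [Hin [B0 [P1 [P2 HS]]]]]]]].
    pose proof (Rmax_r R0 (Rmax (Rabs x) (Rabs y1))). pose proof (Rmax_l (Rabs x) (Rabs y1)).
    pose proof (Rmax_r (Rabs x) (Rabs y1)).
    assert (Pk : forall k, (k < K)%nat -> 0 <= / (p - zeta (S k)) - / (q - zeta k)).
    { intros k Hk. apply (Tpos (i + Z.of_nat k)%Z). apply Hz; lia.
      replace (i + Z.of_nat k + 1)%Z with (i + Z.of_nat (S k))%Z by lia. apply Hz; lia. }
    pose proof (rsum_nonneg _ K Pk) as G.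
    assert (I1 : 0 < / (p - zeta O)) by (apply Rinv_0_lt_compat; lra).
    assert (I2 : 0 < - / (q - zeta K)).
    { replace (- / (q - zeta K)) with (/ (zeta K - q)) by (field; lra). apply Rinv_0_lt_compat; lra. }
    apply Rabs_le_between in HS.
    exists i, zeta, K. split; [|split; [|split; [|split; [|split; [|split; [|split]]]]]]; auto; try lra.
    - apply (Hin n x E). lra.
    - intros y Ey. apply (Hin (n + 1)%Z y Ey). unfold y1 in *. rewrite Ey in *. simpl in *. lra.
    - intros k Hk. pose proof (rsum_ge_term _ K k Pk Hk) as G2. cbv beta in G2. lra. }
  apply equal_gaps_of_steps.
  - intros n x E. split.
    (* If [x] were the last zero, it would end every window, and the end term would keep the fixed
       positive value [/ (x - q)]. The other bullet treats a first zero likewise. *)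
    + pose proof (Mon n) as L. rewrite E in L.
      destruct (z (n + 1)%Z) as [y| |] eqn:Ey; [reflexivity| |easy]. exfalso.
      assert (Key : forall e, 0 < e -> q < x /\ - / (q - x) <= e).
      { intros e He. destruct (Sm e n x He E) as [i [zeta [K [Hz [Bn [_ [_ [P2 [_ [Q2 _]]]]]]]]]].
        assert (EK : zeta K = x).
        { assert (n = (i + Z.of_nat K)%Z).
          { destruct (Z.eq_dec n (i + Z.of_nat K)) as [Q|Q]; auto. exfalso.
            pose proof (Hz (Z.to_nat (n + 1 - i)) ltac:(lia)) as Q3.
            replace (i + Z.of_nat (Z.to_nat (n + 1 - i)))%Z with (n + 1)%Z in Q3 by lia.
            rewrite Ey in Q3. easy. }
          pose proof (index_at i n zeta K x Hz E Bn) as Q3. now replace (Z.to_nat (n - i)) with K in Q3 by lia. }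
        rewrite EK in *. auto. }
      assert (Hxq : q < x) by (apply (Key 1); lra).
      assert (I2 : 0 < - / (q - x)).
      { replace (- / (q - x)) with (/ (x - q)) by (field; lra). apply Rinv_0_lt_compat; lra. }
      destruct (Key (- / (q - x) / 2)). lra. lra.
    + pose proof (mon_le (n - 1) n ltac:(lia)) as L. rewrite E in L.
      destruct (z (n - 1)%Z) as [y| |] eqn:Ey; [reflexivity|easy|]. exfalso.
      assert (Key : forall e, 0 < e -> x < p /\ / (p - x) <= e).
      { intros e He. destruct (Sm e n x He E) as [i [zeta [K [Hz [Bn [_ [P1 [_ [Q1 _]]]]]]]]].
        assert (EK : zeta O = x).
        { assert (n = i).
          { destruct (Z.eq_dec n i) as [Q|Q]; auto. exfalso.
            pose proof (Hz (Z.to_nat (n - 1 - i)) ltac:(lia)) as Q3.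
            replace (i + Z.of_nat (Z.to_nat (n - 1 - i)))%Z with (n - 1)%Z in Q3 by lia.
            rewrite Ey in Q3. easy. }
          pose proof (index_at i n zeta K x Hz E Bn) as Q3. now replace (Z.to_nat (n - i)) with O in Q3 by lia. }
        rewrite EK in *. auto. }
      assert (Hxp : x < p) by (apply (Key 1); lra).
      assert (I1 : 0 < / (p - x)) by (apply Rinv_0_lt_compat; lra).
      destruct (Key (/ (p - x) / 2)). lra. lra.
  - intros n x y Ex Ey. pose proof (Tpos n x y Ex Ey).
    apply Rle_antisym; [|lra]. apply Rnot_lt_le. intros L.
    destruct (Sm ((/ (p - y) - / (q - x)) / 2) n x) as [i [zeta [K [Hz [Bn [Bn1 [_ [_ [_ [_ Hk]]]]]]]]]]; auto. lra.
    specialize (Bn1 y Ey). specialize (Hk (Z.to_nat (n - i)) ltac:(lia)).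
    rewrite (index_at i n zeta K x Hz Ex Bn) in Hk.
    replace (S (Z.to_nat (n - i))) with (Z.to_nat (n + 1 - i)) in Hk by lia.
    rewrite (index_at i (n + 1) zeta K y Hz Ey) in Hk by lia. lra.
Qed.

(** The paired terms are now nonpositive while the end terms are positive, so signs alone do not
    decide. But there is no infinite gap, and bounded gaps make the end terms small for large
    [r]. *)
Lemma small_gaps_equal :
  (forall d, zero_gap z d -> Rbar_le d (Finite (p - q))) -> equal_gaps.
Proof.
  intros HG.
  assert (Fin : forall n x, z n = Finite x -> is_finite (z (n + 1)%Z) /\ is_finite (z (n - 1)%Z)).
  { intros n x E. split.
    - pose proof (Mon n) as L. rewrite E in L. destruct (z (n + 1)%Z) as [y| |] eqn:Ey; [reflexivity| |easy].
      exfalso. assert (G : zero_gap z p_infty).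
      { exists n. rewrite E, Ey. split. left; reflexivity. reflexivity. }
      apply HG in G. easy.
    - pose proof (mon_le (n - 1) n ltac:(lia)) as L. rewrite E in L.
      destruct (z (n - 1)%Z) as [y| |] eqn:Ey; [reflexivity|easy|].
      exfalso. assert (G : zero_gap z p_infty).
      { exists (n - 1)%Z. replace (n - 1 + 1)%Z with n by lia. rewrite E, Ey. split. right; reflexivity. reflexivity. }
      apply HG in G. easy. }
  assert (St : forall n x y, z n = Finite x -> z (n + 1)%Z = Finite y -> y - x <= p - q).
  { intros n x y Ex Ey. exact (HG _ (gap_step n x y Ex Ey)). }
  assert (Tneg : forall n x y, z n = Finite x -> z (n + 1)%Z = Finite y -> 0 <= - (/ (p - y) - / (q - x))).
  { intros n x y Ex Ey. pose proof (St n x y Ex Ey).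
    pose proof (consecutive_same_sign n x y Ex Ey).
    assert (/ (p - y) <= / (q - x)); [|lra]. apply Rinv_le_of_ge_sign; lra. }
  apply equal_gaps_of_steps; auto.
  intros n x y Ex Ey. pose proof (Tneg n x y Ex Ey).
  apply Rle_antisym; [lra|]. apply Rnot_lt_le. intros L.
  (* The end terms are at most [e] each and the total is at most [e] in modulus, so no paired term
     can reach [4 * e]. *)
  set (e := (- (/ (p - y) - / (q - x))) / 4). assert (He : 0 < e) by (unfold e; lra).
  destruct (shifted_sum_small e He) as [R0 [HR0 HR]].
  set (r := Rmax R0 (Rmax (Rmax (Rabs x) (Rabs y)) (/ e + Rabs p + Rabs q + 1))).
  destruct (HR r (Rmax_l _ _)) as [i [zeta [K [Hz [Hin [B0 [P1 [P2 HS]]]]]]]].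
  assert (Hr1 : R0 <= r) by apply Rmax_l.
  assert (Hr2 : Rmax (Rmax (Rabs x) (Rabs y)) (/ e + Rabs p + Rabs q + 1) <= r) by apply Rmax_r.
  pose proof (Rmax_l (Rmax (Rabs x) (Rabs y)) (/ e + Rabs p + Rabs q + 1)).
  pose proof (Rmax_r (Rmax (Rabs x) (Rabs y)) (/ e + Rabs p + Rabs q + 1)).
  pose proof (Rmax_l (Rabs x) (Rabs y)). pose proof (Rmax_r (Rabs x) (Rabs y)).
  assert (Ie : 0 < / e) by now apply Rinv_0_lt_compat.
  pose proof (Rle_abs p). pose proof (Rle_abs (- q)) as Hq'. rewrite Rabs_Ropp in Hq'.
  (* The zero just before the window is at most [x0] and exceeds [r] in modulus, so it is below
     [- r]; [zeta O] is at most [p - q] further. *)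
  assert (HB1 : zeta O < p - q - r).
  { pose proof (Hz O ltac:(lia)) as E0. replace (i + Z.of_nat 0)%Z with i in E0 by lia.
    destruct (Fin i _ E0) as [_ F]. unfold is_finite in F. symmetry in F.
    pose proof (St (i - 1)%Z _ (zeta O) F) as S1. replace (i - 1 + 1)%Z with i in S1 by lia. specialize (S1 E0).
    pose proof (mon_le_R (i - 1) n0 _ x0 ltac:(lia) F H0) as M1.
    set (u := real (z (i - 1)%Z)) in *.
    assert (Hu : r < Rabs u). { apply Rnot_le_lt. intros Q. apply (Hin _ _ F) in Q. lia. }
    apply Rabs_le_between in HR0. unfold Rabs in Hu. destruct (Rcase_abs u); lra. }
  assert (HB2 : r - (p - q) < zeta K).
  { pose proof (Hz K ltac:(lia)) as E0.
    destruct (Fin _ _ E0) as [F _]. unfold is_finite in F. symmetry in F.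
    pose proof (St _ _ _ E0 F) as S1.
    pose proof (mon_le_R n0 (i + Z.of_nat K + 1) x0 _ ltac:(lia) H0 F) as M1.
    set (u := real (z (i + Z.of_nat K + 1)%Z)) in *.
    assert (Hu : r < Rabs u). { apply Rnot_le_lt. intros Q. apply (Hin _ _ F) in Q. lia. }
    apply Rabs_le_between in HR0. unfold Rabs in Hu. destruct (Rcase_abs u); lra. }
  assert (I1 : / (p - zeta O) <= e).
  { rewrite <- (Rinv_inv e). apply Rinv_le_contravar; auto. pose proof (Rabs_pos p). lra. }
  assert (I2 : - / (q - zeta K) <= e).
  { replace (- / (q - zeta K)) with (/ (zeta K - q)) by (field; lra).
    rewrite <- (Rinv_inv e). apply Rinv_le_contravar; auto. pose proof (Rabs_pos q). lra. }
  assert (Pk : forall k, (k < K)%nat -> 0 <= - (/ (p - zeta (S k)) - / (q - zeta k))).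
  { intros k Hk. apply (Tneg (i + Z.of_nat k)%Z). apply Hz; lia.
    replace (i + Z.of_nat k + 1)%Z with (i + Z.of_nat (S k))%Z by lia. apply Hz; lia. }
  assert (Bn : (i <= n <= i + Z.of_nat K)%Z) by (apply (Hin n x Ex); lra).
  assert (Bn1 : (i <= n + 1 <= i + Z.of_nat K)%Z) by (apply (Hin (n + 1)%Z y Ey); lra).
  pose proof (rsum_ge_term _ K (Z.to_nat (n - i)) Pk ltac:(lia)) as G. cbv beta in G.
  rewrite rsum_opp in G.
  rewrite (index_at i n zeta K x Hz Ex Bn) in G.
  replace (S (Z.to_nat (n - i))) with (Z.to_nat (n + 1 - i)) in G by lia.
  rewrite (index_at i (n + 1) zeta K y Hz Ey) in G by lia.
  apply Rabs_le_between in HS. unfold e in *. lra.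
Qed.

Lemma equal_gaps_arithmetic : equal_gaps -> forall n, z n = Finite ((x0 - IZR n0 * (p - q)) + IZR n * (p - q)).
Proof.
  intros HE.
  assert (Up : forall k, z (n0 + Z.of_nat k)%Z = Finite (x0 + INR k * (p - q))).
  { induction k as [|k IH]. replace (n0 + Z.of_nat 0)%Z with n0 by lia. rewrite H0. f_equal. simpl. ring.
    replace (n0 + Z.of_nat (S k))%Z with (n0 + Z.of_nat k + 1)%Z by lia.
    rewrite (proj1 (HE _ _ IH)), S_INR. f_equal. ring. }
  assert (Dn : forall k, z (n0 - Z.of_nat k)%Z = Finite (x0 - INR k * (p - q))).
  { induction k as [|k IH]. replace (n0 - Z.of_nat 0)%Z with n0 by lia. rewrite H0. f_equal. simpl. ring.
    replace (n0 - Z.of_nat (S k))%Z with (n0 - Z.of_nat k - 1)%Z by lia.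
    rewrite (proj2 (HE _ _ IH)), S_INR. f_equal. ring. }
  intros n. destruct (Z_le_gt_dec n0 n) as [L|L].
  - pose proof (Up (Z.to_nat (n - n0))) as E. replace (n0 + Z.of_nat (Z.to_nat (n - n0)))%Z with n in E by lia.
    rewrite E, INR_IZR_INZ, Z2Nat.id, minus_IZR by lia. f_equal. ring.
  - pose proof (Dn (Z.to_nat (n0 - n))) as E. replace (n0 - Z.of_nat (Z.to_nat (n0 - n)))%Z with n in E by lia.
    rewrite E, INR_IZR_INZ, Z2Nat.id, minus_IZR by lia. f_equal. ring.
Qed.

Lemma equal_gaps_gap : equal_gaps -> forall d, zero_gap z d <-> d = Finite (p - q).
Proof.
  intros HE. pose proof (equal_gaps_arithmetic HE) as A.
  assert (E : forall n, Rbar_minus (z (n + 1)%Z) (z n) = Finite (p - q)).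
  { intros n. rewrite !A, plus_IZR. unfold Rbar_minus; simpl. f_equal. ring. }
  intros d. split.
  - intros [n [_ ->]]. apply E.
  - intros ->. exists n0. split. left. now rewrite H0. now rewrite E.
Qed.
End Gaps.
End NonZero.
End Main.

(** * Infimum and supremum of the gaps *)

Lemma Rbar_glb_correct (E : Rbar -> Prop) : Rbar_is_glb E (Rbar_glb E).
Proof. unfold Rbar_glb. now destruct (Rbar_ex_glb E). Qed.

Lemma Rbar_lub_correct (E : Rbar -> Prop) : Rbar_is_lub E (Rbar_lub E).
Proof. unfold Rbar_lub. now destruct (Rbar_ex_lub E). Qed.

Theorem theorem2p3 :
  forall (f : C -> C) (z : Z -> Rbar) (a q p : R),
    entire f ->
    has_order f 1 ->
    (forall x : R, Im (f (RtoC x)) = 0) ->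
    (forall w : C, f w = 0%C -> Im w = 0) ->
    lists_zeros f z ->
    consecutive_real_zeros (fun w : C => (C_derive f w + RtoC a * f w)%C) q p ->
    (Rbar_le (Rbar_glb (zero_gap z)) (Finite (p - q)) /\
     Rbar_le (Finite (p - q)) (Rbar_lub (zero_gap z))) /\
    ((forall w : C, f w = 0%C -> has_multiplicity f w 1) ->
     (Rbar_glb (zero_gap z) = Finite (p - q) \/
      Finite (p - q) = Rbar_lub (zero_gap z)) ->
     (Rbar_glb (zero_gap z) = Finite (p - q) /\
      Finite (p - q) = Rbar_lub (zero_gap z)) /\
     exists A B C0 D : R,
       forall w : C,
         f w = (RtoC A * Cexp (RtoC B * w) * Ccos (RtoC C0 * w + RtoC D))%C).
Proof.
  intros f z a q p Ef Of Rf If Lz [Hqp [Hq [Hp Hno]]].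
  pose proof (entire_centire f Ef) as Cf. pose proof (has_order_1_small_growth f Cf Of) as Gf.
  pose proof (lists_zeros_outside f z Lz) as Zf. destruct Lz as [Mon _].
  destruct (Rbar_glb_correct (zero_gap z)) as [Glb1 Glb2].
  destruct (Rbar_lub_correct (zero_gap z)) as [Lub1 Lub2].
  assert (Core : f (RtoC q) <> RtoC 0 -> f (RtoC p) <> RtoC 0 ->
    exists n0 x0, z n0 = Finite x0 /\ q < x0 < p) by (intros; eapply zero_in_between; eauto).
  split.
  - destruct (classic (f (RtoC q) = RtoC 0 \/ f (RtoC p) = RtoC 0)) as [F|F].
    + assert (G0 : zero_gap z (Finite 0)).
      { destruct F as [F|F]; [apply (double_zero_gap f z a Ef Mon Zf q F Hq)|
          apply (double_zero_gap f z a Ef Mon Zf p F Hp)]. }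
      split.
      * eapply Rbar_le_trans. apply Glb1. exact G0. simpl. lra.
      * assert (G : exists d, zero_gap z d /\ Rbar_le (Finite (p - q)) d).
        { destruct F as [F|F]; [eapply gap_at_multiple_left | eapply gap_at_multiple_right]; eauto. }
        destruct G as [d [G1 G2]]. eapply Rbar_le_trans. apply G2. now apply Lub1.
    + apply not_or_and in F. destruct F as [Nq Np].
      destruct (Core Nq Np) as [n0 [x0 [H0 Hx0]]].
      (* If [p - q] were below the infimum or above the supremum, all gaps would equal [p - q] by
         the corresponding lemma; then [p - q] is itself a gap, a contradiction. *)
      split; apply Rbar_not_lt_le; intros L.
      * assert (E : equal_gaps z q p).
        { eapply large_gaps_equal; eauto. intros d Hd. eapply Rbar_le_trans. apply Rbar_lt_le, L. now apply Glb1. }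
        apply (Rbar_lt_not_le _ _ L). apply Glb1. eapply equal_gaps_gap; eauto.
      * assert (E : equal_gaps z q p).
        { eapply small_gaps_equal; eauto. intros d Hd. eapply Rbar_le_trans. now apply Lub1. now apply Rbar_lt_le. }
        apply (Rbar_lt_not_le _ _ L). apply Lub1. eapply equal_gaps_gap; eauto.
  - intros Simple HE.
    (* At a simple zero of [f] the value of [f' + a f] is [f'], which is the nonzero value of the
       cofactor. Hence [q] and [p] are not zeros of [f]. *)
    assert (N : forall x, (C_derive f (RtoC x) + RtoC a * f (RtoC x))%C = RtoC 0 -> f (RtoC x) <> RtoC 0).
    { intros x Hx F. destruct (Simple _ F) as [k [Ek [Nk E]]]. apply Nk.
      assert (Dk : cderiv f (RtoC x) (k (RtoC x))).
      { apply cderiv_ext with (fun w => ((w - RtoC x) * k w)%C). intros v. rewrite E. simpl. ring.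
        eapply cderiv_eq. apply cderiv_mult. apply cderiv_minus. apply cderiv_id. apply cderiv_const.
        now apply entire_cderiv. cbv beta. ring. }
      rewrite F, (cderiv_unique _ _ _ _ (entire_cderiv f (RtoC x) Ef) Dk) in Hx. rewrite <- Hx. ring. }
    pose proof (N q Hq) as Nq. pose proof (N p Hp) as Np.
    destruct (Core Nq Np) as [n0 [x0 [H0 Hx0]]].
    assert (EG : equal_gaps z q p).
    { destruct HE as [HE|HE].
      - eapply large_gaps_equal; eauto. intros d Hd. rewrite <- HE. now apply Glb1.
      - eapply small_gaps_equal; eauto. intros d Hd. rewrite HE. now apply Lub1. }
    pose proof (equal_gaps_gap z q p n0 x0 H0 EG) as GG.
    split.
    + split.
      * apply Rbar_is_glb_unique. split.
        intros d Hd. apply GG in Hd. rewrite Hd. apply Rbar_le_refl.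
        intros b Hb. apply Hb. now apply GG.
      * symmetry. apply Rbar_is_lub_unique. split.
        intros d Hd. apply GG in Hd. rewrite Hd. apply Rbar_le_refl.
        intros b Hb. apply Hb. now apply GG.
    (* [- a] is the logarithmic derivative of [f] at [q]. *)
    + apply (arithmetic_zeros_cosine f z (x0 - IZR n0 * (p - q)) (p - q) q (- a)); auto. lra.
      apply equal_gaps_arithmetic; auto.
      eapply cderiv_eq. now apply entire_cderiv.
      replace (C_derive f (RtoC q)) with ((C_derive f (RtoC q) + RtoC a * f (RtoC q)) - RtoC a * f (RtoC q))%C by ring.
      rewrite Hq, RtoC_opp. ring.
Qed.
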